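(* Consider the scalar conservation law $\partial_tu+\partial_xf(u)=0$ with the non-convex flux $f(u)=\frac12(u^3-3u)$. 1) For any $u_B\in\mathcal U=\mathbb{R}$, the sets of admissible boundary values $\mathcal E^{\text{entropy}}_{\text{viscosity}}(u_B)$, $\mathcal E^{\text{layer}}_{\text{Godunov}}(u_B)$ and $\mathcal E^{\text{entropy}}_{\text{Godunov}}(u_B)$ coincide with $$\mathcal E^{\text{Riemann}}(u_B)=\begin{cases}\{u_B\}&\text{if }u_B<-2,\\\{-2,1\}&\text{if }u_B=-2,\\ [u_B^s,1]\cup\{u_B\}&\text{if }-2<u_B<-1,\\ [-1,1]&\text{if }-1\le u_B\le1,\\ [-1,u_B^\ell]\cup\{u_B\}&\text{if }1<u_B<2,\\\{2,-1\}&\text{if }u_B=2,\\\{u_B\}&\text{if }u_B>2,\end{cases}$$ and $$\mathcal E^{\text{layer}}_{\text{viscosity}}(u_B)=\mathcal E^{\text{Riemann}}(u_B)\setminus E(u_B).$$ 2) Given any state $u_B\in\mathcal U=[-M,M]$ for a fixed value $M>2$, set $\|f'\|_\infty=\sup_{w\in[-8M,8M]}|f'(w)|$ and consider a Lax–Friedrichs type scheme with coefficients $\lambda$ and $Q$ satisfying $\|f'\|_\infty\lambda/Q\le1$. Then $$\mathcal E^{\text{layer}}_{\text{Lax}}(u_B)\cap[-M,M]=\bigl(\mathcal E^{\text{Riemann}}(u_B)\cap[-M,M]\bigr)\setminus E(u_B),$$ $$\mathcal E^{\text{entropy}}_{\text{Lax}}(u_B)\cap[-M,M]=\mathcal E^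{\text{Riemann}}(u_B)\cap[-M,M].$$
   Context: For $u_B\in(-2,-1)\cup(1,2)$ the equation $f(u)=f(u_B)$, $u\ne u_B$, has exactly two solutions; $u_B^\ell$ and $u_B^s$ denote the largest and the smallest of them. The set $E(u_B)$ is $$E(u_B)=\begin{cases}\emptyset&\text{if }u_B\in(-\infty,-2)\cup[-1,1]\cup(2,\infty),\\\{1\}&\text{if }u_B=-2,\\\{u_B^s\}&\text{if }-2<u_B<-1,\\\{u_B^\ell\}&\text{if }1<u_B<2,\\\{-1\}&\text{if }u_B=2.\end{cases}$$ Convex entropy pairs are pairs $(U,F)$ of $C^2$ functions with $U''\ge0$ and $F'=U'f'$. $R(v,w)$ is the value at $x/t=0+$ of the entropy solution of the Riemann problem for the conservation law with left data $v$ and right data $w$, and $\mathcal E^{\text{Riemann}}(u_B)=\{R(u_B,w):w\in\mathbb{R}\}$. The viscosity coefficient $B(u)>0$ is smooth (e.g. $B\equiv1$). Definitions of the sets (states are in $\mathcal U$): - $\mathcal E^{\text{entropy}}_{\text{viscosity}}(u_B)$: all $u_0$ with $F(u_B)+U'(u_B)(f(u_0)-f(u_B))\ge F(u_0)$ for all convex entropy pairs $(U,F)$ (for scalar equations with $B>0$, $B$-convexity of $U$, i.e. $U''B>0$, amounts to strict convexity). - $\mathcal E^{\text{layer}}_{\text{viscosity}}(u_B)$: all $v_\infty$ such that $B(v)\,\partial_yv=f(v)-f(v_\infty)$, $v(0)=u_B$, $\lim_{y\to\infty}v(y)=v_\infty$ has a smooth solution on $y\ge0$. - For a scheme with numerical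 flux $g$ and numerical entropy flux $G$: $\mathcal E^{\text{entropy}}_{\text{scheme}}(u_B)$ is the set of $u_0$ for which there exists $v_1$ with $G(u_B,v_1)\ge F(u_0)$ for all convex entropy pairs $(U,F)$; $\mathcal E^{\text{layer}}_{\text{scheme}}(u_B)$ is the set of $v_\infty$ such that $g(v(y),v(y+1))=f(v_\infty)$ for $y\ge0$, $v(y)=u_B$ for $y\in[0,1)$, $\lim_{y\to\infty}v(y)=v_\infty$ has a piecewise constant solution $v(y)\in\mathcal U$, $y\ge0$ (constant on each $[k,k+1)$). - Godunov: $g(v,w)=f(R(v,w))$, $G(v,w)=F(R(v,w))$. - Lax (Lax–Friedrichs type): $g(v,w)=\tfrac12(f(v)+f(w))-\tfrac Q\lambda(w-v)$, $G(v,w)=\tfrac12(F(v)+F(w))-\tfrac Q\lambda(U(w)-U(v))$, where $Q\in(0,1)$ and $\lambda>0$ is the mesh ratio. In part 2 the sets for the Lax scheme are taken with $\mathcal U=[-M,M]$, while $\mathcal E^{\text{Riemann}}(u_B)$ is the set given in part 1. *)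

(* Defs.v *)
From HB Require Import structures.
From mathcomp Require Import all_boot all_order all_algebra.
From mathcomp Require Import all_classical all_reals all_analysis.

Set Implicit Arguments.
Unset Strict Implicit.
Unset Printing Implicit Defensive.

Import Order.TTheory GRing.Theory Num.Theory.
Import numFieldNormedType.Exports.

Local Open Scope classical_set_scope.
Local Open Scope ring_scope.

Definition flux (R : realType) (u : R) : R := (u ^+ 3 - 3 * u) / 2.

Definition C2 (R : realType) (g : R -> R) : Prop :=
  [/\ forall x, derivable g x 1,
      forall x, derivable (derive1 g) x 1
    & continuous (derive1n 2 g)].

Definition smooth (R : realType) (g : R -> R) : Prop :=
  forall n x, derivable (derive1n n g) x 1.

(* Smoothness up to the boundary of [0, +oo[.  The values of [g] on ]-oo, 0[
   are irrelevant: every smooth function on [0, +oo[ has an extension to the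
   line which satisfies this, and conversely. *)
Definition smooth_ge0 (R : realType) (g : R -> R) : Prop :=
  forall n y, 0 <= y -> derivable (derive1n n g) y 1.

Definition convex_entropy_pair (R : realType) (U F : R -> R) : Prop :=
  [/\ C2 U, C2 F, forall u, 0 <= derive1n 2 U u
    & forall u, derive1 F u = derive1 U u * derive1 (@flux R) u].

Definition partial_t (R : realType) (phi : R -> R -> R) (t x : R) : R :=
  derive1 (fun s => phi s x) t.

Definition partial_x (R : realType) (phi : R -> R -> R) (t x : R) : R :=
  derive1 (phi t) x.

(* Nonnegative C^1 functions of (t, x) with compact support in the open
   half-plane t > 0. *)
Definition test_function (R : realType) (phi : R -> R -> R) : Prop :=
  [/\ forall t x, derivable (fun s => phi s x) t 1 /\ derivable (phi t) x 1,
      continuous (fun p : R * R => partial_t phi p.1 p.2),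
      continuous (fun p : R * R => partial_x phi p.1 p.2),
      forall t x, 0 <= phi t x
    & exists a b : R, 0 < a /\
        forall t x, phi t x != 0 -> a <= t <= b /\ `|x| <= b].

(* Points are pairs (t, x). *)
Definition half_plane (R : realType) : set (R * R) := [set p | 0 < p.1].

(* Kruzkov's definition: a bounded measurable function on t > 0 which satisfies
   d_t U(u) + d_x F(u) <= 0 in the sense of distributions for every convex
   entropy pair and assumes its initial data in L^1_loc.  The conservation law
   itself is the case of the pairs (id, flux) and (- id, - flux). *)
Definition entropy_solution (R : realType) (u : R -> R -> R) (u0 : R -> R) :
    Prop :=
  [/\ measurable_fun (@half_plane R)
        (fun p : measurableTypeR R * measurableTypeR R => u p.1 p.2),
      exists C : R, forall t x, 0 < t -> `|u t x| <= C,
      forall U F : R -> R, convex_entropy_pair U F ->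
      forall phi : R -> R -> R, test_function phi ->
        (0 <= \int[(@lebesgue_measure R \x @lebesgue_measure R)%E]_(p in
                    @half_plane R)
                (U (u p.1 p.2) * partial_t phi p.1 p.2 +
                 F (u p.1 p.2) * partial_x phi p.1 p.2)%R%:E)%E
    & forall r : R, 0 < r ->
        (\int[@lebesgue_measure R]_(x in [set` `[(- r)%R, r]%R])
           (`|u t x - u0 x|)%R%:E)%E @[t --> 0^'+] --> 0%E].

(* [r] is the value at x/t = 0+ of the self-similar entropy solution
   (t, x) |-> z (x / t) with left data [v] and right data [w]. *)
Definition riemann_trace (R : realType) (v w r : R) : Prop :=
  exists z : R -> R,
    entropy_solution (fun t x => z (x / t)) (fun x => if x < 0 then v else w) /\
    z xi @[xi --> 0^'+] --> r.

(* The Riemann problem is uniquely solvable, so that [riemann_trace v w] holds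
   of exactly one state; the default value 0 plays no role. *)
Definition riemann_value (R : realType) (v w : R) : R :=
  xget 0 [set r | riemann_trace v w r].

Definition E_riemann (R : realType) (uB : R) : set R :=
  [set riemann_value uB w | w in setT].

(* In the definitions below [S] is the set of states. *)

Definition E_entropy_viscosity (R : realType) (S : set R) (uB : R) : set R :=
  [set u0 | S u0 /\
     forall U F : R -> R, convex_entropy_pair U F ->
       F uB + derive1 U uB * (flux u0 - flux uB) >= F u0].

Definition E_layer_viscosity (R : realType) (S : set R) (B : R -> R) (uB : R) :
    set R :=
  [set vinf | S vinf /\ exists v : R -> R,
     [/\ smooth_ge0 v,
         forall y, 0 <= y -> S (v y),
         forall y, 0 <= y -> B (v y) * derive1 v y = flux (v y) - flux vinf,
         v 0 = uB
       & v y @[y --> +oo] --> vinf]].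

Definition E_entropy_scheme (R : realType) (S : set R)
    (G : (R -> R) -> (R -> R) -> R -> R -> R) (uB : R) : set R :=
  [set u0 | S u0 /\ exists v1, S v1 /\
     forall U F : R -> R, convex_entropy_pair U F -> G U F uB v1 >= F u0].

Definition E_layer_scheme (R : realType) (S : set R) (g : R -> R -> R)
    (uB : R) : set R :=
  [set vinf | S vinf /\ exists v : R -> R,
     [/\ forall y, 0 <= y -> S (v y),
         forall (k : nat) y, k%:R <= y < k.+1%:R -> v y = v k%:R,
         forall y, 0 <= y -> g (v y) (v (y + 1)) = flux vinf,
         forall y, 0 <= y < 1 -> v y = uB
       & v y @[y --> +oo] --> vinf]].

Definition godunov_flux (R : realType) (v w : R) : R :=
  flux (riemann_value v w).

Definition godunov_entropy_flux (R : realType) (U F : R -> R) (v w : R) : R :=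
  F (riemann_value v w).

Definition lax_flux (R : realType) (Q lambda v w : R) : R :=
  (flux v + flux w) / 2 - Q / lambda * (w - v).

Definition lax_entropy_flux (R : realType) (Q lambda : R) (U F : R -> R)
    (v w : R) : R :=
  (F v + F w) / 2 - Q / lambda * (U w - U v).

Definition other_states (R : realType) (uB : R) : set R :=
  [set u | flux u = flux uB /\ u != uB].

(* For 1 < |uB| < 2 the set [other_states uB] has exactly two elements, of
   which these are the largest and the smallest. *)
Definition uB_l (R : realType) (uB : R) : R := sup (other_states uB).
Definition uB_s (R : realType) (uB : R) : R := inf (other_states uB).

Definition E_exc (R : realType) (uB : R) : set R :=
  if uB == - 2 then [set 1]
  else if - 2 < uB < - 1 then [set uB_s uB]
  else if 1 < uB < 2 then [set uB_l uB]
  else if uB == 2 then [set - 1]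
  else set0.

Definition E_formula (R : realType) (uB : R) : set R :=
  if uB < - 2 then [set uB]
  else if uB == - 2 then [set - 2; 1]
  else if uB < - 1 then [set` `[uB_s uB, 1]] `|` [set uB]
  else if uB <= 1 then [set` `[- 1, 1]]
  else if uB < 2 then [set` `[- 1, uB_l uB]] `|` [set uB]
  else if uB == 2 then [set 2; - 1]
  else [set uB].

Definition sup_flux' (R : realType) (M : R) : R :=
  sup [set `|derive1 (@flux R) w| | w in `[- (8 * M), 8 * M]].

(* Main.v *)
Require Import Defs.
From HB Require Import structures.
From mathcomp Require Import all_boot all_order all_algebra.
From mathcomp Require Import all_classical all_reals all_analysis.
From mathcomp Require Import measurable_realfun.
From mathcomp Require Import ring lra.

Set Implicit Arguments.
Unset Strict Implicit.
Unset Printing Implicit Defensive.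

Import Order.TTheory GRing.Theory Num.Theory.
Import numFieldNormedType.Exports.

Local Open Scope classical_set_scope.
Local Open Scope ring_scope.

(** All the sets of boundary values are described by one condition, [bln uB u0]:
    [f u0] is the minimum of [f] over the segment from [uB] to [u0] when
    [uB <= u0], and the maximum when [u0 <= uB].  It is Oleinik's condition for
    the waves between the boundary state and the trace [u0] to have nonpositive
    speed.  Requiring strict inequality at every state other than [u0] gives
    [strict_bln uB u0].  For the cubic flux, [f s - f u] has the sign of
    [(s - u) * (s ^ 2 + s u + u ^ 2 - 3)], so both conditions become quadratic
    inequalities; these give the explicit list of the theorem
    ([E_formula_bln]), and the exceptional set consists of the states [u0] with
    [f u0 = f uB] that are joined to [uB] by a stationary shock
    ([E_exc_strict_bln]).  There remains to see that each approximation selects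
    [bln] or [strict_bln].

    Entropy sets.  Tested with entropies close to Kruzkov's [|s - k|], for [k]
    between [uB] and [u0], the boundary inequalities give [bln] in the limit.
    Conversely, [entropy_dissipation] shows that an inequality between the
    values of [f s - xi s] yields an entropy inequality for all convex pairs at
    once; this gives the viscous set with [xi = 0], and the Lax-Friedrichs set
    with [xi = - 2 Q / lambda] and [xi = 0], after the choice of the state [v1]
    for which the numerical flux is [f u0].

    Layer sets.  A viscous or a Lax-Friedrichs layer with limit [u0 > uB] cannot
    cross a state [s < u0] with [f s <= f u0], because the flow or the scheme
    pushes it back; hence its limit satisfies [strict_bln].  A Godunov layer is
    only stopped by the states with [f s < f u0], and its limit satisfies [bln].
    Conversely the layers are constructed: by inverting the travel time of the
    ordinary differential equation ([orbit_to_rest_point]), by monotone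
    iteration ([lax_layer_up]), and in a single step for Godunov's scheme.

    The Riemann problem.  The sets of Godunov's scheme and of the Riemann problem
    need the value at [x / t = 0+] of the entropy solution; by
    [riemann_value_interface_state] it is the extremal point of [f] between the
    data, the one closest to the right datum if there are several.  For
    existence, with [v <= w], the profile [z xi] is any minimiser of
    [f s - xi s] over [v <= s <= w].  On rays, the weak form of the entropy
    inequality becomes the one-dimensional inequality
    [(F (z) - xi U (z))' + U (z) <= 0] ([weak_form_rays]), which follows from
    the minimality by translation and [entropy_dissipation]
    ([minimiser_entropy]).  For uniqueness, the same one-dimensional inequality,
    localised between two Lebesgue points of an arbitrary profile, says that
    [F (z) - xi U (z)] decreases, at least at the rate [U (z)]
    ([entropy_decrease]).  Applied to the affine entropies and to Kruzkov's, it
    shows that [slack k xi = f (z xi) - f k - xi (z xi - k)] is Lipschitz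
    continuous on the Lebesgue points and that [sg (z xi - k) * slack k xi] is nonincreasing.  The
    initial condition fixes the signs of [slack k] far away, and these facts
    leave no freedom: [slack k <= 0] for [k] between the data, and no value of
    [z] at a Lebesgue point lies outside the data.  At [xi = 0+] this says that
    the trace minimises the flux. *)

(** * Calculus on the line *)

(** The definition of the derivative with a remainder: the usual way to
    differentiate a function of two variables along a curve. *)
Lemma is_derive_eps (R : realType) (f : R -> R) (x d : R) :
  (forall e : R, 0 < e -> exists2 r : R, 0 < r &
     forall h, `|h| < r -> `|f (x + h) - f x - d * h| <= e * `|h|) ->
  is_derive x 1 f d.
Proof.
move=> H.
have cv : h^-1 *: ((f \o shift x) (h *: (1 : R)) - f x) @[h --> (0:R)^'] --> d.
  apply/cvgrPdist_le => e e0; have [r r0 Hr] := H e e0.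
  near=> h.
  have h0 : h != 0 by near: h; exact: nbhs_dnbhs_neq.
  rewrite /= /GRing.scale/= mulr1.
  have -> : d - h^-1 * (f (h + x) - f x) = - (h^-1 * (f (x + h) - f x - d * h)).
    by rewrite (addrC h x); field.
  rewrite normrN normrM normfV ler_pdivrMl ?normr_gt0// [leRHS]mulrC; apply: Hr.
  by near: h; exact: dnbhs0_lt.
split; first exact/cvg_ex/(ex_intro _ d).
exact/cvg_lim.
Unshelve. all: by end_near. Qed.

Lemma is_derive_quadratic (R : realType) (f : R -> R) (x d K : R) :
  (forall h, `|f (x + h) - f x - d * h| <= K * h ^+ 2) ->
  is_derive x 1 f d.
Proof.
move=> H; have K0 : 0 <= K.
  by have := le_trans (normr_ge0 _) (H 1); rewrite expr1n mulr1.
apply: is_derive_eps => e e0; exists (e / (K + 1)); first by rewrite divr_gt0// ltr_wpDl.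
move=> h; rewrite ltr_pdivlMr ?ltr_wpDl// => hK; apply: (le_trans (H h)).
rewrite -[h ^+ 2]ger0_norm ?sqr_ge0// normrX.
by have := normr_ge0 h; nra.
Qed.

Section calculus.
Context {R : realType}.
Implicit Types (f g : R -> R) (x a b c d k : R).

Lemma is_derive_derive1 f x d : is_derive x 1 f d -> derive1 f x = d.
Proof. by move=> H; rewrite derive1E; exact: derive_val. Qed.

Lemma is_derive_continuous f x d : is_derive x 1 f d -> {for x, continuous f}.
Proof. by move=> H; apply/differentiable_continuous/derivable1_diffP. Qed.

Lemma derivable_is_derive f x : derivable f x 1 -> is_derive x 1 f (derive1 f x).
Proof. by move=> H; rewrite derive1E; exact: derivableP. Qed.

Lemma derD f g x a b : is_derive x 1 f a -> is_derive x 1 g b ->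
  is_derive x 1 (fun y => f y + g y) (a + b).
Proof. by move=> df dg; exact: is_deriveD. Qed.

Lemma derN f x a : is_derive x 1 f a -> is_derive x 1 (fun y => - f y) (- a).
Proof. by move=> df; exact: is_deriveN. Qed.

Lemma derB f g x a b : is_derive x 1 f a -> is_derive x 1 g b ->
  is_derive x 1 (fun y => f y - g y) (a - b).
Proof. by move=> df dg; exact: is_deriveB. Qed.

Lemma derM f g x a b : is_derive x 1 f a -> is_derive x 1 g b ->
  is_derive x 1 (fun y => f y * g y) (a * g x + f x * b).
Proof.
move=> df dg; apply: is_derive_eq (is_deriveM df dg) _.
by rewrite addrC /GRing.scale/= [g x * a]mulrC.
Qed.

Lemma derZ k f x a : is_derive x 1 f a -> is_derive x 1 (fun y => k * f y) (k * a).
Proof. by move=> df; exact: is_deriveZ. Qed.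

Lemma der_cst k x : is_derive x 1 (fun=> k : R) 0.
Proof. exact: is_derive_cst. Qed.

Lemma der_id x : is_derive x 1 (fun y : R => y) 1.
Proof. exact: is_derive_id. Qed.

Lemma der_comp f g x a b : is_derive x 1 g a -> is_derive (g x) 1 f b ->
  is_derive x 1 (fun y => f (g y)) (b * a).
Proof.
by move=> dg df; exact: is_derive1_comp.
Qed.

Lemma der_eq f x a b : is_derive x 1 f a -> a = b -> is_derive x 1 f b.
Proof. by move=> + <-. Qed.

Lemma is_derive_eq0_far f (df : R -> R) N : (forall x, is_derive x 1 f (df x)) ->
  (forall x, N < `|x| -> f x = 0) -> forall x, N < `|x| -> df x = 0.
Proof.
move=> dfx f0 x Nx; rewrite -(is_derive_derive1 (dfx x)); apply: is_derive_derive1.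
apply: near_eq_is_derive (der_cst 0 x).
have cn : `|y| @[y --> x] --> `|x| by exact: norm_continuous.
have : \forall y \near x, N < `|y| by exact: (cn _ (lt_nbhsr Nx)).
by apply: filterS => y yN; rewrite f0.
Qed.

Lemma derive_ge0_le f (df : R -> R) a b : a <= b ->
  (forall x, a <= x <= b -> is_derive x 1 f (df x)) ->
  (forall x, a <= x <= b -> 0 <= df x) -> f a <= f b.
Proof.
move=> ab H H0.
have [] := @MVT_segment R f df a b ab.
- by move=> x /[!in_itv]/= /andP[ax xb]; apply: H; rewrite !ltW.
- apply: continuous_in_subspaceT => x /[!inE]/= /[!in_itv]/= xab.
  exact: is_derive_continuous (H _ xab).
- move=> c /[!in_itv]/= cab E.
  by rewrite -subr_ge0 E mulr_ge0 ?H0// subr_ge0.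
Qed.

Lemma derive_norm_le_itv f (df : R -> R) a b (K : R) : a <= b ->
  (forall x, is_derive x 1 f (df x)) ->
  (forall x, a <= x <= b -> `|df x| <= K) -> `|f b - f a| <= K * (b - a).
Proof.
move=> ab H H0.
have cf : {within `[a, b], continuous f}.
  apply: continuous_in_subspaceT => x _; exact: is_derive_continuous (H _).
have [c cab ->] := MVT_segment ab (fun x _ => H x) cf.
rewrite normrM [`|b - a|]ger0_norm ?subr_ge0// ler_wpM2r ?subr_ge0// H0//.
Qed.

Lemma norm_between a b x : a <= x <= b -> `|x| <= Num.max `|a| `|b|.
Proof.
move=> /andP[ax xb]; have := ler_norm b; have := ler_norm (- a); rewrite normrN => ? ?.
by rewrite ler_norml le_max; apply/andP; split;
  [rewrite lerNl le_max|]; apply/orP; [left|right]; lra.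
Qed.

Lemma derive_norm_le f (df : R -> R) a b (K : R) :
  (forall x, is_derive x 1 f (df x)) ->
  (forall x, `|x - a| <= `|b - a| -> `|x| <= Num.max `|a| `|b| -> `|df x| <= K) ->
  `|f b - f a| <= K * `|b - a|.
Proof.
move=> H H0; have [ab|/ltW ba] := leP a b.
  rewrite [`|b - a|]ger0_norm ?subr_ge0//; apply: (derive_norm_le_itv ab H) => x xab.
  apply: H0; last exact: norm_between.
  by rewrite !ger0_norm ?subr_ge0 ?lerD2r//; case/andP: xab.
rewrite distrC [`|b - a|]distrC [`|a - b|]ger0_norm ?subr_ge0//.
apply: (derive_norm_le_itv ba H) => x xab.
apply: H0; last by rewrite maxC; exact: norm_between.
by rewrite !ler0_norm ?subr_le0 ?lerN2 ?lerD2r//; case/andP: xab.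
Qed.

Lemma integrable_continuous_itv (p : R -> R) (a b : R) : continuous p ->
  (@lebesgue_measure R).-integrable `[a, b] (EFin \o p).
Proof.
move=> cp; apply: continuous_compact_integrable; first exact: segment_compact.
exact: continuous_subspaceT.
Qed.

(** The integral from [c] is glued from two integrals with ordered bounds; near
    each point it differs by a constant from the integral with a base point
    further to the left, to which the fundamental theorem applies. *)
Lemma antiderivative_exists (p : R -> R) (c : R) : continuous p ->
  exists P : R -> R, P c = 0 /\ forall x, is_derive x 1 P (p x).
Proof.
move=> cp.
pose G a x := \int[@lebesgue_measure R]_(t in `[a, x]) p t.
pose P x := if c <= x then G c x else - G x c.
have PE a x : a <= c -> a <= x -> P x = G a x - G a c.
  move=> ac ax; rewrite /P; case: leP => cx.
    have -> : G a x - G a c = \int[lebesgue_measure]_(t in `]c, x]) p t.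
      apply: Rintegral_itvB; rewrite ?bnd_simp//.
      exact: integrable_continuous_itv.
    rewrite Rintegral_itv_obnd_cbnd//.
    apply: integrableS (@integrable_continuous_itv p c x cp) => //.
    exact: subset_itv_oc_cc.
  have E : G a c - G a x = \int[lebesgue_measure]_(t in `]x, c]) p t.
    apply: Rintegral_itvB; rewrite ?bnd_simp//; last exact: ltW.
    exact: integrable_continuous_itv.
  rewrite -[RHS]opprB E Rintegral_itv_obnd_cbnd//.
  apply: integrableS (@integrable_continuous_itv p x c cp) => //.
  exact: subset_itv_oc_cc.
exists P; split; first by rewrite (PE c c)// subrr.
move=> x; pose a := Num.min x c - 1.
have ax : a < x.
  by rewrite /a ltrBlDr; apply: (@le_lt_trans _ _ x); rewrite ?ge_min ?lexx// ltrDl.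
have ac : a < c.
  by rewrite /a ltrBlDr; apply: (@le_lt_trans _ _ c); rewrite ?ge_min ?lexx ?orbT// ltrDl.
have [] := @continuous_FTC1_closed R p a x (x + 1) _ _ ax (cp x).
- by rewrite ltrDl.
- exact: integrable_continuous_itv.
move=> dG G'.
have : is_derive x 1 (fun y => G a y - G a c) (p x).
  have : is_derive x 1 (G a) (p x) by rewrite -G'; exact: derivable_is_derive.
  move=> dG'; rewrite -[p x]subr0; apply: is_deriveB.
apply: near_eq_is_derive; near=> y; apply/esym/PE; first exact: ltW.
by near: y; apply: filterS (lt_nbhsr ax) => y; exact: ltW.
Unshelve. all: by end_near. Qed.

Lemma integral_is_derive (P p : R -> R) a b : a <= b -> continuous p ->
  (forall x, is_derive x 1 P (p x)) ->
  \int[@lebesgue_measure R]_(t in `[a, b]) p t = P b - P a.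
Proof.
move=> ab cp dP; move: ab; rewrite le_eqVlt => /predU1P[->|ab].
  by rewrite subrr set_itv1 Rintegral_set1.
have cP : continuous P by move=> x; apply: is_derive_continuous.
rewrite /Rintegral (@continuous_FTC2 R p P a b ab)//.
- exact: continuous_subspaceT.
- split.
  + by move=> x _; exact: ex_derive.
  + exact: cvg_at_right_filter (cP _).
  + exact: cvg_at_left_filter (cP _).
- by move=> x _; exact: is_derive_derive1.
Qed.

End calculus.

(** * The flux and its convex entropy pairs *)

Definition flux_deriv {R : realType} (u : R) : R := (3 * u ^+ 2 - 3) / 2.

Section entropy_pairs.
Context {R : realType}.
Implicit Types (U F : R -> R) (x a b c d k s xi : R).
Local Notation f := (@flux R).
Local Notation f' := (@flux_deriv R).

Lemma is_derive_flux x : is_derive x 1 f (f' x).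
Proof.
have d := der_id x.
have -> : f = fun y => 2^-1 * (y * (y * y) - 3 * y).
  by apply/funext => y; rewrite /flux !exprS expr0; field.
apply: der_eq (derZ 2^-1 (derB (derM d (derM d d)) (derZ 3 d))) _.
by rewrite /flux_deriv; field.
Qed.

Lemma continuous_flux : continuous f.
Proof. by move=> x; exact: is_derive_continuous (is_derive_flux x). Qed.

Lemma is_derive_flux_deriv x : is_derive x 1 f' (3 * x).
Proof.
have d := der_id x.
have -> : f' = fun y => 2^-1 * (3 * (y * y) - 3).
  by apply/funext => y; rewrite /flux_deriv !exprS expr0; field.
apply: der_eq (derZ 2^-1 (derB (derZ 3 (derM d d)) (der_cst 3 x))) _.
by field.
Qed.

Lemma derive1_flux : derive1 f = f'.
Proof. by apply/funext => x; exact: is_derive_derive1 (is_derive_flux x). Qed.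

Lemma fluxN u : f (- u) = - f u.
Proof. by rewrite /flux; field. Qed.

Lemma derive1n_2 (g : R -> R) : derive1n 2 g = derive1 (derive1 g).
Proof. by []. Qed.

(** The entropy flux is [C^2] because [F' = U' f'] is a product of [C^1]
    functions. *)
Lemma entropy_pairI U U1 U2 F : (forall x, is_derive x 1 U (U1 x)) ->
  (forall x, is_derive x 1 U1 (U2 x)) -> continuous U2 -> (forall x, 0 <= U2 x) ->
  (forall x, is_derive x 1 F (U1 x * f' x)) -> convex_entropy_pair U F.
Proof.
move=> dU dU1 cU2 U2ge0 dF.
have EU : derive1 U = U1 by apply/funext => x; exact: is_derive_derive1.
have EU1 : derive1 U1 = U2 by apply/funext => x; exact: is_derive_derive1.
have EF : derive1 F = (fun x => U1 x * f' x).
  by apply/funext => x; exact: is_derive_derive1.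
have dF1 x : is_derive x 1 (fun x => U1 x * f' x) (U2 x * f' x + U1 x * (3 * x)).
  by apply: derM => //; exact: is_derive_flux_deriv.
have EF1 : derive1 (fun x => U1 x * f' x) = fun x => U2 x * f' x + U1 x * (3 * x).
  by apply/funext => x; exact: is_derive_derive1.
split.
- split; rewrite ?derive1n_2 ?EU ?EU1//.
- split; rewrite ?derive1n_2 ?EF ?EF1//.
  move=> x; apply: cvgD; apply: cvgM; [exact: cU2|..].
  + exact: is_derive_continuous (is_derive_flux_deriv x).
  + exact: is_derive_continuous (dU1 x).
  + by apply: cvgM; [exact: cvg_cst|exact: cvg_id].
- by move=> u; rewrite derive1n_2 EU EU1.
- by move=> u; rewrite EF EU derive1_flux.
Qed.

Lemma entropy_pairE U F : convex_entropy_pair U F ->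
  [/\ forall x, is_derive x 1 U (derive1 U x),
      forall x, is_derive x 1 (derive1 U) (derive1n 2 U x),
      continuous (derive1n 2 U), forall x, 0 <= derive1n 2 U x
    & forall x, is_derive x 1 F (derive1 U x * f' x)].
Proof.
case=> -[dU dU1 cU2] [dF _ _] U2ge0 EF; split; [move=> x|move=> x|exact: cU2|exact: U2ge0|move=> x].
- exact: derivable_is_derive.
- by rewrite derive1n_2; exact: derivable_is_derive.
- by rewrite -derive1_flux -EF; exact: derivable_is_derive.
Qed.

Lemma entropy_pair_continuous U F : convex_entropy_pair U F ->
  continuous U /\ continuous F.
Proof.
move=> /entropy_pairE[dU _ _ _ dF].
by split=> x; [exact: is_derive_continuous (dU x)|exact: is_derive_continuous (dF x)].
Qed.

(** Used with [a] of either sign: affine entropies turn entropy inequalities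
    into equalities, that is, into the conservation law. *)
Lemma entropy_pair_id a : convex_entropy_pair (fun x => a * x) (fun x => a * f x).
Proof.
have dU x : is_derive x 1 (fun y => a * y) a.
  by apply: der_eq (derZ a (der_id x)) _; rewrite mulr1.
have dF x : is_derive x 1 (fun y => a * f y) (a * f' x).
  exact: derZ (is_derive_flux x).
apply: (entropy_pairI dU (fun x => der_cst a x) _ _ dF) => // x.
exact: cvg_cst.
Qed.

Lemma entropy_pair_opp U F : convex_entropy_pair U F ->
  convex_entropy_pair (fun x => U (- x)) (fun x => F (- x)).
Proof.
move=> /entropy_pairE[dU dU1 cU2 U2ge0 dF].
have dN x : is_derive x 1 (fun y : R => - y) (- 1) by exact: derN (der_id x).
have dUN x : is_derive x 1 (fun y => U (- y)) (- derive1 U (- x)).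
  by apply: der_eq (der_comp (dN x) (dU (- x))) _; rewrite mulrN1.
have dU1N x : is_derive x 1 (fun y => - derive1 U (- y)) (derive1n 2 U (- x)).
  by apply: der_eq (derN (der_comp (dN x) (dU1 (- x)))) _; rewrite mulrN1 opprK.
have dFN x : is_derive x 1 (fun y => F (- y)) (- derive1 U (- x) * f' x).
  apply: der_eq (der_comp (dN x) (dF (- x))) _.
  by rewrite mulrN1 /flux_deriv sqrrN mulNr.
apply: (entropy_pairI dUN dU1N _ _ dFN) => [x|x]; last exact: U2ge0.
by apply: continuous_comp; [exact: opp_continuous|exact: cU2].
Qed.

(** Along an interval on which the affinely corrected flux [f s - xi s] stays
    above a level [c], the combination below decreases, because its derivative
    is [U'' s * (c - (f s - xi s))].  This single identity turns Oleinik-type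
    conditions on the graph of the flux into entropy inequalities. *)
Lemma entropy_dissipation U F xi c a b : convex_entropy_pair U F -> a <= b ->
  (forall s, a <= s <= b -> c <= f s - xi * s) ->
  F b - xi * U b + derive1 U b * (c - (f b - xi * b)) <=
  F a - xi * U a + derive1 U a * (c - (f a - xi * a)).
Proof.
move=> /entropy_pairE[dU dU1 cU2 U2ge0 dF] ab H; rewrite -lerN2.
have dg s : is_derive s 1 (fun s => f s - xi * s) (f' s - xi).
  by apply: der_eq (derB (is_derive_flux s) (derZ xi (der_id s))) _; rewrite mulr1.
apply: (@derive_ge0_le _ (fun s => - (F s - xi * U s + derive1 U s * (c - (f s - xi * s))))
   (fun s => - (derive1n 2 U s * (c - (f s - xi * s))))) => // s sab.
  apply: der_eq (derN (derD (derB (dF s) (derZ xi (dU s)))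
     (derM (dU1 s) (derB (der_cst c s) (dg s))))) _.
  by ring.
by rewrite oppr_ge0 mulr_ge0_le0// subr_le0 H.
Qed.

(** * Regularised Kruzkov entropies *)

Definition pospart x : R := Num.max 0 x.

Lemma pospartE x : (0 <= x /\ pospart x = x) \/ (x <= 0 /\ pospart x = 0).
Proof. by rewrite /pospart; case: (leP 0 x) => h; [left|right; split => //; exact: ltW]. Qed.

Lemma is_derive_pospart2 x : is_derive x 1 (fun y => pospart y ^+ 2) (2 * pospart x).
Proof.
apply: (@is_derive_quadratic _ _ _ _ 1) => h.
rewrite ler_norml; case: (pospartE (x + h)) => -[h1 ->];
  case: (pospartE x) => -[h2 ->]; apply/andP; split; nra.
Qed.

Lemma continuous_pospart : continuous pospart.
Proof. by move=> x; apply: continuous_max; [exact: cvg_cst|exact: cvg_id]. Qed.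

(** The second difference of [max 0 x], and the [C^1] step function of which it
    is the derivative: [2 * step - 1] is a [C^1] substitute for the sign. *)
Definition hat x : R := pospart (x + 1) - 2 * pospart x + pospart (x - 1).

Definition step x : R :=
  (pospart (x + 1) ^+ 2 - 2 * pospart x ^+ 2 + pospart (x - 1) ^+ 2) / 2.

Lemma is_derive_step x : is_derive x 1 step (hat x).
Proof.
have d c : is_derive x 1 (fun y => pospart (y + c) ^+ 2) (2 * pospart (x + c)).
  have d1 : is_derive x 1 (fun y : R => y + c) 1.
    by apply: der_eq (derD (der_id x) (der_cst c x)) _; rewrite addr0.
  apply: der_eq (der_comp d1 (is_derive_pospart2 (x + c))) _.
  by rewrite mulr1.
have -> : step = fun y => 2^-1 * (pospart (y + 1) ^+ 2 - 2 * pospart y ^+ 2 +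
    pospart (y - 1) ^+ 2) by apply/funext => y; rewrite /step mulrC.
apply: der_eq (derZ 2^-1 (derD (derB (d 1) (derZ 2 (is_derive_pospart2 x)))
  (d (- 1)))) _.
by rewrite /hat; field.
Qed.

End entropy_pairs.

Section kruzkov.
Context {R : realType}.
Implicit Types (U F G : R -> R) (x y a b c d k s t u e L : R).
Local Notation f := (@flux R).
Local Notation f' := (@flux_deriv R).
Local Notation hat := (@hat R).
Local Notation step := (@step R).
Local Notation pospart := (@pospart R).

Ltac pospart_cases x :=
  case: (pospartE (x + 1)) => -[? ->]; case: (pospartE x) => -[? ->];
  case: (pospartE (x - 1)) => -[? ->].

Lemma hat_ge0 x : 0 <= hat x.
Proof. by rewrite /hat; pospart_cases x; lra. Qed.

Lemma hat_le1 x : hat x <= 1.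
Proof. by rewrite /hat; pospart_cases x; lra. Qed.

Lemma hat_eq0 x : 1 <= `|x| -> hat x = 0.
Proof.
by rewrite /hat ler_normr; move=> /orP[] ?; pospart_cases x; lra.
Qed.

Lemma continuous_hat : continuous hat.
Proof.
have c a x : {for x, continuous (fun y => pospart (y + a))}.
  apply: (@continuous_comp _ _ _ (fun y => y + a) pospart); last exact: continuous_pospart.
  by apply: cvgD; [exact: cvg_id|exact: cvg_cst].
move=> x; apply: cvgD; last exact: c.
apply: cvgB; first exact: c.
by apply: cvgM; [exact: cvg_cst|exact: continuous_pospart].
Qed.

Lemma step_ge1 x : 1 <= x -> step x = 1.
Proof. by move=> ?; rewrite /step; pospart_cases x; nra. Qed.

Lemma step_leN1 x : x <= -1 -> step x = 0.
Proof. by move=> ?; rewrite /step; pospart_cases x; nra. Qed.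

Lemma step_ge0 x : 0 <= step x.
Proof. by rewrite /step; pospart_cases x; nra. Qed.

Lemma step_le1 x : step x <= 1.
Proof. by rewrite /step; pospart_cases x; nra. Qed.

Lemma stepN x : step (- x) = 1 - step x.
Proof.
rewrite /step.
case: (pospartE (x + 1)) => -[? ->]; case: (pospartE x) => -[? ->];
case: (pospartE (x - 1)) => -[? ->]; case: (pospartE (- x + 1)) => -[? ->];
case: (pospartE (- x)) => -[? ->]; case: (pospartE (- x - 1)) => -[? ->]; nra.
Qed.

Lemma step_half x : 0 <= x -> 2^-1 <= step x.
Proof. by move=> ?; rewrite /step; pospart_cases x; nra. Qed.

(** The errors of the regularised entropies have derivatives which are bounded and
    vanish outside a short transition. *)
Lemma transition_bound G (dG : R -> R) k e L : (forall s, is_derive s 1 G (dG s)) ->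
  G k = 0 -> 0 <= e -> (forall s, k <= s <= k + e -> `|dG s| <= L) ->
  (forall s, k + e <= s -> dG s = 0) -> forall s, k <= s -> `|G s| <= L * e.
Proof.
move=> dGs Gk e0 HL H0 s ks.
have L0 : 0 <= L by apply: le_trans (HL k _); rewrite ?lexx ?lerDl.
have H t : k <= t <= k + e -> `|G t| <= L * e.
  move=> /andP[kt te]; rewrite -[G t]subr0 -Gk.
  apply: le_trans (derive_norm_le_itv kt dGs _) _.
    by move=> u /andP[ku ut]; apply: HL; rewrite ku (le_trans ut).
  by rewrite ler_wpM2l// lerBlDl.
have [se|se] := leP s (k + e); first by apply: H; rewrite ks.
have : `|G s - G (k + e)| <= 0 * (s - (k + e)).
  apply: (derive_norm_le_itv (ltW se) dGs) => t /andP[? _].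
  by rewrite H0// normr0.
rewrite mul0r normr_le0 subr_eq0 => /eqP ->.
by apply: H; rewrite lexx lerDl e0.
Qed.

Lemma transition_bound_left G (dG : R -> R) k e L : (forall s, is_derive s 1 G (dG s)) ->
  G k = 0 -> 0 <= e -> (forall s, k - e <= s <= k -> `|dG s| <= L) ->
  (forall s, s <= k - e -> dG s = 0) -> forall s, s <= k -> `|G s| <= L * e.
Proof.
move=> dGs Gk e0 HL H0 s sk.
have dr t : is_derive t 1 (fun t => 2 * k - t) (-1).
  by apply: der_eq (derB (der_cst (2 * k) t) (der_id t)) _; rewrite sub0r.
have rr t : 2 * k - (2 * k - t) = t by ring.
have Hk : G (2 * k - k) = 0 by rewrite (_ : 2 * k - k = k)//; ring.
rewrite -[s]rr.
apply: (transition_bound (fun t => der_comp (dr t) (dGs _)) Hk e0) => [t /andP[? ?]|t ?|].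
- by rewrite mulrN1 normrN; apply: HL; apply/andP; split; lra.
- by rewrite H0 ?mul0r//; lra.
- lra.
Qed.

(** Entropies as close as desired to [|s - k|], with the corresponding entropy
    fluxes; passing to the limit in an inequality valid for all convex pairs
    gives it for Kruzkov's entropies, which are not [C^2]. *)
Lemma kruzkov_pair (k eta : R) : 0 < eta -> exists U F : R -> R,
  [/\ convex_entropy_pair U F, forall s, 0 <= U s,
      forall s, `|U s - `|s - k| | <= eta,
      forall s, `|F s - Num.sg (s - k) * (f s - f k)| <= eta
    & forall s, eta <= `|s - k| -> derive1 U s = Num.sg (s - k)].
Proof.
move=> eta0; pose L : R := (3 * (`|k| + 1) ^+ 2 + 3) / 2.
have L1 : 1 <= L by rewrite /L; have := sqr_ge0 (`|k|); have := normr_ge0 k; nra.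
have Hf s : `|s - k| <= 1 -> `|f' s| <= L.
  move=> sk; rewrite /flux_deriv /L.
  have : `|s| <= `|k| + 1 by rewrite -[s](subrKC k) addrC; apply: le_trans (ler_normD _ _) _; rewrite addrC lerD2l.
  rewrite -[s ^+ 2]ger0_norm ?sqr_ge0// normrX => ?.
  have ? := normr_ge0 s; have ? := normr_ge0 k.
  by rewrite ler_norml; apply/andP; split; nra.
(* The width of the transition of the derivative from -1 to 1; on it the slope
   of the flux is bounded by [L]. *)
pose e := Num.min (Num.min 1 eta) (eta / (2 * L)).
have e0 : 0 < e by rewrite /e !lt_min ltr01 eta0/= divr_gt0//; lra.
have e1 : e <= 1 by rewrite /e !ge_min lexx.
have ee : e <= eta by rewrite /e !ge_min lexx orbT.
have eL : 2 * L * e <= eta.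
  by rewrite mulrC -ler_pdivlMr ?/e ?ge_min ?lexx ?orbT//; lra.
pose U1 s := 2 * step (e^-1 * (s - k)) - 1.
pose U2 s := 2 * (hat (e^-1 * (s - k)) * e^-1).
have darg s : is_derive s 1 (fun s => e^-1 * (s - k)) e^-1.
  apply: der_eq (derZ e^-1 (derB (der_id s) (der_cst k s))) _.
  by rewrite subr0 mulr1.
have dU1 s : is_derive s 1 U1 (U2 s).
  apply: der_eq (derB (derZ 2 (der_comp (darg s) (is_derive_step _))) (der_cst 1 s)) _.
  by rewrite subr0.
have cU1 : continuous U1 by move=> s; exact: is_derive_continuous (dU1 s).
have cf' : continuous f' by move=> s; exact: is_derive_continuous (is_derive_flux_deriv s).
have cU2 : continuous U2.
  move=> s; apply: cvgM; first exact: cvg_cst.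
  apply: cvgM; last exact: cvg_cst.
  apply: (@continuous_comp _ _ _ (fun s => e^-1 * (s - k)) hat); last exact: continuous_hat.
  exact: is_derive_continuous (darg s).
have [U [Uk dU]] := antiderivative_exists k cU1.
have cF1 : continuous (fun s => U1 s * f' s) by move=> s; apply: cvgM; [exact: cU1|exact: cf'].
have [F [Fk dF]] := antiderivative_exists k cF1.
have U1R s : k + e <= s -> U1 s = 1.
  move=> ks; rewrite /U1 step_ge1; first by ring.
  by rewrite mulrC ler_pdivlMr// mul1r; lra.
have U1L s : s <= k - e -> U1 s = -1.
  move=> ks; rewrite /U1 step_leN1; first by ring.
  by rewrite mulrC ler_pdivrMr//; lra.
have U1b s : -1 <= U1 s <= 1.
  have := step_ge0 (e^-1 * (s - k)); have := step_le1 (e^-1 * (s - k)).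
  by rewrite /U1 => ? ?; apply/andP; split; lra.
have U1p s : k <= s -> 0 <= U1 s.
  move=> ks; have : 2^-1 <= step (e^-1 * (s - k)).
    by apply: step_half; rewrite mulr_ge0 ?subr_ge0// invr_ge0 ltW.
  by rewrite /U1; lra.
have U1n s : s <= k -> U1 s <= 0.
  move=> ks; have : 2^-1 <= step (- (e^-1 * (s - k))).
    by apply: step_half; rewrite -mulrN mulr_ge0 ?invr_ge0 ?(ltW e0)//; lra.
  by rewrite stepN /U1; lra.
have dD (a : R) s : is_derive s 1 (fun s => a * (s - k)) a.
  apply: der_eq (derZ a (derB (der_id s) (der_cst k s))) _.
  by rewrite subr0 mulr1.
have UB s : `|U s - `|s - k| | <= e.
  rewrite -[e]mul1r; have [ks|/ltW sk] := leP k s.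
    rewrite [X in _ - X]ger0_norm ?subr_ge0//.
    have dG t : is_derive t 1 (fun s => U s - 1 * (s - k)) (U1 t - 1) by apply: derB.
    rewrite -[X in _ - X]mul1r.
    have H : U k - 1 * (k - k) = 0 by rewrite Uk subrr mulr0 subr0.
    apply: (transition_bound dG H (ltW e0) _ _ ks).
      move=> t /andP[kt _]; have := U1p _ kt; have /andP[? ?] := U1b t => ?.
      by rewrite ler_norml; apply/andP; split; lra.
    by move=> t kt; rewrite U1R// subrr.
  rewrite [X in _ - X]ler0_norm ?subr_le0// opprK.
  have dG t : is_derive t 1 (fun s => U s + 1 * (s - k)) (U1 t + 1) by apply: derD.
  rewrite -[X in _ + X]mul1r.
  have H : U k + 1 * (k - k) = 0 by rewrite Uk subrr mulr0 addr0.
  apply: (transition_bound_left dG H (ltW e0) _ _ sk).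
    move=> t /andP[_ tk]; have := U1n _ tk; have /andP[? ?] := U1b t => ?.
    by rewrite ler_norml; apply/andP; split; lra.
  by move=> t kt; rewrite U1L// addNr.
have FB s : `|F s - Num.sg (s - k) * (f s - f k)| <= 2 * L * e.
  have [ks|sk|<-] := ltgtP k s; last first.
  - rewrite Fk !subrr mulr0 subrr normr0; apply: mulr_ge0; [lra|exact: ltW].
  - rewrite ltr0_sg ?subr_lt0// mulN1r opprK.
    have dG t : is_derive t 1 (fun s => F s + (f s - f k)) (U1 t * f' t + (f' t - 0)).
      by apply: (derD (dF t) (derB (is_derive_flux t) (der_cst _ _))).
    have H : F k + (f k - f k) = 0 by rewrite Fk subrr addr0.
    apply: (transition_bound_left dG H (ltW e0) _ _ (ltW sk)).
      move=> t /andP[kt te]; rewrite subr0 -[X in _ + X]mul1r -mulrDl normrM.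
      apply: ler_pM => //; last by apply: Hf; rewrite ler_norml; apply/andP; split; lra.
      by have /andP[? ?] := U1b t; rewrite ler_norml; apply/andP; split; lra.
    by move=> t kt; rewrite U1L ?subr0 ?mulN1r ?addNr.
  - rewrite gtr0_sg ?subr_gt0// mul1r.
    have dG t : is_derive t 1 (fun s => F s - (f s - f k)) (U1 t * f' t - (f' t - 0)).
      by apply: (derB (dF t) (derB (is_derive_flux t) (der_cst _ _))).
    have H : F k - (f k - f k) = 0 by rewrite Fk !subrr.
    apply: (transition_bound dG H (ltW e0) _ _ (ltW ks)).
      move=> t /andP[kt te]; rewrite subr0 -[X in _ - X]mul1r -mulrBl normrM.
      apply: ler_pM => //; last by apply: Hf; rewrite ler_norml; apply/andP; split; lra.
      by have /andP[? ?] := U1b t; rewrite ler_norml; apply/andP; split; lra.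
    by move=> t kt; rewrite U1R ?subr0 ?mul1r ?subrr.
exists U, F; split => //.
- apply: entropy_pairI dU dU1 cU2 _ dF => s.
  by rewrite !mulr_ge0 ?hat_ge0 ?invr_ge0 ?(ltW e0).
- move=> s; have [ks|/ltW sk] := leP k s.
    rewrite -Uk; apply: (derive_ge0_le ks (fun t _ => dU t)) => t /andP[kt _].
    exact: U1p.
  rewrite -lerN2 oppr0 -[0]oppr0 -Uk.
  apply: (derive_ge0_le sk (fun t _ => derN (dU t))) => t /andP[_ kt].
  by rewrite oppr_ge0 U1n.
- by move=> s; apply: le_trans (UB s) ee.
- by move=> s; apply: le_trans (FB s) eL.
- move=> s es; rewrite (is_derive_derive1 (dU s)).
  have [ks|sk|E] := ltgtP k s.
  + by rewrite gtr0_sg ?subr_gt0// U1R//; move: es; rewrite gtr0_norm ?subr_gt0//; lra.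
  + by rewrite ltr0_sg ?subr_lt0// U1L//; move: es; rewrite ltr0_norm ?subr_lt0//; lra.
  + by move: es; rewrite E subrr normr0 leNgt eta0.
Qed.

End kruzkov.

(** * The boundary condition and the explicit sets *)

Section bln.
Context {R : realType}.
Implicit Types (uB u s M r : R).
Local Notation f := (@flux R).

(** The boundary condition of Bardos, Le Roux and Nedelec, with both orders of
    [uB] and [u0] in one formula. *)
Definition bln uB u0 := forall s,
  (uB <= s <= u0 -> f u0 <= f s) /\ (u0 <= s <= uB -> f s <= f u0).

(** Strictness at [s = uB] excludes a stationary shock from [uB] to [u0]. *)
Definition strict_bln uB u0 := forall s,
  (uB <= s < u0 -> f u0 < f s) /\ (u0 < s <= uB -> f s < f u0).

(** [(chord s u - 3) / 2] is the slope of the chord of the flux between [s] and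
    [u], that is, the speed of a shock joining them. *)
Definition chord s u : R := s ^+ 2 + s * u + u ^+ 2.

Lemma fluxB s u : f s - f u = (s - u) * (chord s u - 3) / 2.
Proof. by rewrite /flux /chord; field. Qed.

Lemma flux_le_chord s u : s <= u -> chord s u <= 3 -> f u <= f s.
Proof. by move=> su c; rewrite -subr_ge0 fluxB; nra. Qed.

Lemma flux_lt_chord s u : s < u -> chord s u < 3 -> f u < f s.
Proof. by move=> su c; rewrite -subr_gt0 fluxB; nra. Qed.

Lemma flux_ge_chord s u : u <= s -> chord s u <= 3 -> f s <= f u.
Proof. by move=> su c; rewrite -subr_le0 fluxB; nra. Qed.

Lemma flux_gt_chord s u : u < s -> chord s u < 3 -> f s < f u.
Proof. by move=> su c; rewrite -subr_lt0 fluxB; nra. Qed.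

Lemma bln_opp uB u0 : bln uB u0 -> bln (- uB) (- u0).
Proof.
move=> H s; have [H1 H2] := H (- s); rewrite !fluxN in H1 H2 *.
by split=> /andP[? ?]; [have := H2 _|have := H1 _]; move=> H'; have := H' _; lra.
Qed.

Lemma strict_bln_opp uB u0 : strict_bln uB u0 -> strict_bln (- uB) (- u0).
Proof.
move=> H s; have [H1 H2] := H (- s); rewrite !fluxN in H1 H2 *.
by split=> /andP[? ?]; [have := H2 _|have := H1 _]; move=> H'; have := H' _; lra.
Qed.

Lemma chordNN s u : chord (- s) (- u) = chord s u.
Proof. by rewrite /chord; ring. Qed.

(** Letting [s] tend to [u0] in [chord s u0 <= 3] bounds [u0 ^ 2] by 1: a trace
    does not lie where the characteristics enter the domain, unless it is the
    boundary state. *)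
Lemma bln_chord_lt uB u0 : uB < u0 -> bln uB u0 -> u0 ^+ 2 <= 1 /\ chord uB u0 <= 3.
Proof.
move=> ltu H.
have Hs s : uB <= s < u0 -> chord s u0 <= 3.
  move=> /andP[us su]; have [+ _] := H s; rewrite us (ltW su) => /(_ isT).
  by rewrite -subr_ge0 fluxB; nra.
split; last by apply: Hs; rewrite lexx.
rewrite leNgt; apply/negP => u1.
have a1 : 1 < `|u0|.
  by rewrite ltNge; apply/negP => h; move: u1; rewrite -[u0 ^+ 2]ger0_norm ?sqr_ge0// normrX; have := normr_ge0 u0; nra.
pose d := Num.min (u0 - uB) (`|u0| - 1).
have d0 : 0 < d by rewrite lt_min; apply/andP; split; lra.
have d1 : d <= u0 - uB by rewrite ge_min lexx.
have d2 : d <= `|u0| - 1 by rewrite ge_min lexx orbT.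
have : chord (u0 - d) u0 <= 3 by apply: Hs; apply/andP; split; lra.
have u2 : u0 ^+ 2 = `|u0| ^+ 2 by rewrite -normrX ger0_norm ?sqr_ge0.
have u3 : u0 <= `|u0| by exact: ler_norm.
by rewrite /chord; nra.
Qed.

(** [chord s u0] is convex in [s], and at [s = u0] it is [3 * u0 ^ 2 <= 3]. *)
Lemma chord_le uB u0 s : u0 ^+ 2 <= 1 -> chord uB u0 <= 3 ->
  (uB <= s <= u0) || (u0 <= s <= uB) -> chord s u0 <= 3.
Proof.
wlog : uB u0 s / uB <= s <= u0 => [W|/andP[us su]].
  move=> u1 c3 /orP[H|H]; first by apply: (W _ _ _ H u1 c3); rewrite H.
  have H' : - uB <= - s <= - u0 by rewrite !lerN2 andbC.
  by rewrite -chordNN; apply: (W _ _ _ H'); rewrite ?chordNN ?sqrrN// H'.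
move=> u1 + _; rewrite /chord => c3.
by have [h|h] := leP (s + uB + u0) 0; nra.
Qed.

Lemma chord_lt uB u0 s : u0 ^+ 2 <= 1 -> chord uB u0 < 3 ->
  (uB <= s < u0) || (u0 < s <= uB) -> chord s u0 < 3.
Proof.
wlog : uB u0 s / uB <= s < u0 => [W|/andP[us su]].
  move=> u1 c3 /orP[H|H]; first by apply: (W _ _ _ H u1 c3); rewrite H.
  have H' : - uB <= - s < - u0 by rewrite lerN2 ltrN2 andbC.
  by rewrite -chordNN; apply: (W _ _ _ H'); rewrite ?chordNN ?sqrrN// H'.
move=> u1 + _; rewrite /chord => c3.
by have [h|h] := leP (s + uB + u0) 0; nra.
Qed.

Lemma bln_chord uB u0 :
  bln uB u0 <-> u0 = uB \/ (u0 ^+ 2 <= 1 /\ chord uB u0 <= 3).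
Proof.
split=> [H|[->|[u1 c3]] s].
- have [lt|gt|->] := ltgtP uB u0; [|right|by left].
    by right; exact: bln_chord_lt.
  rewrite -chordNN -[u0 ^+ 2]sqrrN; apply: bln_chord_lt; first by rewrite ltrN2.
  exact: bln_opp.
- by split=> /le_anti ->.
- split=> H; have := chord_le u1 c3 (s := s); rewrite H ?orbT => /(_ isT);
    case/andP: H => ? ?; [exact: flux_le_chord|exact: flux_ge_chord].
Qed.

Lemma strict_bln_chord uB u0 :
  strict_bln uB u0 <-> u0 = uB \/ (u0 ^+ 2 <= 1 /\ chord uB u0 < 3).
Proof.
split=> [H|[->|[u1 c3]] s].
- have [->|ne] := eqVneq u0 uB; [by left|right].
  have /bln_chord[E|[u1 _]] : bln uB u0.
  + move=> s; have [H1 H2] := H s; split=> /andP[a b].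
      by have [->//|n] := eqVneq s u0; rewrite ltW// H1// a lt_neqAle n b.
    by have [->//|n] := eqVneq s u0; rewrite ltW// H2// b lt_neqAle eq_sym n a.
  + by rewrite E eqxx in ne.
  + split=> //; have [H1 H2] := H uB.
    have [lt|gt|E] := ltgtP uB u0; last by rewrite E eqxx in ne.
      by move: H1; rewrite lexx lt => /(_ isT); rewrite -subr_gt0 fluxB; nra.
    by move: H2; rewrite lexx gt => /(_ isT); rewrite -subr_gt0 fluxB /chord; nra.
- by split=> /andP[a b]; [have := le_lt_trans a b|have := lt_le_trans a b]; rewrite ltxx.
- split=> H; have := chord_lt u1 c3 (s := s); rewrite H ?orbT => /(_ isT);
    case/andP: H => ? ?; [exact: flux_lt_chord|exact: flux_gt_chord].
Qed.

Lemma strict_blnW uB u0 : strict_bln uB u0 -> bln uB u0.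
Proof.
move=> /strict_bln_chord H; apply/bln_chord.
by case: H => [|[? /ltW ?]]; [left|right].
Qed.

Lemma other_statesE uB u : other_states uB u <-> chord u uB = 3 /\ u != uB.
Proof.
rewrite /other_states/=; split=> -[E ne]; split=> //.
  have := fluxB u uB; rewrite E subrr => /esym/eqP.
  by rewrite mulf_eq0 invr_eq0 pnatr_eq0 orbF mulf_eq0 !subr_eq0 (negbTE ne)/= => /eqP.
by apply/eqP; rewrite -subr_eq0 fluxB E subrr mulr0 mul0r.
Qed.

Lemma ltr_sq (a b : R) : 0 <= b -> a ^+ 2 < b ^+ 2 -> a < b.
Proof. by move=> b0 H; rewrite ltNge; apply/negP => ba; nra. Qed.

(** The other states solve [chord u uB = 3], a quadratic equation in [u] with
    discriminant [12 - 3 * uB ^ 2].  The bounds on its root [r] are all that the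
    comparison with the intervals of the theorem needs. *)
Lemma uB_lE uB : 1 < uB < 2 ->
  exists r, [/\ r ^+ 2 = 12 - 3 * uB ^+ 2, 2 - uB < r, r < 2 + uB & uB_l uB = (- uB + r) / 2].
Proof.
move=> /andP[u1 u2]; exists (Num.sqrt (12 - 3 * uB ^+ 2)).
set r := Num.sqrt _.
have r0 : 0 < r by rewrite sqrtr_gt0; nra.
have r2 : r ^+ 2 = 12 - 3 * uB ^+ 2 by rewrite sqr_sqrtr//; nra.
have r3 : r < 2 + uB by apply: ltr_sq; rewrite ?r2; nra.
have r4 : 2 - uB < r by apply: ltr_sq; rewrite ?r2; nra.
split=> //; set m := _ / 2.
have mO : other_states uB m.
  apply/other_statesE; split; first by rewrite /chord /m; lra.
  by rewrite lt_eqF// /m; lra.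
have ub : ubound (other_states uB) m.
  move=> u /other_statesE[+ _]; rewrite /chord /m => c.
  suff : 2 * u + uB <= r by lra.
  by rewrite leNgt; apply/negP => h; nra.
apply/le_anti/andP; split; first by apply: ge_sup => //; exists m.
by apply: ub_le_sup => //; exists m.
Qed.

Lemma uB_sN uB : uB_s (- uB) = - uB_l uB.
Proof.
rewrite /uB_s /uB_l /inf; congr (- sup _); apply/seteqP; split=> u.
  move=> [v [E n] <-]; split; first by rewrite fluxN E fluxN opprK.
  by rewrite -eqr_opp opprK.
move=> [E n]; exists (- u); last by rewrite opprK.
by split; [rewrite !fluxN E|rewrite eqr_opp].
Qed.

Lemma uB_sE uB : - 2 < uB < - 1 ->
  exists r, [/\ r ^+ 2 = 12 - 3 * uB ^+ 2, 2 + uB < r, r < 2 - uB & uB_s uB = (- uB - r) / 2].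
Proof.
move=> /andP[u1 u2].
have [|r [r2 r3 r4 E]] := @uB_lE (- uB); first by apply/andP; split; lra.
exists r; rewrite r2 sqrrN; split=> //; first by lra.
by rewrite -[uB in LHS]opprK uB_sN E; field.
Qed.

Lemma E_formula_bln uB : E_formula uB = [set u0 | bln uB u0].
Proof.
apply/seteqP; rewrite /E_formula; split=> u /=; rewrite bln_chord.
- case: (ltP uB (- 2)) => h1; first by move=> ->; left.
  case: eqP => [->|/eqP h2]; first by case=> ->; [left|right; rewrite /chord; lra].
  case: (ltP uB (- 1)) => h3.
    have [|r [r2 r3 r4 E]] := @uB_sE uB; first by rewrite h3 andbT lt_neqAle eq_sym h2.
    case=> [|->]; last by left.
    rewrite /= ?in_itv/= E => /andP[? ?]; right; rewrite /chord; split; nra.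
  case: (leP uB 1) => h4.
    rewrite /= ?in_itv/= => /andP[? ?]; right; rewrite /chord; split; nra.
  case: (ltP uB 2) => h5.
    have [|r [r2 r3 r4 E]] := @uB_lE uB; first by rewrite h4.
    case=> [|->]; last by left.
    rewrite /= ?in_itv/= E => /andP[? ?]; right; rewrite /chord; split; nra.
  case: eqP => [->|_]; last by move=> ->; left.
  by case=> ->; [left|right; rewrite /chord; lra].
- case=> [->|[u1 c3]].
    case: ltP => // h1; case: eqP => [E|_]; first by left.
    case: (ltP uB (- 1)) => h3; first by right.
    case: (leP uB 1) => h4; first by rewrite /= ?in_itv/= h3.
    case: (ltP uB 2) => h5; first by right.
    by case: eqP => [E|_]; first by left.
  rewrite /chord in c3; have ? : - 1 <= u <= 1 by apply/andP; split; nra.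
  case: (ltP uB (- 2)) => h1; first by exfalso; nra.
  case: eqP => [E|/eqP h2].
    right; apply/eqP; rewrite -subr_eq0 -sqrf_eq0; apply/eqP/le_anti.
    by rewrite sqr_ge0 andbT; move: c3; rewrite E; nra.
  case: (ltP uB (- 1)) => h3.
    have [|r [r2 r3 r4 E]] := @uB_sE uB; first by rewrite h3 andbT lt_neqAle eq_sym h2.
    by left; rewrite /= ?in_itv/= E; apply/andP; split; nra.
  case: (leP uB 1) => h4 //.
  case: (ltP uB 2) => h5.
    have [|r [r2 r3 r4 E]] := @uB_lE uB; first by rewrite h4.
    by left; rewrite /= ?in_itv/= E; apply/andP; split; nra.
  case: eqP => [E|/eqP h6].
    right; apply/eqP; rewrite -subr_eq0 -sqrf_eq0; apply/eqP/le_anti.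
    by rewrite sqr_ge0 andbT; move: c3; rewrite E; nra.
  exfalso; have : 2 < uB by rewrite lt_neqAle eq_sym h6.
  nra.
Qed.

Lemma sqr_eq_neg (a r : R) : a ^+ 2 = r ^+ 2 -> a < r -> a = - r.
Proof.
by move=> /eqP; rewrite eqf_sqr => /orP[/eqP ->|/eqP //]; rewrite ltxx.
Qed.

(** The exceptional states are the solutions of [f u = f uB] that satisfy the
    boundary condition; at [uB = 2] and [uB = -2] they are double roots. *)
Lemma E_exc_chord uB u : u ^+ 2 <= 1 -> chord uB u <= 3 -> u != uB ->
  (E_exc uB u <-> chord uB u = 3).
Proof.
move=> u1 c3 ne; rewrite /E_exc; have ? : - 1 <= u <= 1 by apply/andP; split; nra.
have sq0 (a : R) : a ^+ 2 = 0 -> a = 0 by move=> /eqP; rewrite sqrf_eq0 => /eqP.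
case: (uB =P -2) => [E|/eqP h1].
  rewrite /chord/= E; split=> [->|H]; first by ring.
  by have := sq0 (u - 1); lra.
case: ifP => [h2|h2].
  have [r [r2 r3 r4 ->]] := uB_sE h2; rewrite /= /chord; split=> [->|H]; first lra.
  by have := @sqr_eq_neg (2 * u + uB) r; lra.
case: ifP => [h3|h3].
  have [r [r2 r3 r4 ->]] := uB_lE h3; rewrite /= /chord; split=> [->|H]; first lra.
  by have := @sqr_eq_neg (- (2 * u + uB)) r; lra.
case: (uB =P 2) => [E|/eqP h4].
  rewrite /chord/= E; split=> [->|H]; first by ring.
  by have := sq0 (u + 1); lra.
split=> // H; exfalso; rewrite /chord in c3 H.
have [a|a] := leP uB (- 1).
  have {}a : uB = - 1 \/ uB < - 2.
    move: a; rewrite le_eqVlt => /orP[/eqP|a]; [by left|right].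
    by rewrite lt_neqAle h1 leNgt; apply/negP => b; rewrite a b in h2.
  case: a => [a|a]; last nra.
  by have := sq0 (u + 1); rewrite a in ne H; move/eqP: ne; nra.
have [b|b] := leP 1 uB.
  have {}b : uB = 1 \/ 2 < uB.
    move: b; rewrite le_eqVlt => /orP[/eqP <-|b]; [by left|right].
    by rewrite lt_neqAle eq_sym h4 leNgt; apply/negP => c; rewrite b c in h3.
  case: b => [b|b]; last nra.
  by have := sq0 (u - 1); rewrite b in ne H; move/eqP: ne; nra.
nra.
Qed.

Lemma E_exc_strict_bln uB : E_formula uB `\` E_exc uB = [set u0 | strict_bln uB u0].
Proof.
have nE : ~ E_exc uB uB.
  rewrite /E_exc; case: (uB =P -2) => [->|_] /=; first by lra.
  case: ifP => [h2|_]; first by have [r [r2 r3 r4 ->]] := uB_sE h2; move=> /=; lra.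
  case: ifP => [h2|_]; first by have [r [r2 r3 r4 ->]] := uB_lE h2; move=> /=; lra.
  by case: (uB =P 2) => [->|_] //=; lra.
rewrite E_formula_bln; apply/seteqP; split=> u /=.
- move=> [/bln_chord[->|[u1 c3]] n]; apply/strict_bln_chord; first by left.
  have [->|ne] := eqVneq u uB; first by left.
  right; split=> //; rewrite lt_neqAle c3 andbT; apply/eqP => /(E_exc_chord u1 c3 ne).
  exact: n.
- move=> s; split; first exact: strict_blnW.
  move: s => /strict_bln_chord[->//|[u1 c3]].
  have [->//|ne] := eqVneq u uB.
  by move/(E_exc_chord u1 (ltW c3) ne) => E; rewrite E ltxx in c3.
Qed.

End bln.

(** * The entropy set of the viscous approximation *)

Section entropy_sets.
Context {R : realType}.
Implicit Types (uB u s k M c x y : R) (U F : R -> R).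
Local Notation f := (@flux R).

(** Kruzkov's entropies give information only for [k] strictly between [uB] and
    [u0], where [sg (uB - k)] and [sg (u0 - k)] are opposite.  The second hypothesis is
    the first one for the reflected states. *)
Lemma bln_open uB u0 :
  (forall s, uB < s < u0 -> f u0 <= f s) ->
  (forall s, - uB < s < - u0 -> f (- u0) <= f s) -> bln uB u0.
Proof.
have half a b s : (forall s, a < s < b -> f b <= f s) -> a <= s <= b -> f b <= f s.
  move=> H /andP[as_ sb]; have [->//|ne] := eqVneq s b.
  have {}sb : s < b by rewrite lt_neqAle ne.
  have cf : f x @[x --> s^'+] --> f s by apply: cvg_at_right_filter; exact: continuous_flux.
  rewrite -(cvg_lim _ cf)//; apply: limr_ge; first by apply/cvg_ex; exists (f s).
  near=> t; apply: H; apply/andP; split; last by near: t; exact: nbhs_right_lt.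
  by rewrite (le_lt_trans as_)//; near: t; exact: nbhs_right_gt.
move=> H1 H2 s; split=> [|/andP[us su]]; first exact: half.
by rewrite -lerN2 -!fluxN; apply: (half _ _ _ H2); rewrite !lerN2 su.
Unshelve. all: by end_near. Qed.

(** With Kruzkov's entropy the boundary inequality reads
    [sg (uB - k) (f u0 - f k) >= sg (u0 - k) (f u0 - f k)]; conversely the
    boundary condition is the hypothesis of [entropy_dissipation] with [xi = 0]
    and [c = f u0], and the two ends of the conclusion are the two sides of the
    boundary inequality. *)
Lemma E_entropy_viscosity_bln uB : E_entropy_viscosity setT uB = [set u0 | bln uB u0].
Proof.
pose P u u0 := forall U F, convex_entropy_pair U F ->
  F u0 <= F u + derive1 U u * (f u0 - f u).
have PN u u0 : P u u0 -> P (- u) (- u0).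
  move=> H U F p; have := H _ _ (entropy_pair_opp p); have [dU _ _ _ _] := entropy_pairE p.
  have dN : is_derive u 1 (fun x => U (- x)) (derive1 U (- u) * - 1).
    exact: der_comp (derN (der_id u)) (dU (- u)).
  by rewrite (is_derive_derive1 dN) mulrN1 !fluxN; lra.
have Pk u u0 k : P u u0 -> u < k < u0 -> f u0 <= f k.
  move=> H /andP[h1 h2]; apply/ler_addgt0Pr => e e0.
  have m0 : 0 < Num.min e (k - u) by rewrite lt_min e0 subr_gt0.
  have [U [F [p _ _ HF HU]]] := kruzkov_pair k m0.
  have m1 : Num.min e (k - u) <= e by rewrite ge_min lexx.
  have m2 : Num.min e (k - u) <= k - u by rewrite ge_min lexx orbT.
  have := H _ _ p; rewrite HU; last by rewrite ltr0_norm ?subr_lt0// opprB.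
  have := HF u; have := HF u0.
  rewrite gtr0_sg ?subr_gt0// ltr0_sg ?subr_lt0//.
  by rewrite !ler_norml => /andP[? ?] /andP[? ?] ?; lra.
have Pbln u u0 : u <= u0 -> bln u u0 -> P u u0.
  move=> uu b U F p; have := entropy_dissipation (xi := 0) (c := f u0) p uu.
  rewrite !mul0r !subr0 subrr mulr0 addr0; apply => s sb.
  by rewrite mul0r subr0; apply: (b s).1.
apply/seteqP; split=> u0 /= => [[_ H]|b].
  by apply: bln_open => k; apply: Pk => //; exact: PN.
split=> //; have [ub|/ltW ub] := leP uB u0; first exact: Pbln.
rewrite -[uB]opprK -[u0]opprK; apply: PN; apply: Pbln; first by rewrite lerN2.
exact: bln_opp.
Qed.

(** * Lax-Friedrichs type schemes *)

Lemma sqr_gt4 M : 2 < M -> 4 < M ^+ 2.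
Proof. by move=> ?; nra. Qed.

Section lax.
Variables (M c : R).
Hypotheses (M2 : 2 < M) (cM : (3 * (8 * M) ^+ 2 - 3) / 2 <= c).

(* The numerical flux is [A x - C y].  The condition on the mesh ratio makes both
   functions increasing on the state space, so the scheme is monotone. *)
Let A s := f s / 2 + c * s.
Let C s := c * s - f s / 2.

Lemma lax_incr s t : - M <= s -> s < t -> t <= M -> A s < A t /\ C s < C t.
Proof.
move=> Ms st tM.
have c1 : - (c * (t - s)) < f t - f s < c * (t - s).
  have b : 0 <= chord t s <= 3 * M ^+ 2 by rewrite /chord; apply/andP; split; nra.
  move/andP: b => [b1 b2]; rewrite fluxB.
  have M0 : 0 < M by lra.
  have M4 := sqr_gt4 M2.
  have [c1 c2] : 3 < 2 * c /\ 3 * M ^+ 2 < 2 * c by move: cM; rewrite exprMn; split; lra.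
  apply/andP; split; nra.
by move/andP: c1 => [? ?]; rewrite /A /C; split; lra.
Qed.

Lemma lax_incrW s t : - M <= s -> s <= t -> t <= M -> A s <= A t /\ C s <= C t.
Proof.
move=> Ms; rewrite le_eqVlt => /orP[/eqP ->//|st] tM.
by have [? ?] := lax_incr Ms st tM; split; exact: ltW.
Qed.

Lemma lax_ivt a b y : a <= b -> C a <= y <= C b -> exists2 x, a <= x <= b & C x = y.
Proof.
move=> ab /andP[ya yb].
have [||x] := @IVT R C a b y ab.
- apply: continuous_subspaceT => x; apply: cvgB.
    by apply: cvgM; [exact: cvg_cst|exact: cvg_id].
  by apply: cvgM; [exact: continuous_flux|exact: cvg_cst].
- by rewrite ge_min ya le_max yb orbT.
- by rewrite in_itv/= => h1 h2; exists x.
Qed.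

(** Solving [A uB - C v = f u0] for [v]: the boundary condition at [s = uB] says
    that [v] does not lie before [uB], monotonicity of [A] that it does not lie
    beyond [u0]. *)
Lemma lax_next_up uB u0 : - M <= uB -> uB <= u0 -> u0 <= M -> f u0 <= f uB ->
  exists2 v, uB <= v <= u0 & A uB - C v = f u0.
Proof.
move=> h1 h2 h3 h4.
have [a _] := lax_incrW h1 h2 h3.
have [v v1 v2] : exists2 v, uB <= v <= u0 & C v = A uB - f u0.
  by apply: lax_ivt => //; rewrite /A /C in a *; apply/andP; split; lra.
by exists v => //; rewrite v2; ring.
Qed.

(** The affine entropies force the numerical flux [A uB - C v1] to be [f u0].
    Given this, for [k] between [uB] and [u0], the inequality with Kruzkov's
    entropy is the boundary condition at [k] if [v1] lies before [k], and
    otherwise the condition follows from the monotonicity of [A] and [C].  For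
    the converse two dissipation estimates are combined: with [xi = - 2 c], for
    which [f s - xi s = 2 A s], between [uB] and [v1], and with [xi = 0] between
    [v1] and [u0]; the choice of [v1] makes the terms with [U' v1] cancel. *)
Lemma lax_entropy_bln uB u0 : - M <= uB <= M -> - M <= u0 <= M ->
  (exists v1, - M <= v1 <= M /\ forall U F, convex_entropy_pair U F ->
     F u0 <= (F uB + F v1) / 2 - c * (U v1 - U uB)) <-> bln uB u0.
Proof.
pose P u u0 := exists v1, - M <= v1 <= M /\ forall U F, convex_entropy_pair U F ->
     F u0 <= (F u + F v1) / 2 - c * (U v1 - U u).
have PN u w : P u w -> P (- u) (- w).
  move=> [v [/andP[v1 v2] H]]; exists (- v); split; first by apply/andP; split; lra.
  by move=> U F p; exact: H _ _ (entropy_pair_opp p).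
have Pk u w k : - M <= u -> w <= M -> P u w -> u < k < w -> f w <= f k.
  move=> u1 w2 [v [/andP[v1 v2] H]] /andP[k1 k2].
  have g : A u - C v = f w.
    have := H _ _ (entropy_pair_id 1); have := H _ _ (entropy_pair_id (- 1)).
    by rewrite /A /C; lra.
  have c0 : 0 < c by have := sqr_gt4 M2; move: cM; rewrite exprMn; lra.
  have : Num.sg (w - k) * (f w - f k) <=
     (Num.sg (u - k) * (f u - f k) + Num.sg (v - k) * (f v - f k)) / 2
       - c * (`|v - k| - `|u - k|).
    apply/ler_addgt0Pr => e e0.
    pose d := e / (2 + 2 * c).
    have d0 : 0 < d by rewrite divr_gt0//; lra.
    have [U [F [p _ HU HF _]]] := kruzkov_pair k d0.
    have := H _ _ p; have := HF w; have := HF u; have := HF v.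
    have := HU v; have := HU u; rewrite !ler_norml.
    set f1 := Num.sg _ * _; set f2 := Num.sg _ * _; set f3 := Num.sg _ * _.
    move=> /andP[? ?] /andP[? ?] /andP[? ?] /andP[? ?] /andP[? ?] ?.
    have -> : e = d * (2 + 2 * c) by rewrite /d divfK//; apply: lt0r_neq0; lra.
    by nra.
  rewrite gtr0_sg ?subr_gt0// ltr0_sg ?subr_lt0//.
  have [a _] := lax_incr u1 k1 (ltW (lt_le_trans k2 w2)).
  have [kv|vk|kv] := ltgtP k v.
  - move=> _; have [_ h] := lax_incr (le_trans u1 (ltW k1)) kv v2.
    by rewrite /A /C in a g h; lra.
  - rewrite ltr0_sg ?subr_lt0// ltr0_norm ?subr_lt0// ltr0_norm ?subr_lt0//.
    by rewrite /A /C in g; lra.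
  - by move=> _; rewrite /A /C -kv in a g; lra.
have Pbln u w : - M <= u -> u <= w -> w <= M -> bln u w -> P u w.
  move=> u1 uw w2 b.
  have [] := lax_next_up u1 uw w2; first by apply: (b u).1; rewrite lexx.
  move=> v /andP[v1 v2] g; exists v; split; first by apply/andP; split; lra.
  move=> U F p.
  have H1 : forall s, u <= s <= v -> f u - (- (2 * c)) * u <= f s - (- (2 * c)) * s.
    move=> s /andP[s1 s2]; have [h _] := lax_incrW u1 s1 (le_trans s2 (le_trans v2 w2)).
    by rewrite /A in h; lra.
  have H2 : forall s, v <= s <= w -> f w <= f s - 0 * s.
    move=> s /andP[s1 s2]; rewrite mul0r subr0; apply: (b s).1.
    by rewrite s2 (le_trans v1).
  have := entropy_dissipation p v1 H1; have := entropy_dissipation p v2 H2.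
  have -> : f u - - (2 * c) * u - (f v - - (2 * c) * v) = 2 * (f w - f v).
    by rewrite -g /A /C; field.
  have -> : f u - - (2 * c) * u - (f u - - (2 * c) * u) = 0 by ring.
  rewrite !mul0r !subr0 subrr.
  by set D := derive1 U v; set X := f w - f v; lra.
move=> /andP[uB1 uB2] /andP[u1 u2]; split=> [H|b].
  apply: bln_open => k; first exact: Pk.
  by apply: Pk; [rewrite lerN2|rewrite lerNl|exact: PN].
have [ub|/ltW ub] := leP uB u0; first exact: Pbln.
rewrite -[uB]opprK -[u0]opprK; apply: PN; apply: Pbln.
- by rewrite lerN2.
- by rewrite lerN2.
- by rewrite lerNl.
- exact: bln_opp.
Qed.

End lax.
End entropy_sets.

(** * Layers of numerical schemes *)

Section layers.
Context {R : realType}.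
Implicit Types (uB u s x y w : R) (v : R -> R) (g : R -> R -> R) (S : set R).
Local Notation f := (@flux R).

Lemma layer_le v (l s : R) : v y @[y --> +oo] --> l ->
  (forall k : nat, v k%:R <= s) -> l <= s.
Proof.
move=> cv H; have cn : (fun k : nat => v k%:R) @ \oo --> l.
  exact: (cvg_comp _ _ (@cvgr_idn R) cv).
rewrite -(cvg_lim _ cn)//; apply: limr_le; first by apply/cvg_ex; exists l.
exact: nearW.
Qed.

Lemma layer_ge v (l s : R) : v y @[y --> +oo] --> l ->
  (forall k : nat, s <= v k%:R) -> s <= l.
Proof.
move=> cv H; rewrite -lerN2; apply: (@layer_le (fun y => - v y)).
  exact: cvgN.
by move=> k; rewrite lerN2.
Qed.

(** The trajectory of a discrete layer cannot jump over a state [s] that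
    every step of the scheme leaves on the same side. *)
Lemma layer_trap_le S g uB u0 s : uB <= s ->
  (forall x y, S x -> S y -> g x y = f u0 -> x <= s -> y <= s) ->
  E_layer_scheme S g uB u0 -> u0 <= s.
Proof.
move=> us H [_ [v [vS vk vg v0 cv]]].
apply: (layer_le cv) => k; elim: k => [|k IH].
  by rewrite v0// lexx ltr01.
have k0 : 0 <= k%:R :> R by [].
apply: (H _ _ _ _ _ IH); [exact: vS|exact: vS|].
by rewrite -natr1; exact: vg.
Qed.

Lemma layer_trap_ge S g uB u0 s : s <= uB ->
  (forall x y, S x -> S y -> g x y = f u0 -> s <= x -> s <= y) ->
  E_layer_scheme S g uB u0 -> s <= u0.
Proof.
move=> us H [_ [v [vS vk vg v0 cv]]].
apply: (layer_ge cv) => k; elim: k => [|k IH].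
  by rewrite v0// lexx ltr01.
have k0 : 0 <= k%:R :> R by [].
apply: (H _ _ _ _ _ IH); [exact: vS|exact: vS|].
by rewrite -natr1; exact: vg.
Qed.

Lemma layer_of_sequence S g uB u0 (x : nat -> R) : S u0 -> (forall k, S (x k)) ->
  x 0%N = uB -> (forall k, g (x k) (x k.+1) = f u0) -> x @ \oo --> u0 ->
  E_layer_scheme S g uB u0.
Proof.
move=> Su Sx x0 xg cx; split=> //; exists (fun y => x (Num.truncn y)); split.
- by [].
- by move=> k y H; rewrite natrK (Num.Theory.truncn_def H).
- move=> y y0; rewrite (_ : Num.truncn (y + 1) = (Num.truncn y).+1)//.
  apply: Num.Theory.truncn_def; have /andP[? ?] := Num.Theory.truncn_itv y0.
  by rewrite -!natr1 lerD2r ltrD2r natr1; apply/andP.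
- by move=> y H; rewrite (@Num.Theory.truncn_def _ y 0%N).
- apply/cvgrPdist_le => e e0; move/cvgrPdist_le: cx => /(_ e e0) [N _ HN].
  near=> y; apply: HN => /=.
  have ? : N%:R <= y by near: y; exact: nbhs_pinfty_ge.
  by rewrite Num.Theory.truncn_ge_nat//; apply: le_trans (ler0n _ N) _.
Unshelve. all: by end_near. Qed.

Lemma E_layer_scheme_opp S g uB u0 : (forall x y, g (- x) (- y) = - g x y) ->
  (forall x, S x -> S (- x)) ->
  E_layer_scheme S g uB u0 -> E_layer_scheme S g (- uB) (- u0).
Proof.
move=> gN SN [Su [v [vS vk vg v0 cv]]]; split; first exact: SN.
exists (fun y => - v y); split.
- by move=> y y0; apply/SN/vS.
- by move=> k y H; rewrite (vk k).
- by move=> y y0; rewrite gN vg// fluxN.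
- by move=> y H; rewrite v0.
- exact: cvgN.
Qed.

Section lax_layer.
Variables (M c : R) (g : R -> R -> R).
Hypotheses (M2 : 2 < M) (cM : (3 * (8 * M) ^+ 2 - 3) / 2 <= c).
Hypothesis gE : forall x y, g x y = (f x / 2 + c * x) - (c * y - f y / 2).

Let gN x y : g (- x) (- y) = - g x y.
Proof. by rewrite !gE !fluxN; field. Qed.

Let SN x : (`[- M, M]%classic : set R) x -> (`[- M, M]%classic : set R) (- x).
Proof. by rewrite /= !in_itv/= => /andP[? ?]; apply/andP; split; lra. Qed.

(** If [f s <= f u0], then a step of the scheme cannot lead from [x <= s] to
    [y > s]: its flux would be less than [g s s = f s]. *)
Lemma lax_layer_strict_lt uB u0 s : - M <= uB -> u0 <= M -> uB <= s < u0 ->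
  E_layer_scheme `[- M, M] g uB u0 -> f u0 < f s.
Proof.
move=> h1 h2 /andP[us su] L; rewrite ltNge; apply/negP => fs.
suff : u0 <= s by rewrite leNgt su.
apply: (layer_trap_le us _ L) => x y; rewrite /= !in_itv/= => /andP[x1 x2] /andP[y1 y2].
rewrite gE => E xs; rewrite leNgt; apply/negP => sy.
have [a _] := lax_incrW M2 cM x1 xs (le_trans (ltW su) h2).
have [_ b] := lax_incr M2 cM (le_trans h1 us) sy y2.
lra.
Qed.

(** The layer is the increasing sequence of the states given by [lax_next_up].
    Its limit [l] satisfies [g l l = f l = f u0], and strictness of the boundary
    condition leaves only [l = u0]. *)
Lemma lax_layer_up uB u0 : - M <= uB -> uB <= u0 -> u0 <= M -> strict_bln uB u0 ->
  E_layer_scheme `[- M, M] g uB u0.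
Proof.
move=> h1 h2 h3 b.
have nx x : exists y, uB <= x <= u0 -> x <= y <= u0 /\ g x y = f u0.
  have [/andP[x1 x2]|] := boolP (uB <= x <= u0); last by exists 0.
  have [+ _] := strict_blnW b x; rewrite x1 x2 => /(_ isT) fx.
  have [y xy E] := lax_next_up M2 cM (le_trans h1 x1) x2 h3 fx.
  by exists y => _; rewrite gE.
have [nxt Hn] := choice nx.
pose x k := iter k nxt uB.
have xin k : uB <= x k <= u0.
  elim: k => [|k IH]; first by rewrite lexx.
  have [/andP[a a'] _] := Hn _ IH.
  by rewrite /= a' andbT (le_trans _ a)//; case/andP: IH.
have xnd : nondecreasing_seq x.
  by apply/nondecreasing_seqP => k; have [/andP[a a'] _] := Hn _ (xin k).
have ub : has_ubound (range x).
  by exists u0 => _ [k _ <-]; have /andP[] := xin k.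
have cx := nondecreasing_cvgn xnd ub.
set l := sup _ in cx.
have l1 : uB <= l by apply: ub_le_sup => //; exists 0%N.
have l2 : l <= u0.
  by apply: ge_sup => [|_ [k _ <-]]; [exists uB, 0%N|have /andP[] := xin k].
have cf : f (x k) @[k --> \oo] --> f l by apply: continuous_cvg => //; exact: continuous_flux.
have cx1 : x k.+1 @[k --> \oo] --> l by rewrite cvg_shiftS.
have cf1 : f (x k.+1) @[k --> \oo] --> f l by apply: continuous_cvg => //; exact: continuous_flux.
have cg : g (x k) (x k.+1) @[k --> \oo] --> g l l.
  under eq_fun do rewrite gE.
  rewrite gE; apply: cvgB; [apply: cvgD|apply: cvgB].
  - by apply: cvgM => //; exact: cvg_cst.
  - by apply: cvgM => //; exact: cvg_cst.
  - by apply: cvgM => //; exact: cvg_cst.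
  - by apply: cvgM => //; exact: cvg_cst.
have E : g l l = f u0.
  have e : (fun k => g (x k) (x k.+1)) = fun=> f u0.
    by apply/funext => k; have [_] := Hn _ (xin k).
  by rewrite e in cg; exact: (cvg_unique _ cg (cvg_cst _)).
have lu : l = u0.
  apply/eqP/negP => /negP ne; have := (b l).1; rewrite l1 lt_neqAle ne l2 => /(_ isT).
  by rewrite -E gE; lra.
rewrite lu in cx.
apply: (layer_of_sequence (x := x)) => //.
- by rewrite /= in_itv/= h3 (le_trans h1).
- move=> k; rewrite /= in_itv/=; have /andP[? ?] := xin k.
  by apply/andP; split; lra.
- by move=> k; have [_] := Hn _ (xin k).
Qed.

Lemma lax_layer uB u0 : - M <= uB <= M -> - M <= u0 <= M ->
  E_layer_scheme `[- M, M] g uB u0 <-> strict_bln uB u0.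
Proof.
move=> /andP[h1 h2] /andP[h3 h4]; split=> [L s|b].
- split=> H; first exact: lax_layer_strict_lt L.
  rewrite -ltrN2 -!fluxN; apply: (@lax_layer_strict_lt (- uB)).
  + by rewrite lerN2.
  + by rewrite lerNl.
  + by rewrite lerN2 ltrN2 andbC.
  + exact: E_layer_scheme_opp.
- have [ub|/ltW ub] := leP uB u0; first exact: lax_layer_up.
  rewrite -[uB]opprK -[u0]opprK; apply: E_layer_scheme_opp => //.
  apply: lax_layer_up; rewrite ?lerN2//; first by rewrite lerNl.
  exact: strict_bln_opp.
Qed.

End lax_layer.

(** * Godunov's scheme *)

(** Oleinik's description of the trace at [x / t = 0+].  The tie-break comes from
    the side on which the trace is taken: waves of speed 0 are behind it, so
    among the extremal states it is the one closest to the right datum. *)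
Definition interface_state (v w r : R) : Prop :=
  (v <= w -> v <= r <= w /\
     forall s, v <= s <= w -> f r <= f s /\ (f s = f r -> s <= r)) /\
  (w <= v -> w <= r <= v /\
     forall s, w <= s <= v -> f s <= f r /\ (f s = f r -> r <= s)).

Lemma interface_state_bln uB w (r : R) : interface_state uB w r -> bln uB r.
Proof.
move=> [H1 H2] s; have [h|/ltW h] := leP uB w.
- have [/andP[r1 r2] H] := H1 h; split=> /andP[s1 s2].
    by have [] := H s; rewrite // s1 (le_trans s2).
  have -> : r = uB by apply/le_anti; rewrite r1 (le_trans s1).
  by have -> : s = uB by apply/le_anti; rewrite s2 (le_trans r1).
- have [/andP[r1 r2] H] := H2 h; split=> /andP[s1 s2]; last first.
    by have [] := H s; rewrite // s2 (le_trans r1).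
  have -> : r = uB by apply/le_anti; rewrite r2 (le_trans s1).
  by have -> : s = uB by apply/le_anti; rewrite s1 (le_trans s2).
Qed.

Lemma bln_interface_state uB u0 (r : R) : bln uB u0 -> interface_state uB u0 r -> r = u0.
Proof.
move=> b [H1 H2]; have [h|/ltW h] := leP uB u0.
- have [/andP[r1 r2] H] := H1 h; have [|a1 a2] := H u0; first by rewrite h lexx.
  have := (b r).1; rewrite r1 r2 => /(_ isT) a3.
  by apply/le_anti; rewrite r2 a2//; apply/le_anti/andP.
- have [/andP[r1 r2] H] := H2 h; have [|a1 a2] := H u0; first by rewrite h lexx.
  have := (b r).2; rewrite r1 r2 => /(_ isT) a3.
  by apply/le_anti; rewrite r1 a2//; apply/le_anti/andP.
Qed.

Lemma interface_state_same x (r : R) : interface_state x x r -> r = x.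
Proof. by apply: bln_interface_state => s; split=> /le_anti ->. Qed.

Section godunov.
Variable rv : R -> R -> R.
Hypothesis rvP : forall v w : R, interface_state v w (rv v w).

(** Each trace satisfies the boundary condition with respect to the left datum,
    and a state which satisfies it is the trace obtained with itself as right
    datum. *)
Lemma range_rv_bln uB : [set rv uB w | w in setT] = [set u0 | bln uB u0].
Proof.
apply/seteqP; split=> [_ [w _ <-]|u0 b] /=; first exact: interface_state_bln (rvP _ _).
by exists u0 => //; exact: bln_interface_state (rvP _ _).
Qed.

(** A Riemann problem across a state [s] has flux at most [f s], so when
    [f s < f u0] no step with flux [f u0] crosses [s]. *)
Lemma godunov_layer_le uB u0 s : uB <= s <= u0 ->
  E_layer_scheme setT (fun x y => f (rv x y)) uB u0 -> f u0 <= f s.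
Proof.
move=> /andP[us su] L; rewrite leNgt; apply/negP => fs.
have {}su : s < u0 by rewrite lt_neqAle su andbT; apply: contraTneq fs => ->; rewrite ltxx.
suff : u0 <= s by rewrite leNgt su.
apply: (layer_trap_le us _ L) => x y _ _ E xs; rewrite leNgt; apply/negP => sy.
have [H _] := rvP x y; have [_ /(_ s)] := H (ltW (le_lt_trans xs sy)).
by rewrite xs (ltW sy) E => /(_ isT)[]; rewrite leNgt fs.
Qed.

Lemma godunov_layer_ge uB u0 s : u0 <= s <= uB ->
  E_layer_scheme setT (fun x y => f (rv x y)) uB u0 -> f s <= f u0.
Proof.
move=> /andP[us su] L; rewrite leNgt; apply/negP => fs.
have {}us : u0 < s by rewrite lt_neqAle us andbT; apply: contraTneq fs => ->; rewrite ltxx.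
suff : s <= u0 by rewrite leNgt us.
apply: (layer_trap_ge su _ L) => x y _ _ E xs; rewrite leNgt; apply/negP => sy.
have [_ H] := rvP x y; have [_ /(_ s)] := H (ltW (lt_le_trans sy xs)).
by rewrite xs (ltW sy) E => /(_ isT)[]; rewrite leNgt fs.
Qed.

Lemma godunov_layer uB :
  E_layer_scheme setT (fun x y => f (rv x y)) uB = [set u0 | bln uB u0].
Proof.
apply/seteqP; split=> u0 /= => [L s|b].
  by split=> H; [exact: godunov_layer_le L|exact: godunov_layer_ge L].
apply: (layer_of_sequence (x := fun k => if k is 0%N then uB else u0)) => //.
  case=> [|k]; first by rewrite (bln_interface_state b (rvP _ _)).
  by rewrite (interface_state_same (rvP _ _)).
by rewrite -cvg_shiftS; exact: cvg_cst.
Qed.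

(** The flux of the scheme at the boundary is that of the trace [r] of a Riemann
    problem, which satisfies the boundary condition; since [f r = f u0],
    Kruzkov's entropies give the boundary condition between [r] and [u0], and
    the two conditions compose. *)
Lemma godunov_entropy uB :
  E_entropy_scheme setT (fun U F x y => F (rv x y)) uB = [set u0 | bln uB u0].
Proof.
apply/seteqP; split=> u0 /= => [[_ [v [_ H]]]|b]; last first.
  split=> //; exists u0; split=> // U F _.
  by rewrite (bln_interface_state b (rvP _ _)).
have b := interface_state_bln (rvP uB v); set r := rv uB v in b H.
have E : f r = f u0.
  have := H _ _ (entropy_pair_id 1); have := H _ _ (entropy_pair_id (- 1)); lra.
have K k : Num.sg (u0 - k) * (f u0 - f k) <= Num.sg (r - k) * (f r - f k).
  apply/ler_addgt0Pr => e e0.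
  have e2 : 0 < e / 2 by rewrite divr_gt0.
  have [U [F [p _ _ HF _]]] := kruzkov_pair k e2.
  have := H _ _ p; have := HF u0; have := HF r; rewrite !ler_norml.
  by move=> /andP[? ?] /andP[? ?] ?; lra.
have b' : bln r u0.
  apply: bln_open => k /andP[k1 k2].
    by have := K k; rewrite gtr0_sg ?subr_gt0// ltr0_sg ?subr_lt0//; lra.
  have := K (- k); rewrite ltr0_sg; last by lra.
  by rewrite gtr0_sg ?fluxN; lra.
move=> s; have [B1 B2] := b s; have [B'1 B'2] := b' s.
split=> /andP[s1 s2].
- have [sr|/ltW rs] := leP s r; last by apply: B'1; rewrite rs.
  by rewrite -E; apply: B1; rewrite s1.
- have [rs|/ltW sr] := leP r s; last by apply: B'2; rewrite s1.
  by rewrite -E; apply: B2; rewrite rs.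
Qed.

End godunov.
End layers.

(** * Viscous layers *)

Section smoothness.
Context {R : realType}.
Implicit Types (g h v : R -> R) (x y : R).

(** The recursion runs through the derivative, as inductions on products and
    inverses require. *)
Fixpoint differentiable_times n g : Prop :=
  if n is n'.+1 then (forall x, derivable g x 1) /\ differentiable_times n' (derive1 g)
  else True.

Lemma smoothP g : smooth g <-> forall n, differentiable_times n g.
Proof.
split=> [H n|H n].
- elim: n g H => [//|n IH] g H; split; first exact: (H 0%N).
  by apply: IH => k x; rewrite -derive1Sn.
- elim: n g H => [|n IH] g H; first by move=> x; have [] := H 1%N.
  move=> x; rewrite derive1Sn; apply: IH => k.
  by have [] := H k.+1.
Qed.

Lemma differentiable_timesW n g : differentiable_times n.+1 g -> differentiable_times n g.
Proof. by elim: n g => [//|n IH] g [dg /IH]. Qed.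

Lemma differentiable_timesD n g h : differentiable_times n g ->
  differentiable_times n h -> differentiable_times n (fun x => g x + h x).
Proof.
elim: n g h => [//|n IH] g h [dg Dg] [dh Dh].
have d x := derD (derivable_is_derive (dg x)) (derivable_is_derive (dh x)).
split; first by move=> x; exact: (@ex_derive _ _ _ _ _ _ _ (d x)).
rewrite (_ : derive1 _ = fun x => derive1 g x + derive1 h x); first exact: IH.
by apply/funext => x; exact: is_derive_derive1.
Qed.

Lemma differentiable_timesM n g h : differentiable_times n g ->
  differentiable_times n h -> differentiable_times n (fun x => g x * h x).
Proof.
elim: n g h => [//|n IH] g h Dg Dh.
have [dg Dg'] := Dg; have [dh Dh'] := Dh.
have d x := derM (derivable_is_derive (dg x)) (derivable_is_derive (dh x)).
split; first by move=> x; exact: (@ex_derive _ _ _ _ _ _ _ (d x)).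
rewrite (_ : derive1 _ = fun x => derive1 g x * h x + g x * derive1 h x).
  by apply: differentiable_timesD; apply: IH => //; exact: differentiable_timesW.
by apply/funext => x; exact: is_derive_derive1.
Qed.

Lemma differentiable_times_cst n (k : R) : differentiable_times n (fun=> k).
Proof.
elim: n k => [//|n IH] k; split; first by move=> x; exact: (@ex_derive _ _ _ _ _ _ _ (der_cst k x)).
rewrite (_ : derive1 _ = fun=> (0 : R)); first exact: IH.
by apply/funext => x; exact: is_derive_derive1 (der_cst k x).
Qed.

Lemma differentiable_times_id n : differentiable_times n (fun x : R => x).
Proof.
case: n => [//|n]; split; first by move=> x; exact: (@ex_derive _ _ _ _ _ _ _ (der_id x)).
rewrite (_ : derive1 _ = fun=> (1 : R)); first exact: differentiable_times_cst.
by apply/funext => x; exact: is_derive_derive1 (der_id x).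
Qed.

Lemma differentiable_timesV n g : (forall x, g x != 0) ->
  differentiable_times n g -> differentiable_times n (fun x => (g x)^-1).
Proof.
move=> g0; elim: n => [//|n IH] Dg; have [dg Dg'] := Dg.
have d x : is_derive x 1 (fun x => (g x)^-1) (-1 * (derive1 g x * ((g x)^-1 * (g x)^-1))).
  apply: der_eq (is_deriveV (g0 x) (derivable_is_derive (dg x))) _.
  by rewrite /GRing.scale/= -exprVn expr2 mulN1r mulNr mulrC.
split; first by move=> x; exact: (@ex_derive _ _ _ _ _ _ _ (d x)).
rewrite (_ : derive1 _ = fun x => -1 * (derive1 g x * ((g x)^-1 * (g x)^-1))).
  have D := IH (differentiable_timesW Dg).
  apply: differentiable_timesM; first exact: differentiable_times_cst.
  by apply: differentiable_timesM => //; exact: differentiable_timesM.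
by apply/funext => x; exact: is_derive_derive1 (d x).
Qed.

Lemma smoothM g h : smooth g -> smooth h -> smooth (fun x => g x * h x).
Proof.
by move=> /smoothP Hg /smoothP Hh; apply/smoothP => n; exact: differentiable_timesM.
Qed.

Lemma smooth_derive1 g : smooth g -> smooth (derive1 g).
Proof. by move=> H n x; rewrite -derive1Sn. Qed.

Lemma smooth_continuous g : smooth g -> continuous g.
Proof. by move=> H x; apply/differentiable_continuous/derivable1_diffP; exact: (H 0%N). Qed.

(** Solutions of autonomous equations inherit the smoothness of the right-hand
    side, each derivative being a smooth function of the solution. *)
Lemma ode_smooth (H : R -> R) v (d : R) : smooth H -> 0 < d ->
  (forall y, - d < y -> is_derive y 1 v (H (v y))) -> smooth_ge0 v.
Proof.
move=> sH d0 dv.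
(* [Hn n (v y)] is the derivative of order [n] of [v]. *)
pose fix Hn n : R -> R := if n is n'.+1 then fun x => derive1 (Hn n') x * H x else fun x => x.
have sHn n : smooth (Hn n).
  elim: n => [|n IH]; first by apply/smoothP => k; exact: differentiable_times_id.
  by apply: smoothM; [exact: smooth_derive1|exact: sH].
have near_gt y : - d < y -> \forall z \near y, - d < z by exact: lt_nbhsr.
have dHn n y : - d < y -> is_derive y 1 (fun z => Hn n (v z)) (Hn n.+1 (v y)).
  move=> yd; apply: (der_comp (dv y yd)).
  exact: derivable_is_derive (sHn n 0%N (v y)).
have E n y : - d < y -> derive1n n v y = Hn n (v y).
  elim: n y => [//|n IH] y yd; rewrite derive1nS.
  apply: is_derive_derive1; apply: near_eq_is_derive (dHn n y yd).
  by apply: filterS (near_gt _ yd) => z zd; rewrite IH.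
move=> n y y0; have yd : - d < y by rewrite (lt_le_trans _ y0)// oppr_lt0.
apply: (@near_eq_derivable _ _ _ (fun z => Hn n (v z))).
  by apply: filterS (near_gt _ yd) => z zd; rewrite E.
exact: (@ex_derive _ _ _ _ _ _ _ (dHn n y yd)).
Qed.

End smoothness.

Section ode.
Context {R : realType}.
Implicit Types (k m v : R -> R) (x y z s t : R).

(** An autonomous equation with positive bounded speed is solved by inverting
    the travel time, which grows at least linearly. *)
Lemma positive_speed_ode k (K s0 : R) : continuous k -> (forall x, 0 < k x <= K) ->
  exists v : R -> R, [/\ v 0 = s0, forall y, is_derive y 1 v (k (v y)),
    forall x y, x <= y -> v x <= v y & forall x, exists y, x <= v y].
Proof.
move=> ck kK.
have K0 : 0 < K by have /andP[? ?] := kK 0; lra.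
have k0 x : k x != 0 by have /andP[? _] := kK x; rewrite gt_eqF.
have cp : continuous (fun x => (k x)^-1) by move=> x; apply: cvgV => //; exact: ck.
have [T [T0 dT]] := antiderivative_exists s0 cp.
have TK x y : x <= y -> K^-1 * (y - x) <= T y - T x.
  move=> xy.
  have dG z : is_derive z 1 (fun z => T z - K^-1 * z) ((k z)^-1 - K^-1 * 1).
    exact: derB (dT z) (derZ _ (der_id z)).
  have := derive_ge0_le xy (fun z _ => dG z).
  suff H : forall z, x <= z <= y -> 0 <= (k z)^-1 - K^-1 * 1.
    by move=> /(_ H); rewrite mulrBr; lra.
  by move=> z _; have /andP[? ?] := kK z; rewrite mulr1 subr_ge0 lef_pV2 ?posrE.
have Tlt x y : x < y -> T x < T y.
  move=> xy; have := TK _ _ (ltW xy).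
  have : 0 < K^-1 * (y - x) by rewrite mulr_gt0 ?invr_gt0 ?subr_gt0.
  lra.
have cT : continuous T by move=> x; exact: is_derive_continuous (dT x).
have Tsurj y : exists x, T x = y.
  have Ky : 0 <= K * `|y| by rewrite mulr_ge0// ltW.
  pose a := s0 - K * `|y|; pose b := s0 + K * `|y|.
  have ab : a <= b by rewrite /a /b; lra.
  have sa : s0 - a = K * `|y| by rewrite /a; ring.
  have sb : b - s0 = K * `|y| by rewrite /b; ring.
  have Ta : T a <= - `|y|.
    have := TK a s0; rewrite sa T0 mulKf ?gt_eqF// => H.
    have /H : a <= s0 by rewrite /a; lra.
    lra.
  have Tb : `|y| <= T b.
    have := TK s0 b; rewrite sb T0 mulKf ?gt_eqF// => H.
    have /H : s0 <= b by rewrite /b; lra.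
    lra.
  have [||x _ E] := @IVT R T a b y ab; last by exists x.
    exact: continuous_subspaceT.
  have := ler_norm y; have := ler_norm (- y); rewrite normrN => ? ?.
  by rewrite ge_min le_max; apply/andP; split; apply/orP; [left|right]; lra.
have [v Tv] := choice Tsurj.
have vT x : v (T x) = x.
  by have [/Tlt|/Tlt|//] := ltgtP (v (T x)) x; rewrite Tv ltxx.
exists v; split.
- by rewrite -T0 vT.
- move=> y; rewrite -{1}(Tv y) -[k _]invrK.
  apply: (@is_derive_inverse _ T) => //; last by rewrite invr_eq0.
  + by near do exact: vT.
  + by near do exact: cT.
- move=> x y xy; rewrite leNgt; apply/negP => /Tlt; rewrite !Tv.
  by rewrite ltNge xy.
- by move=> x; exists (T x); rewrite vT.
Unshelve. all: by end_near. Qed.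

(** An orbit of [v' = (b - v) m(v)] towards the rest point [b].  In the variable
    [- ln (b - v)] the speed is [m], which is bounded and, once modified behind
    the starting point, bounded away from 0 on bounded sets. *)
Lemma orbit_to_rest_point m (a b : R) : continuous m -> a < b ->
  (forall x, a <= x < b -> 0 < m x) ->
  exists v (d : R), [/\ 0 < d, v 0 = a,
    forall y, - d < y -> is_derive y 1 v ((b - v y) * m (v y))
    & v y @[y --> +oo] --> b].
Proof.
move=> cm ab m0.
have ma : 0 < m a by apply: m0; rewrite lexx.
have /nbhs_ballP[e /= e0 He] : \forall x \near a, 0 < m x.
  exact: (cm a _ (lt_nbhsr ma)).
pose a1 := a - e / 2.
have a1b : a1 < b by rewrite /a1; lra.
have m1 x : a1 <= x < b -> 0 < m x.
  move=> /andP[x1 x2]; have [ax|xa] := leP a x; first by apply: m0; rewrite ax.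
  apply: He; rewrite /ball/= ltr_norml; apply/andP; split; rewrite /a1 in x1; lra.
have [c _ mc] := @EVT_max R m a1 b (ltW a1b) (continuous_subspaceT cm).
pose s1 := - ln (b - a1).
pose X s := b - expR (- s).
pose k s := m (X (Num.max s s1)).
have Xs s : a1 <= X (Num.max s s1) < b.
  rewrite /X ltrBlDr ltrDl expR_gt0 andbT.
  have : expR (- Num.max s s1) <= b - a1.
    rewrite -[leRHS]lnK ?posrE ?subr_gt0// ler_expR lerNl -/s1.
    by rewrite le_max lexx orbT.
  lra.
have dX s : is_derive s 1 X (expR (- s)).
  apply: der_eq (derB (der_cst b s) (der_comp (derN (der_id s)) (is_derive_expR (- s)))) _.
  by rewrite mulrN1 sub0r opprK.
have ck : continuous k.
  move=> s; apply: (@continuous_comp _ _ _ (fun s => X (Num.max s s1)) m); last exact: cm.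
  apply: (@continuous_comp _ _ _ (fun s => Num.max s s1) X); last exact: is_derive_continuous.
  by apply: continuous_max; [exact: cvg_id|exact: cvg_cst].
have kb s : 0 < k s <= m c.
  rewrite /k m1//=; apply: mc; rewrite in_itv/=.
  by have /andP[-> /ltW ->] := Xs s.
pose s0 := - ln (b - a).
have s10 : s1 < s0.
  by rewrite ltrN2 ltr_ln ?posrE ?subr_gt0// /a1; lra.
have [w [w0 dw wnd wy]] := positive_speed_ode s0 ck kb.
have cw : continuous w by move=> y; exact: is_derive_continuous (dw y).
have /nbhs_ballP[d /= d0 Hd] : \forall y \near (0 : R), s1 < w y.
  have s1w : s1 < w 0 by rewrite w0.
  exact: (cw 0 _ (lt_nbhsr s1w)).
have ws y : - d < y -> s1 <= w y.
  move=> yd; have [y0|y0] := leP 0 y.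
    by apply: le_trans (ltW s10) _; rewrite -w0 wnd.
  by apply/ltW/Hd; rewrite /ball/= sub0r normrN ltr_norml; apply/andP; split; lra.
exists (fun y => X (w y)), d; split=> //.
- by rewrite w0 /X /s0 opprK lnK ?posrE ?subr_gt0//; ring.
- move=> y yd; apply: der_eq (der_comp (dw y) (dX (w y))) _.
  by rewrite /k max_l ?ws// /X; ring.
- apply/cvgrPdist_le => r r0.
  have [y0 Hy] := wy (- ln r).
  near=> y; rewrite /X opprB addrC subrK ger0_norm ?expR_ge0//.
  rewrite -[leRHS]lnK ?posrE// ler_expR lerNl (le_trans Hy)//; apply: wnd.
  by near: y; exact: (nbhs_pinfty_ge (num_real y0)).
Unshelve. all: by end_near. Qed.

End ode.

Section viscous_layer.
Context {R : realType}.
Implicit Types (uB u s x y : R) (v B : R -> R).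
Local Notation f := (@flux R).

(** The viscous profile equation, factored at its rest point, is
    [v' = (u - v) * layer_speed B u v]. *)
Definition layer_speed (B : R -> R) (u x : R) : R := (3 - chord x u) / (2 * B x).

Lemma layer_speedE B u x : B x != 0 -> (u - x) * layer_speed B u x = (f x - f u) / B x.
Proof. by move=> B0; rewrite fluxB /layer_speed; field. Qed.

Lemma continuous_layer_speed B u : continuous B -> (forall x, 0 < B x) ->
  continuous (layer_speed B u).
Proof.
move=> cB B0 x; apply: cvgM.
  apply: cvgB; first exact: cvg_cst.
  apply: cvgD; last exact: cvg_cst.
  apply: cvgD; last by apply: cvgM; [exact: cvg_id|exact: cvg_cst].
  by rewrite /= expr2; apply: cvgM; exact: cvg_id.
apply: cvgV; first by rewrite mulf_neq0// gt_eqF.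
by apply: cvgM; [exact: cvg_cst|exact: cB].
Qed.

Lemma smooth_layer B u : smooth B -> (forall x, 0 < B x) ->
  smooth (fun x => (f x - f u) / B x).
Proof.
move=> /smoothP sB B0; apply/smoothP => n; apply: differentiable_timesM; last first.
  by apply: differentiable_timesV => // x; rewrite gt_eqF.
apply: differentiable_timesD; last exact: differentiable_times_cst.
have -> : f = fun x => 2^-1 * (x * (x * x) + (- 3) * x).
  by apply/funext => x; rewrite /flux; field.
have I := differentiable_times_id n.
apply: differentiable_timesM; first exact: differentiable_times_cst.
apply: differentiable_timesD.
  by apply: differentiable_timesM => //; exact: differentiable_timesM.
by apply: differentiable_timesM => //; exact: differentiable_times_cst.
Qed.

(** Strictness of the boundary condition makes the reduced speed positive on the
    whole orbit, the starting point included. *)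
Lemma viscous_layer_orbit B uB u0 : smooth B -> (forall x, 0 < B x) ->
  strict_bln uB u0 -> exists v (d : R), [/\ 0 < d, v 0 = uB,
    forall y, - d < y -> is_derive y 1 v ((u0 - v y) * layer_speed B u0 (v y))
    & v y @[y --> +oo] --> u0].
Proof.
move=> sB B0 /strict_bln_chord[->|[u1 c3]].
  exists (fun=> uB), 1; split=> //; last exact: cvg_cst.
  by move=> y _; rewrite subrr mul0r; exact: der_cst.
have cm : continuous (layer_speed B u0).
  by apply: continuous_layer_speed => //; exact: smooth_continuous.
have mp x : chord x u0 < 3 -> 0 < layer_speed B u0 x.
  by move=> h; rewrite divr_gt0 ?mulr_gt0 ?subr_gt0.
have [lt|gt|<-] := ltgtP uB u0.
- apply: orbit_to_rest_point => // x H; apply/mp/(chord_lt u1 c3).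
  by rewrite H.
- have cmN : continuous (fun x => layer_speed B u0 (- x)).
    by move=> x; apply: continuous_comp; [exact: opp_continuous|exact: cm].
  have ltN : - uB < - u0 by rewrite ltrN2.
  have [x H|v [d [d0 v0 dv cv]]] := orbit_to_rest_point cmN ltN.
    apply/mp/(chord_lt u1 c3); apply/orP; right.
    by rewrite ltrNr lerNl andbC.
  exists (fun y => - v y), d; split=> //.
  + by rewrite v0 opprK.
  + by move=> y yd; apply: der_eq (derN (dv y yd)) _; ring.
  + by rewrite -[u0]opprK; exact: cvgN.
- exists (fun=> uB), 1; split=> //; last exact: cvg_cst.
  by move=> y _; rewrite subrr mul0r; exact: der_cst.
Qed.

(** A viscous profile starting at or below a state [s] with [f s <= f u0] stays
    below: its distance to [s] satisfies a linear differential inequality. *)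
Lemma viscous_profile_le B v uB u0 s : continuous B -> (forall x, 0 < B x) ->
  (forall y, 0 <= y -> derivable v y 1) ->
  (forall y, 0 <= y -> B (v y) * derive1 v y = f (v y) - f u0) -> v 0 = uB ->
  uB <= s -> f s <= f u0 -> forall y, 0 <= y -> v y <= s.
Proof.
move=> cB B0 dv vE v0 us fs.
(* The profile is differentiable for [y >= 0] only; [max 0 y] makes [c] continuous
   on the line.  With [C' = c], the function [exp (- C) * (s - v)] increases. *)
pose c y := - layer_speed B s (v (Num.max 0 y)).
have cc : continuous c.
  move=> y; apply: cvgN.
  apply: (@continuous_comp _ _ _ (fun y => v (Num.max 0 y)) (layer_speed B s)); last first.
    exact: continuous_layer_speed.
  apply: (@continuous_comp _ _ _ (fun y => Num.max 0 y) v).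
    by apply: continuous_max; [exact: cvg_cst|exact: cvg_id].
  apply/differentiable_continuous/derivable1_diffP/dv.
  by rewrite le_max lexx.
have [C [_ dC]] := antiderivative_exists 0 cc.
move=> y y0.
have dE x : 0 <= x <= y -> is_derive x 1 (fun x => expR (- C x) * (s - v x))
    (expR (- C x) * - c x * (s - v x) + expR (- C x) * (0 - derive1 v x)).
  move=> /andP[x0 _].
  exact: (derM (der_comp (derN (dC x)) (is_derive_expR (- C x)))
    (derB (der_cst s x) (derivable_is_derive (dv x x0)))).
have := derive_ge0_le y0 dE.
suff H : forall x, 0 <= x <= y ->
    0 <= expR (- C x) * - c x * (s - v x) + expR (- C x) * (0 - derive1 v x).
  move=> /(_ H); rewrite v0 => h.
  have : 0 <= expR (- C y) * (s - v y).
    by apply: le_trans h; rewrite mulr_ge0 ?expR_ge0 ?subr_ge0.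
  by rewrite pmulr_rge0 ?expR_gt0// subr_ge0.
move=> x /andP[x0 _].
rewrite -mulrA -mulrDr mulr_ge0 ?expR_ge0// sub0r subr_ge0.
rewrite /c max_r// opprK mulrC layer_speedE ?gt_eqF//.
rewrite ler_pdivlMr// mulrC vE// lerD2l lerN2//.
Qed.

Lemma viscous_layer_strict_lt B v uB u0 s : continuous B -> (forall x, 0 < B x) ->
  (forall y, 0 <= y -> derivable v y 1) ->
  (forall y, 0 <= y -> B (v y) * derive1 v y = f (v y) - f u0) -> v 0 = uB ->
  v y @[y --> +oo] --> u0 -> uB <= s < u0 -> f u0 < f s.
Proof.
move=> cB B0 dv vE v0 cv /andP[us su]; rewrite ltNge; apply/negP => fs.
have H := viscous_profile_le cB B0 dv vE v0 us fs.
suff : u0 <= s by rewrite leNgt su.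
rewrite -(cvg_lim _ cv)//; apply: limr_le; first by apply/cvg_ex; exists u0.
near=> y; apply: H.
by near: y; exact: nbhs_pinfty_ge.
Unshelve. all: by end_near. Qed.

Lemma E_layer_viscosity_bln B uB : smooth B -> (forall x, 0 < B x) ->
  E_layer_viscosity setT B uB = [set u0 | strict_bln uB u0].
Proof.
move=> sB B0; have cB := smooth_continuous sB.
apply/seteqP; split=> u0 /=.
- move=> [_ [v [sv _ vE v0 cv]]] s.
  have dv y : 0 <= y -> derivable v y 1 by exact: (sv 0%N).
  split=> H; first exact: (viscous_layer_strict_lt cB B0 dv vE v0 cv).
  have cBN : continuous (fun x => B (- x)).
    by move=> x; apply: continuous_comp; [exact: opp_continuous|exact: cB].
  have dvN y : 0 <= y -> is_derive y 1 (fun y => - v y) (- derive1 v y).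
    by move=> y0; exact: derN (derivable_is_derive (dv y y0)).
  rewrite -ltrN2 -!fluxN.
  apply: (@viscous_layer_strict_lt _ (fun y => - v y) (- uB) _ _ cBN).
  + by move=> x; exact: B0.
  + by move=> y /dvN d; exact: (@ex_derive _ _ _ _ _ _ _ d).
  + move=> y y0; rewrite (is_derive_derive1 (dvN y y0)) opprK mulrN vE// !fluxN.
    by rewrite opprB addrC opprK.
  + by rewrite v0.
  + exact: cvgN.
  + by rewrite lerN2 ltrN2 andbC.
- move=> b; split=> //; have [v [d [d0 v0 dv cv]]] := viscous_layer_orbit sB B0 b.
  have dv' y : - d < y -> is_derive y 1 v ((f (v y) - f u0) / B (v y)).
    by move=> /dv; rewrite layer_speedE ?gt_eqF.
  exists v; split=> //.
  + exact: (ode_smooth (smooth_layer sB B0) d0 dv').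
  + move=> y y0; have yd : - d < y by rewrite (lt_le_trans _ y0)// oppr_lt0.
    by rewrite (is_derive_derive1 (dv' y yd)) mulrC divfK// gt_eqF.
Qed.

End viscous_layer.

(** * Lebesgue integrals on the line and in the plane *)

Section affine_change.
Context {R : realType}.
Local Notation mu := (@lebesgue_measure R).
Variables (a b : R).
Hypothesis a0 : 0 < a.

Let phi : measurableTypeR R -> measurableTypeR R := fun x => a * x + b.

Let mphi : measurable_fun setT phi.
Proof. by apply: measurable_funD => //; exact: mulrl_measurable. Qed.

Lemma lebesgue_measure_affine A : measurable A -> mu A = (a%:E * mu (phi @^-1` A))%E.
Proof.
move=> mA.
have E := @lebesgue_measure_unique R
  (mscale (NngNum (ltW a0)) (pushforward mu (phi : measurableTypeR R -> measurableTypeR R))).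
rewrite E//= => {A mA E} _ [[c d] _ <-] /=.
rewrite /mscale/= /pushforward.
have -> : phi @^-1` `]c, d]%classic = `](c - b) / a, (d - b) / a]%classic.
  apply/seteqP; split=> x /=; rewrite !in_itv/= /phi.
    by rewrite ltr_pdivrMr// ler_pdivlMr// ltrBlDr lerBrDr mulrC.
  by rewrite ltr_pdivrMr// ler_pdivlMr// ltrBlDr lerBrDr mulrC.
rewrite !lebesgue_measure_itv/= !lte_fin ltr_pM2r ?invr_gt0// ltrD2r.
case: ifP => _; last by rewrite mule0.
by rewrite -!EFinB -EFinM; congr EFin; field; rewrite gt_eqF.
Qed.

End affine_change.

Section locally_bounded.
Context {d : measure_display} {T : measurableType d} {R : realType}.
Variable size : T -> R.
Implicit Types g h : T -> R.

(** Bounded on the sets where [size] is bounded: multipliers for the integrands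
    defined next. *)
Definition locally_bounded g := measurable_fun setT g /\
  forall N : R, exists K : R, forall x, size x <= N -> `|g x| <= K.

(** Bounded measurable functions with bounded support.  All the integrands below
    belong to this class, which settles integrability once for all. *)
Definition bsupp h := locally_bounded h /\ exists N : R, forall x, N < size x -> h x = 0.

Lemma locally_boundedD g h : locally_bounded g -> locally_bounded h ->
  locally_bounded (fun x => g x + h x).
Proof.
move=> [mg bg] [mh bh]; split; first exact: measurable_funD.
move=> N; have [K HK] := bg N; have [L HL] := bh N; exists (K + L) => x xN.
by apply: le_trans (ler_normD _ _) _; rewrite lerD ?HK ?HL.
Qed.

Lemma locally_boundedM g h : locally_bounded g -> locally_bounded h ->
  locally_bounded (fun x => g x * h x).
Proof.
move=> [mg bg] [mh bh]; split; first exact: measurable_funM.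
move=> N; have [K HK] := bg N; have [L HL] := bh N; exists (K * L) => x xN.
by rewrite normrM ler_pM ?HK ?HL.
Qed.

Lemma locally_bounded_cst (k : R) : locally_bounded (fun=> k).
Proof. by split=> [|N]; [exact: measurable_cst|exists `|k|]. Qed.

Lemma locally_boundedN g : locally_bounded g -> locally_bounded (fun x => - g x).
Proof.
move=> [mg bg]; split; first exact: measurable_funN.
by move=> N; have [K HK] := bg N; exists K => x xN; rewrite normrN HK.
Qed.

Lemma locally_boundedB g h : locally_bounded g -> locally_bounded h ->
  locally_bounded (fun x => g x - h x).
Proof. by move=> bg bh; apply: locally_boundedD => //; exact: locally_boundedN. Qed.

Lemma locally_bounded_bounded g (K : R) : measurable_fun setT g ->
  (forall x, `|g x| <= K) -> locally_bounded g.
Proof. by move=> mg bg; split=> // N; exists K. Qed.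

Lemma bsuppD g h : bsupp g -> bsupp h -> bsupp (fun x => g x + h x).
Proof.
move=> [bg [N HN]] [bh [L HL]]; split; first exact: locally_boundedD.
by exists (Num.max N L) => x; rewrite gt_max => /andP[? ?]; rewrite HN// HL// addr0.
Qed.

Lemma bsuppMl g h : locally_bounded g -> bsupp h -> bsupp (fun x => g x * h x).
Proof.
move=> bg [bh [L HL]]; split; first exact: locally_boundedM.
by exists L => x Lx; rewrite HL// mulr0.
Qed.

Lemma bsuppZ (k : R) h : bsupp h -> bsupp (fun x => k * h x).
Proof. by apply: bsuppMl; exact: locally_bounded_cst. Qed.

Lemma bsuppN h : bsupp h -> bsupp (fun x => - h x).
Proof.
move=> [bh [N HN]]; split; first exact: locally_boundedN.
by exists N => x Nx; rewrite HN// oppr0.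
Qed.

Lemma bsuppB g h : bsupp g -> bsupp h -> bsupp (fun x => g x - h x).
Proof. by move=> ng nh; apply: bsuppD => //; exact: bsuppN. Qed.

Lemma bsupp_bounded h : bsupp h -> exists K : R, forall x, `|h x| <= K.
Proof.
move=> [[_ bh] [N HN]]; have [K HK] := bh N.
exists (Num.max K 0) => x; have [xN|/HN ->] := leP (size x) N.
  by rewrite le_max HK.
by rewrite normr0 le_max lexx orbT.
Qed.

Lemma bsupp_integrable (mu : {measure set T -> \bar R}) h :
  (forall N : R, exists2 D, measurable D & (mu D < +oo)%E /\ forall x, size x <= N -> D x) ->
  bsupp h -> mu.-integrable setT (EFin \o h).
Proof.
move=> Hmu nh; have [K HK] := bsupp_bounded nh; have [[mh _] [N HN]] := nh.
have [D mD [Dfin HD]] := Hmu N.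
have -> : EFin \o h = (EFin \o h) \_ D.
  apply/funext => x; rewrite /patch; case: ifPn => // /negP nD /=.
  rewrite HN// ltNge; apply/negP => /HD Dx; apply: nD; exact/mem_set.
apply/(integrable_mkcond _ mD).
apply: measurable_bounded_integrable => //; first exact: measurable_funTS.
exists K; split; first exact: num_real.
by move=> L KL x _ /=; rewrite (le_trans (HK x))// ltW.
Qed.

End locally_bounded.

Section line_integrals.
Context {R : realType}.
Local Notation mu := (@lebesgue_measure R).
Implicit Types (g h : R -> R) (a b x K N : R).

Definition locally_bounded1 g := locally_bounded (fun x : measurableTypeR R => `|x|) g.
Definition bsupp1 h := bsupp (fun x : measurableTypeR R => `|x|) h.

Lemma bsupp1_integrable h : bsupp1 h -> mu.-integrable setT (EFin \o h).
Proof.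
apply: bsupp_integrable => N; exists `[- N, N]%classic; first exact: measurable_itv.
split; last by move=> x; rewrite /= in_itv/= ler_norml.
by rewrite /= lebesgue_measure_itv/=; case: ifP => // _; rewrite -EFinB ltry.
Qed.

Lemma continuous_locally_bounded1 g : continuous g -> locally_bounded1 g.
Proof.
move=> cg; split; first exact: continuous_measurable_fun.
move=> N; have [N0|N0] := leP 0 N; last first.
  by exists 0 => x /(le_trans (normr_ge0 x)); rewrite leNgt N0.
have cg' : {within `[- N, N], continuous (fun x => `|g x|)}.
  by apply: continuous_subspaceT => x; apply: continuous_comp; [exact: cg|exact: norm_continuous].
have [|c _ Hc] := @EVT_max R (fun x => `|g x|) (- N) N _ cg'; first by lra.
by exists `|g c| => x xN; apply: Hc; rewrite in_itv/= -ler_norml.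
Qed.

Lemma locally_bounded1_id : locally_bounded1 (fun x => x).
Proof. by apply: continuous_locally_bounded1 => x; exact: cvg_id. Qed.

Lemma locally_bounded1_comp (U z : R -> R) K : continuous U ->
  measurable_fun setT z -> (forall x, `|z x| <= K) -> locally_bounded1 (fun x => U (z x)).
Proof.
move=> cU mz zK; split.
  by apply: (measurableT_comp _ mz); exact: continuous_measurable_fun.
move=> N; have [_ /(_ K)[L HL]] := continuous_locally_bounded1 cU.
by exists L => x _; exact: HL.
Qed.

Lemma bsupp1_affine a b h : 0 < a -> bsupp1 h -> bsupp1 (fun x => h (a * x + b)).
Proof.
move=> a0 [[mh bh] [N HN]]; split; first split.
- apply: (measurableT_comp mh); apply: measurable_funD => //; exact: mulrl_measurable.
- move=> L; have [K HK] := bh (a * L + `|b|); exists K => x xL; apply: HK.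
  by apply: le_trans (ler_normD _ _) _; rewrite normrM gtr0_norm// lerD2r ler_wpM2l// ltW.
- exists ((N + `|b|) / a) => x; rewrite ltr_pdivrMr// => H; apply: HN.
  have := ler_normB (a * x + b) b; rewrite addrK normrM gtr0_norm//.
  by rewrite mulrC in H; lra.
Qed.

Lemma ge0_integral_affine (f : R -> \bar R) a b : 0 < a -> measurable_fun setT f ->
  (forall x, 0 <= f x)%E -> (\int[mu]_x f x = a%:E * \int[mu]_x f (a * x + b)%R)%E.
Proof.
move=> a0 mf f0.
pose phi : measurableTypeR R -> measurableTypeR R := fun x => a * x + b.
have mphi : measurable_fun setT phi.
  by apply: measurable_funD => //; exact: mulrl_measurable.
have := @ge0_integral_pushforward _ _ _ _ _ phi mphi mu setT f measurableT mf (fun y _ => f0 y).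
rewrite preimage_setT /comp /phi => <-.
rewrite -(@ge0_integral_mscale _ _ _ _ _ measurableT (NngNum (ltW a0)))//.
by apply: eq_measure_integral => A mA _; exact: (lebesgue_measure_affine b a0).
Qed.

Lemma Rintegral_affine h a b : 0 < a -> bsupp1 h ->
  \int[mu]_x h x = a * \int[mu]_x h (a * x + b).
Proof.
move=> a0 nh; have ih := bsupp1_integrable nh.
have ih' := bsupp1_integrable (bsupp1_affine b a0 nh).
have mh : measurable_fun setT (EFin \o h) by have /integrableP[] := ih.
have mp : measurable_fun setT (EFin \o h)^\+%E by exact: measurable_funepos.
have mn : measurable_fun setT (EFin \o h)^\-%E by exact: measurable_funeneg.
have E : (\int[mu]_x (EFin \o h) x =
    a%:E * \int[mu]_x (EFin \o (fun x => h (a * x + b)%R)) x)%E.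
  rewrite integralE [in RHS]integralE muleBr//; last first.
    rewrite fin_num_adde_defl// fin_numN.
    exact/(integrable_fin_num measurableT)/integrable_funeneg.
  rewrite (@ge0_integral_affine _ a b a0 mp); last by move=> ?; exact: funepos_ge0.
  rewrite (@ge0_integral_affine _ a b a0 mn); last by move=> ?; exact: funeneg_ge0.
  congr (_ * _ - _ * _)%E; apply: eq_integral => x _ /=.
    by rewrite !funeposE.
  by rewrite !funenegE.
rewrite /Rintegral -[LHS]/(fine (\int[mu]_x (EFin \o h) x)) E fineM//.
exact: integrable_fin_num.
Qed.

Lemma bsupp1_intD g h : bsupp1 g -> bsupp1 h ->
  \int[mu]_x (g x + h x) = \int[mu]_x g x + \int[mu]_x h x.
Proof. by move=> ng nh; rewrite RintegralD//; exact: bsupp1_integrable. Qed.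

Lemma bsupp1_intB g h : bsupp1 g -> bsupp1 h ->
  \int[mu]_x (g x - h x) = \int[mu]_x g x - \int[mu]_x h x.
Proof. by move=> ng nh; rewrite RintegralB//; exact: bsupp1_integrable. Qed.

Lemma bsupp1_intZ (k : R) h : bsupp1 h -> \int[mu]_x (k * h x) = k * \int[mu]_x h x.
Proof. by move=> nh; rewrite RintegralZl//; exact: bsupp1_integrable. Qed.

Lemma bsupp1_int_le g h : bsupp1 g -> bsupp1 h -> (forall x, g x <= h x) ->
  \int[mu]_x g x <= \int[mu]_x h x.
Proof.
by move=> ng nh gh; apply: le_Rintegral => //; exact: bsupp1_integrable.
Qed.

End line_integrals.

Section plane_integrals.
Context {R : realType}.
Local Notation mu := (@lebesgue_measure R).
Local Notation RR := (measurableTypeR R * measurableTypeR R)%type.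
Implicit Types (g h : RR -> R) (K N t x : R).

Definition locally_bounded2 g := locally_bounded (fun p : RR => Num.max `|p.1| `|p.2|) g.
Definition bsupp2 h := bsupp (fun p : RR => Num.max `|p.1| `|p.2|) h.

(** The product of the Borel sigma-algebras contains the open sets of the plane,
    since each is a countable union of squares with rational centres and sides. *)
Lemma open_measurable2 (A : set (R * R)) : open A -> measurable (A : set RR).
Proof.
move=> oA.
pose box (q : rat * rat * rat) : set RR :=
  ball (ratr q.1.1 : R) (ratr q.2) `*` ball (ratr q.1.2 : R) (ratr q.2).
have mbox q : measurable (box q) by apply: measurableX; exact: measurable_ball.
have -> : (A : set RR) = \bigcup_(q in [set q | box q `<=` (A : set RR)]) box q.
  apply/seteqP; split=> [[t x] Atx|p [q qA qp]]; last exact: qA.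
  have /nbhs_ballP[e /= e0 He] : nbhs (t, x) A by apply: open_nbhs_nbhs.
  have [r] : exists r : rat, 0 < (ratr r : R) < e / 2.
    have [r] := @rat_in_itvoo R 0 (e / 2) (divr_gt0 e0 (ltr0Sn R 1)).
    by rewrite in_itv/= => ?; exists r.
  move=> /andP[r0 re].
  have near_rat (y : R) : exists q : rat, `|ratr q - y| < ratr r.
    have [|q] := @rat_in_itvoo R (y - ratr r) (y + ratr r); first by lra.
    rewrite in_itv/= => /andP[q1 q2]; exists q.
    by rewrite ltr_norml; apply/andP; split; lra.
  have [q1 H1] := near_rat t; have [q2 H2] := near_rat x.
  exists (q1, q2, r) => [[t' x'] [/= b1 b2]|]; last by split.
  apply: He; rewrite /ball/= in b1 b2 *.
  split=> /=; rewrite /ball/=.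
    rewrite -(subrKA (ratr q1)) (le_lt_trans (ler_normD _ _))// distrC.
    by lra.
  rewrite -(subrKA (ratr q2)) (le_lt_trans (ler_normD _ _))// distrC.
  by lra.
rewrite bigcup_mkcond; apply: countable_bigcupT_measurable => // q.
by case: ifP.
Qed.

Lemma continuous_measurable2 (g : R * R -> R) : continuous g ->
  measurable_fun [set: RR] (g : RR -> R).
Proof.
move=> cg _; apply: (measurability _ (RGenOInfty.measurableE R)) => //.
move=> /= _ [_ [a ->] <-]; rewrite setTI; apply: open_measurable2.
by apply: open_comp => // p _; exact: cg.
Qed.

Lemma continuous_locally_bounded2 (g : R * R -> R) : continuous g ->
  locally_bounded2 (g : RR -> R).
Proof.
move=> cg; split; first exact: continuous_measurable2.
move=> N.
have cK : compact ((`[- N, N] : set R) `*` (`[- N, N] : set R)).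
  by apply: compact_setX; exact: segment_compact.
have /compact_bounded[K [_ HK]] : compact (g @` ((`[- N, N] : set R) `*` (`[- N, N] : set R))).
  by apply: continuous_compact => //; exact: continuous_subspaceT.
exists (`|K| + 1) => -[t x]; rewrite ge_max/= => /andP[t1 x1].
apply: (HK (`|K| + 1)); first by rewrite (le_lt_trans (ler_norm K))// ltrDl.
by exists (t, x) => //; split; rewrite /= in_itv/= -ler_norml.
Qed.

Lemma locally_bounded2_snd (g : R -> R) : locally_bounded1 g ->
  locally_bounded2 (fun p => g p.2).
Proof.
move=> [mg bg]; split; first exact: (measurableT_comp mg measurable_snd).
by move=> N; have [K HK] := bg N; exists K => p; rewrite ge_max => /andP[_ /HK].
Qed.

Lemma locally_bounded2_fst (g : R -> R) : locally_bounded1 g ->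
  locally_bounded2 (fun p => g p.1).
Proof.
move=> [mg bg]; split; first exact: (measurableT_comp mg measurable_fst).
by move=> N; have [K HK] := bg N; exists K => p; rewrite ge_max => /andP[/HK].
Qed.

Lemma bsupp2_integrable h : bsupp2 h -> (mu \x mu)%E.-integrable setT (EFin \o h).
Proof.
apply: bsupp_integrable => N.
exists ((`[- N, N] : set R) `*` (`[- N, N] : set R)); first by apply: measurableX; exact: measurable_itv.
split; last first.
  by move=> [t x]; rewrite ge_max/= => /andP[? ?]; split; rewrite /= in_itv/= -ler_norml.
rewrite [X in (X < _)%E]product_measure1E; [|exact: measurable_itv|exact: measurable_itv].
rewrite /= lebesgue_measure_itv/=; case: ifP => // _; last by rewrite mule0.
by rewrite -EFinB -EFinM ltry.
Qed.

Lemma bsupp2_row h t : bsupp2 h -> bsupp1 (fun x => h (t, x)).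
Proof.
move=> [[mh bh] [N HN]]; split; first split.
- exact: measurableT_comp mh (measurable_pair1 t).
- move=> L; have [K HK] := bh (Num.max `|t| L); exists K => x xL; apply: HK => /=.
  by rewrite ge_max !le_max lexx xL orbT.
- by exists N => x Nx; apply: HN; rewrite lt_max Nx orbT.
Qed.

Lemma bsupp2_column h x : bsupp2 h -> bsupp1 (fun t => h (t, x)).
Proof.
move=> [[mh bh] [N HN]]; split; first split.
- exact: measurableT_comp mh (measurable_pair2 x).
- move=> L; have [K HK] := bh (Num.max `|x| L); exists K => t tL; apply: HK => /=.
  by rewrite ge_max !le_max lexx tL orbT.
- by exists N => t Nt; apply: HN; rewrite lt_max Nt.
Qed.

Lemma integral_rows h : bsupp2 h ->
  (\int[(mu \x mu)%E]_p (h p)%:E = (\int[mu]_t \int[mu]_x h (t, x))%:E)%E.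
Proof.
move=> nh; have ih := bsupp2_integrable nh.
have E : (\int[(mu \x mu)%E]_p (h p)%:E = \int[mu]_t (\int[mu]_x h (t, x))%:E)%E.
  rewrite -(integral12_prod_meas1 ih); apply: eq_integral => t _.
  rewrite /fubini_F /Rintegral fineK//.
  exact: integrable_fin_num (bsupp1_integrable (bsupp2_row t nh)).
rewrite E /Rintegral fineK// -E.
exact: integrable_fin_num.
Qed.

Lemma integral_swap h : bsupp2 h ->
  \int[mu]_t \int[mu]_x h (t, x) = \int[mu]_x \int[mu]_t h (t, x).
Proof.
move=> nh; have ih := bsupp2_integrable nh.
apply: EFin_inj; rewrite -integral_rows// -(integral21_prod_meas1 ih).
have E : (\int[mu]_x fubini_G mu (EFin \o h) x = \int[mu]_x (\int[mu]_t h (t, x))%:E)%E.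
  apply: eq_integral => x _; rewrite /fubini_G /Rintegral fineK//.
  exact: integrable_fin_num (bsupp1_integrable (bsupp2_column x nh)).
rewrite E [in RHS]/Rintegral fineK// -E (integral21_prod_meas1 ih).
exact: integrable_fin_num.
Qed.

Lemma iterated_intD g h : bsupp2 g -> bsupp2 h ->
  \int[mu]_t \int[mu]_x (g (t, x) + h (t, x)) =
  \int[mu]_t \int[mu]_x g (t, x) + \int[mu]_t \int[mu]_x h (t, x).
Proof.
move=> ng nh; apply: EFin_inj; rewrite EFinD.
rewrite -(@integral_rows (fun p => g p + h p)); last exact: bsuppD.
rewrite -!integral_rows// -(integralD_EFin measurableT); [by []|exact: bsupp2_integrable..].
Qed.

End plane_integrals.

(** * Self-similar functions and test functions *)

Section test_functions.
Context {R : realType}.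
Local Notation mu := (@lebesgue_measure R).
Local Notation RR := (measurableTypeR R * measurableTypeR R)%type.
Implicit Types (t x y s u xi a b K N : R) (phi : R -> R -> R) (U F z : R -> R).

Lemma integral_derivative_eq0 (P p : R -> R) N : continuous p ->
  (forall x, is_derive x 1 P (p x)) -> (forall x, N < `|x| -> P x = 0 /\ p x = 0) ->
  \int[mu]_x p x = 0.
Proof.
move=> cp dP H0; pose L := `|N| + 1.
have NL : N < L by rewrite /L (le_lt_trans (ler_norm N))// ltrDl.
have L0 : 0 <= L by rewrite /L addr_ge0.
have -> : \int[mu]_x p x = \int[mu]_(x in `[- L, L]) p x.
  rewrite [RHS]Rintegral_mkcond; apply: eq_Rintegral => x _; rewrite /patch.
  case: ifPn => // /negP nx; apply: (H0 x _).2; rewrite ltNge; apply/negP => xN.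
  by apply: nx; rewrite inE/= in_itv/= -ler_norml (le_trans xN)// ltW.
rewrite (integral_is_derive _ cp dP); last by lra.
by rewrite (H0 L _).1 ?(H0 (- L) _).1 ?subrr// ?normrN ger0_norm.
Qed.

Section one_test_function.
Variables (phi : R -> R -> R) (a b : R).
Hypotheses (tphi : test_function phi) (a0 : 0 < a).
Hypothesis supp : forall t x, phi t x != 0 -> a <= t <= b /\ `|x| <= b.

Local Notation pt := (partial_t phi).
Local Notation px := (partial_x phi).

Lemma is_derive_test_t t x : is_derive t 1 (fun s => phi s x) (pt t x).
Proof. by have [H _ _ _ _] := tphi; exact: derivable_is_derive (H t x).1. Qed.

Lemma is_derive_test_x t x : is_derive x 1 (phi t) (px t x).
Proof. by have [H _ _ _ _] := tphi; exact: derivable_is_derive (H t x).2. Qed.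

Lemma test_eq0 t x : ~~ (a <= t <= b) || (b < `|x|) ->
  [/\ phi t x = 0, pt t x = 0 & px t x = 0].
Proof.
have z0 s y : ~~ (a <= s <= b) || (b < `|y|) -> phi s y = 0.
  move=> H; apply/eqP/negPn/negP => /supp[h1 h2].
  by move: H; rewrite h1 ltNge h2.
have dt0 s y : (\forall u \near s, phi u y = 0) -> pt s y = 0.
  move=> H; apply: is_derive_derive1; apply: near_eq_is_derive (der_cst 0 s).
  by apply: filterS H => u ->.
have dx0 s y : (\forall u \near y, phi s u = 0) -> px s y = 0.
  move=> H; apply: is_derive_derive1; apply: near_eq_is_derive (der_cst 0 y).
  by apply: filterS H => u ->.
move=> H; split; first exact: z0.
- apply: dt0; case/orP: H => [|xb]; last by exists 1 => //= s _; apply: z0; rewrite xb orbT.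
  rewrite negb_and -!ltNge => /orP[ta|bt].
    by apply: filterS (lt_nbhsl ta) => s sa; apply: z0; rewrite leNgt sa.
  by apply: filterS (lt_nbhsr bt) => s sa; apply: z0; rewrite andbC leNgt sa.
- apply: dx0; case/orP: H => [h|xb]; first by exists 1 => //= y _; apply: z0; rewrite h.
  have cn : `|y| @[y --> x] --> `|x| by exact: norm_continuous.
  have : \forall y \near x, b < `|y| by exact: (cn _ (lt_nbhsr xb)).
  by apply: filterS => y yb; apply: z0; rewrite yb orbT.
Qed.

Lemma test_eq0_far t x : b < Num.max `|t| `|x| ->
  [/\ phi t x = 0, pt t x = 0 & px t x = 0].
Proof.
rewrite lt_max => H; apply: test_eq0; case/orP: H => [bt|->]; last by rewrite orbT.
have [/andP[ta tb]/=|//] := boolP (a <= t <= b).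
by move: bt; rewrite ger0_norm ?(le_trans (ltW a0))// ltNge tb.
Qed.

Lemma test_partial_bounded : exists K, forall t x, `|pt t x| <= K /\ `|px t x| <= K.
Proof.
have [_ ct cx _ _] := tphi.
have N (g : RR -> R) : continuous (g : R * R -> R) ->
    (forall p, ~~ (a <= p.1 <= b) || (b < `|p.2|) -> g p = 0) -> exists K, forall p, `|g p| <= K.
  move=> cg g0; have [_ /(_ b)[K HK]] := continuous_locally_bounded2 cg.
  exists (Num.max K 0) => p; rewrite le_max.
  have [h|h] := boolP (~~ (a <= p.1 <= b) || (b < `|p.2|)).
    by rewrite g0// normr0 lexx orbT.
  apply/orP; left; apply: HK; move: h; rewrite negb_or negbK -leNgt => /andP[/andP[h1 h2] h3].
  by rewrite ge_max h3 andbT ger0_norm// (le_trans _ h1)// ltW.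
have [|K1 H1] := N (fun p => pt p.1 p.2) ct; first by move=> p /test_eq0[].
have [|K2 H2] := N (fun p => px p.1 p.2) cx; first by move=> p /test_eq0[].
exists (Num.max K1 K2) => t x; have h2 := H2 (t, x); have h1 := H1 (t, x).
by split; rewrite le_max; apply/orP; [left; exact: h1|right; exact: h2].
Qed.

(** The way to the continuity of the test functions as functions of two
    variables. *)
Lemma test_lipschitz : exists K, forall t x s y,
  `|phi s y - phi t x| <= K * (`|s - t| + `|y - x|).
Proof.
have [K HK] := test_partial_bounded; exists K => t x s y.
rewrite -(subrKA (phi t y)) (le_trans (ler_normD _ _))// mulrDr lerD//.
  by apply: (derive_norm_le (fun u => is_derive_test_t u y)) => u _ _; exact: (HK u y).1.
by apply: (derive_norm_le (is_derive_test_x t)) => u _ _; exact: (HK t u).2.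
Qed.

Lemma test_continuous : continuous (fun p : R * R => phi p.1 p.2).
Proof.
have [K HK] := test_lipschitz.
have K0 : 0 <= K by have := HK 0 0 1 0; rewrite !subrr subr0 normr1 normr0 addr0 mulr1; apply: le_trans.
move=> [t x]; apply/cvgrPdist_le => e e0.
pose r := e / (2 * K + 1).
have r0 : 0 < r by rewrite divr_gt0//; lra.
have := @nbhsx_ballx R (R * R)%type (t, x) r r0; apply: filterS => -[s y] [/=].
rewrite /ball/= => h1 h2.
rewrite distrC (le_trans (HK _ _ _ _))// distrC [`|y - x|]distrC.
have er : e = r * (2 * K + 1) by rewrite /r divfK// gt_eqF//; lra.
by rewrite er; nra.
Qed.

(** Chain rule along a ray.  Test functions are only known to have continuous
    partial derivatives, hence the mean value theorem in the first variable. *)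
Lemma is_derive_test_ray t xi :
  is_derive t 1 (fun s => phi s (s * xi)) (pt t (t * xi) + xi * px t (t * xi)).
Proof.
have [_ ct _ _ _] := tphi.
have dray : is_derive t 1 (fun s => s * xi) xi.
  by apply: der_eq (derM (der_id t) (der_cst xi t)) _; rewrite mulr0 addr0 mul1r.
have d2 : is_derive t 1 (fun s => phi t (s * xi)) (px t (t * xi) * xi).
  exact: der_comp dray (is_derive_test_x t (t * xi)).
have d1 : is_derive t 1 (fun s => phi s (s * xi) - phi t (s * xi)) (pt t (t * xi)).
  apply: is_derive_eps => e e0.
  have /cvgrPdist_le/(_ e e0)/nbhs_ballP[r /= r0 Hr] := ct (t, t * xi).
  exists (r / (`|xi| + 1)); first by rewrite divr_gt0// ltr_wpDl.
  move=> h; rewrite ltr_pdivlMr ?ltr_wpDl// => hr.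
  rewrite subrr subr0.
  have h1 : `|h| < r by apply: le_lt_trans hr; rewrite ler_peMr// lerDr.
  have h2 : `|h * xi| < r.
    by rewrite normrM; apply: le_lt_trans hr; rewrite ler_wpM2l// lerDl.
  set y := (t + h) * xi; set D := pt t (t * xi).
  have dd s : is_derive s 1 (fun s => phi s y - D * s) (pt s y - D * 1).
    exact: derB (is_derive_test_t s y) (derZ D (der_id s)).
  have := derive_norm_le (a := t) (b := t + h) (K := e) dd.
  rewrite (_ : t + h - t = h); last by ring.
  rewrite (_ : phi (t + h) y - D * (t + h) - (phi t y - D * t) =
    phi (t + h) y - phi t y - D * h); last by ring.
  apply=> s sh _; rewrite mulr1 distrC; apply: (Hr (s, y)); split => /=; rewrite /ball/=.
    by rewrite distrC (le_lt_trans sh).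
  by rewrite /y mulrDl opprD addrA subrr sub0r normrN.
have -> : (fun s => phi s (s * xi)) =
    fun s => (phi s (s * xi) - phi t (s * xi)) + phi t (s * xi).
  by apply/funext => s; rewrite subrK.
by apply: der_eq (derD d1 d2) _; congr (_ + _); exact: mulrC.
Qed.

Let N0 := Num.max b (b / a).

Lemma bsupp2_ray (g : R * R -> R) : continuous g ->
  (forall t x, ~~ (a <= t <= b) || (b < `|x|) -> g (t, x) = 0) ->
  bsupp2 (fun p : RR => g (p.1, p.1 * p.2)).
Proof.
move=> cg g0; split.
  apply: continuous_locally_bounded2 => -[t x].
  have c1 : (fst : R * R -> R) y @[y --> (t, x)] --> t by exact: cvg_fst.
  have c2 : (snd : R * R -> R) y @[y --> (t, x)] --> x by exact: cvg_snd.
  exact: (cvg_comp _ _ (cvg_pair c1 (cvgM c1 c2)) (cg (t, t * x))).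
exists N0 => -[t xi] /= H; apply: g0.
have [/andP[ta tb]/=|//] := boolP (a <= t <= b).
have t0 : 0 < t by apply: lt_le_trans ta.
move: H; rewrite lt_max !gt_max gtr0_norm// [b < t]ltNge tb/= => /andP[_].
by rewrite ltr_pdivrMr// mulrC normrM gtr0_norm// => /lt_le_trans; apply; rewrite ler_wpM2r.
Qed.

(** In the variables [(t, x / t)] the weak form of the entropy inequality splits
    into an exact [t]-derivative, which integrates to zero, and an integral over
    rays of the one-dimensional weak form of [(F - xi U)' + U <= 0]. *)
Lemma weak_form_rays U F z K : continuous U -> continuous F -> measurable_fun setT z ->
  (forall xi, `|z xi| <= K) ->
  (\int[(mu \x mu)%E]_(p in @half_plane R)
      (U (z (p.2 / p.1)) * pt p.1 p.2 + F (z (p.2 / p.1)) * px p.1 p.2)%R%:E =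
   (\int[mu]_t \int[mu]_xi
      ((F (z xi) - xi * U (z xi)) * (t * px t (t * xi)) - U (z xi) * phi t (t * xi)))%:E)%E.
Proof.
move=> cU cF mz zK.
have [_ ct cx _ _] := tphi; have cphi := test_continuous.
(* [q] is the quotient [x / t] on the support of the test function, and it is
   measurable on the whole plane. *)
pose q (p : RR) : R := p.2 * (Num.max p.1 a)^-1.
have mq : measurable_fun setT q.
  apply: measurable_funM; first exact: measurable_snd.
  have ci : continuous (fun t => (Num.max t a)^-1).
    move=> t; apply: cvgV; first by rewrite gt_eqF// lt_max a0 orbT.
    by apply: continuous_max; [exact: cvg_id|exact: cvg_cst].
  exact: (measurableT_comp (continuous_measurable_fun ci) measurable_fst).
have lbq (V : R -> R) : continuous V -> locally_bounded2 (fun p => V (z (q p))).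
  move=> cV; split.
    exact: (measurableT_comp (continuous_measurable_fun cV) (measurableT_comp mz mq)).
  move=> N; have [_ /(_ K)[L HL]] := continuous_locally_bounded1 cV.
  by exists L => p _; exact: HL.
have npt : bsupp2 (fun p : RR => pt p.1 p.2).
  split; first exact: continuous_locally_bounded2 ct.
  by exists b => -[t x] /test_eq0_far[].
have npx : bsupp2 (fun p : RR => px p.1 p.2).
  split; first exact: continuous_locally_bounded2 cx.
  by exists b => -[t x] /test_eq0_far[].
pose I1 (p : RR) := U (z (q p)) * pt p.1 p.2 + F (z (q p)) * px p.1 p.2.
have nI1 : bsupp2 I1.
  by apply: bsuppD; apply: bsuppMl => //; exact: lbq.
have -> : (\int[(mu \x mu)%E]_(p in @half_plane R)
    (U (z (p.2 / p.1)) * pt p.1 p.2 + F (z (p.2 / p.1)) * px p.1 p.2)%R%:E =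
    \int[(mu \x mu)%E]_p (I1 p)%:E)%E.
  rewrite integral_mkcond; apply: eq_integral => -[t x] _; rewrite /patch/= /I1 /q/=.
  have [ta|ta] := leP a t.
    by rewrite mem_set//= /half_plane/= (lt_le_trans a0).
  have [|_ -> ->] := @test_eq0 t x; first by rewrite leNgt ta.
  by rewrite !mulr0 addr0; case: ifP.
rewrite (integral_rows nI1); congr EFin.
(* [K1 (t, xi)] is the derivative of [t * phi t (t * xi)] with respect to [t]. *)
pose K1 (p : RR) := phi p.1 (p.1 * p.2) +
  p.1 * (pt p.1 (p.1 * p.2) + p.2 * px p.1 (p.1 * p.2)).
pose I2 (p : RR) := (F (z p.2) - p.2 * U (z p.2)) * (p.1 * px p.1 (p.1 * p.2)) -
  U (z p.2) * phi p.1 (p.1 * p.2).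
have lbz (V : R -> R) : continuous V -> locally_bounded2 (fun p => V (z p.2)).
  by move=> cV; apply: (@locally_bounded2_snd _ (fun x => V (z x))); exact: locally_bounded1_comp mz zK.
have lb1 : locally_bounded2 (fun p : RR => p.1).
  by exact: locally_bounded2_fst locally_bounded1_id.
have lb2 : locally_bounded2 (fun p : RR => p.2).
  by exact: locally_bounded2_snd locally_bounded1_id.
have nphi : bsupp2 (fun p : RR => phi p.1 (p.1 * p.2)).
  by apply: (bsupp2_ray cphi) => t x /test_eq0[].
have nptr : bsupp2 (fun p : RR => pt p.1 (p.1 * p.2)).
  by apply: (bsupp2_ray ct) => t x /test_eq0[].
have npxr : bsupp2 (fun p : RR => px p.1 (p.1 * p.2)).
  by apply: (bsupp2_ray cx) => t x /test_eq0[].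
have nK1 : bsupp2 (fun p => U (z p.2) * K1 p).
  apply: bsuppMl; first exact: lbz.
  by apply: bsuppD => //; apply: bsuppMl => //; apply: bsuppD => //; exact: bsuppMl.
have nI2 : bsupp2 I2.
  apply: bsuppB; last by apply: bsuppMl => //; exact: lbz.
  apply: bsuppMl; last exact: bsuppMl.
  by apply: locally_boundedB; [exact: lbz|apply: locally_boundedM => //; exact: lbz].
have -> : \int[mu]_t \int[mu]_x I1 (t, x) =
    \int[mu]_t \int[mu]_xi (U (z xi) * K1 (t, xi) + I2 (t, xi)).
  apply: eq_Rintegral => t _; have [ta|ta] := leP a t; last first.
    have E y : [/\ phi t y = 0, pt t y = 0 & px t y = 0].
      by apply: test_eq0; rewrite leNgt ta.
    apply: eq_Rintegral => y _; rewrite /I1 /K1 /I2 /=.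
    by have [_ -> ->] := E y; have [-> -> ->] := E (t * y); rewrite !(mulr0, addr0, subr0).
  have t0 : 0 < t by apply: lt_le_trans ta.
  rewrite (Rintegral_affine 0 t0 (bsupp2_row t nI1)).
  rewrite -bsupp1_intZ; last exact: (bsupp1_affine 0 t0 (bsupp2_row t nI1)).
  apply: eq_Rintegral => xi _; rewrite /I1 /K1 /I2 /q /= addr0 max_l//.
  by rewrite [t * xi]mulrC mulfK ?gt_eqF//; ring.
rewrite (iterated_intD nK1 nI2) (integral_swap nK1).
suff -> : \int[mu]_xi \int[mu]_t (U (z xi) * K1 (t, xi)) = 0 by rewrite add0r.
transitivity (\int[mu]_xi (0 : R)); last by rewrite /Rintegral integral0.
apply: eq_Rintegral => xi _.
have nK1' : bsupp2 K1.
  by apply: bsuppD => //; apply: bsuppMl => //; apply: bsuppD => //; exact: bsuppMl.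
rewrite (bsupp1_intZ _ (bsupp2_column xi nK1')).
suff -> : \int[mu]_t K1 (t, xi) = 0 by rewrite mulr0.
have ray (g : R * R -> R) : continuous g -> continuous (fun t => g (t, t * xi)).
  move=> cg t; have c1 : y @[y --> t] --> t by exact: cvg_id.
  have c2 : y * xi @[y --> t] --> t * xi by apply: cvgM; [exact: cvg_id|exact: cvg_cst].
  exact: (cvg_comp _ _ (cvg_pair c1 c2) (cg (t, t * xi))).
apply: (@integral_derivative_eq0 (fun t => t * phi t (t * xi)) (fun t => K1 (t, xi)) b).
- move=> t; apply: cvgD; first exact: (ray _ cphi).
  apply: cvgM; first exact: cvg_id.
  apply: cvgD; first exact: (ray _ ct).
  by apply: cvgM; [exact: cvg_cst|exact: (ray _ cx)].
- move=> t; apply: der_eq (derM (der_id t) (is_derive_test_ray t xi)) _.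
  by rewrite mul1r.
- move=> t bt; have [|y p1 p2] := @test_eq0_far t (t * xi); first by rewrite lt_max bt.
  by rewrite /K1/= y p1 p2 !(mulr0, addr0).
Qed.

End one_test_function.
End test_functions.

(** * Existence for the Riemann problem *)

Section bounded_convergence.
Context {R : realType}.
Local Notation mu := (@lebesgue_measure R).

Lemma bounded_convergence (g_ : nat -> R -> R) (g : R -> R) (K N : R) :
  (forall n, measurable_fun setT (g_ n)) -> (forall n x, `|g_ n x| <= K) ->
  (forall n x, N < `|x| -> g_ n x = 0) -> (forall x, g_ n x @[n --> \oo] --> g x) ->
  \int[mu]_x g_ n x @[n --> \oo] --> \int[mu]_x g x.
Proof.
move=> mg gK gN cg.
have mgl : measurable_fun setT g.
  by apply: (measurable_fun_cvg mg) => x _; exact: cg.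
have K0 : 0 <= K by apply: le_trans (gK 0%N 0).
have gK' x : `|g x| <= K.
  rewrite -(cvg_lim _ (cvg_norm (cg x)))//; apply: limr_le; last exact: nearW.
  by apply/cvg_ex; exists `|g x|; exact: cvg_norm.
have gN' x : N < `|x| -> g x = 0.
  move=> Nx; rewrite -(cvg_lim _ (cg x))//; apply/cvg_lim => //.
  by under eq_fun do rewrite gN//; exact: cvg_cst.
pose G (x : R) : R := if `|x| <= N then K else 0.
have nG : bsupp1 G.
  split; last by exists N => x Nx; rewrite /G leNgt Nx.
  apply: (@locally_bounded_bounded _ _ _ _ _ K).
    apply: measurable_fun_ifT => //=.
    by apply: measurable_fun_ler => //; exact: normr_measurable.
  by move=> x; rewrite /G; case: ifP => _; rewrite ?normr0// ger0_norm.
have iG := bsupp1_integrable nG.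
have HG (h : R -> R) : (forall x, `|h x| <= K) -> (forall x, N < `|x| -> h x = 0) ->
    forall x, `|h x| <= G x.
  move=> h1 h2 x; rewrite /G; have [//|Nx] := leP (`|x|) N.
  by rewrite h2// normr0.
have ig : mu.-integrable setT (EFin \o g).
  apply: le_integrable iG => //; first exact/measurable_EFinP.
  move=> x _ /=; rewrite lee_fin; apply: le_trans (ler_norm _).
  exact: HG.
have [] := @dominated_convergence _ _ R mu setT measurableT
  (fun n x => (g_ n x)%:E) (EFin \o g) (EFin \o G).
- by move=> n; apply/measurable_EFinP; exact: mg.
- by apply/measurable_EFinP.
- apply: aeW => x _; apply/fine_cvgP; split. by exists 0%N.
  exact: cg.
- exact: iG.
- by apply: aeW => x n _; rewrite /= lee_fin; apply: HG => y; [exact: gK|exact: gN].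
move=> _ _ H.
have fg : (\int[mu]_x (EFin \o g) x \is a fin_num)%E by exact: integrable_fin_num.
rewrite /Rintegral -[X in _ --> X]/(fine (\int[mu]_x (EFin \o g) x)).
apply: fine_cvg; rewrite fineK//; exact: H.
Qed.

End bounded_convergence.

Section translation.
Context {R : realType}.
Local Notation mu := (@lebesgue_measure R).
Implicit Types (g psi : R -> R) (h x : R).

Lemma locally_bounded1_shift g h : locally_bounded1 g ->
  locally_bounded1 (fun x => g (x - h)).
Proof.
move=> [mg bg]; split.
  apply: (measurableT_comp mg); exact: (@measurable_funB _ _ _ _ id (cst h)).
move=> N; have [K HK] := bg (N + `|h|); exists K => x xN; apply: HK.
by apply: le_trans (ler_normB _ _) _; rewrite lerD2r.
Qed.

Lemma Rintegral_translation g psi h : locally_bounded1 g -> bsupp1 psi ->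
  \int[mu]_x (g x * psi (1 * x + h)) = \int[mu]_x (g (x - h) * psi x).
Proof.
move=> bg npsi.
have n1 : bsupp1 (fun x => g (x - h) * psi x).
  by apply: bsuppMl => //; exact: locally_bounded1_shift.
rewrite (Rintegral_affine h ltr01 n1) mul1r; apply: eq_Rintegral => x _.
by rewrite mul1r addrK.
Qed.

End translation.

(** In this section [z xi] is an arbitrary minimiser of [f s - xi * s] over
    [v <= s <= w]. *)

Section minimisers.
Context {R : realType}.
Local Notation mu := (@lebesgue_measure R).
Local Notation f := (@flux R).
Implicit Types (x y xi s h K N C : R) (U F psi : R -> R).

Variables (v w : R) (z : R -> R).
Hypothesis zvw : forall xi, v <= z xi <= w.
Hypothesis zmin : forall xi s, v <= s <= w -> f (z xi) - xi * z xi <= f s - xi * s.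

(** Monotonicity does not depend on how the minimisers are selected. *)
Lemma minimiser_nd x1 x2 : x1 <= x2 -> z x1 <= z x2.
Proof.
rewrite le_eqVlt => /orP[/eqP ->//|x12].
have := zmin x1 (zvw x2); have := zmin x2 (zvw x1) => ? ?.
have : 0 <= (x2 - x1) * (z x2 - z x1) by lra.
by rewrite pmulr_rge0 ?subr_gt0// subr_ge0.
Qed.

Lemma measurable_minimiser : measurable_fun setT z.
Proof. by apply: nondecreasing_measurable => // x y xy; exact: minimiser_nd. Qed.

Lemma minimiser_bounded xi : `|z xi| <= Num.max `|v| `|w|.
Proof. exact: norm_between (zvw xi). Qed.

Let q U F xi := F (z xi) - xi * U (z xi).

(** Minimality of [z x2] is the hypothesis of [entropy_dissipation] with
    [xi = x2].  After division by [x2 - x1] the last term is a difference of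
    two values of [z], whose integral vanishes in the limit. *)
Lemma minimiser_dissipation U F C x1 x2 : convex_entropy_pair U F ->
  (forall s, v <= s <= w -> `|derive1 U s| <= C) -> x1 <= x2 ->
  q U F x2 - q U F x1 <= - (x2 - x1) * U (z x1) + C * (x2 - x1) * (z x2 - z x1).
Proof.
move=> p HC x12; have z12 := minimiser_nd x12.
have H : forall s, z x1 <= s <= z x2 -> f (z x2) - x2 * z x2 <= f s - x2 * s.
  move=> s /andP[s1 s2]; apply: zmin; have /andP[? ?] := zvw x1; have /andP[? ?] := zvw x2.
  by apply/andP; split; lra.
have := entropy_dissipation p z12 H; rewrite subrr mulr0 addr0.
have := zmin x1 (zvw x2); have := H (z x1); rewrite lexx z12 => /(_ isT).
set g := f (z x2) - x2 * z x2 - (f (z x1) - x2 * z x1) => h1 h2.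
have g1 : - ((x2 - x1) * (z x2 - z x1)) <= g <= 0 by rewrite /g; apply/andP; split; lra.
have : derive1 U (z x1) * g <= C * ((x2 - x1) * (z x2 - z x1)).
  apply: le_trans (ler_norm _) _; rewrite normrM ler_pM// ?HC//.
  by case/andP: g1 => ? ?; rewrite ler_norml; apply/andP; split; lra.
by rewrite /q; lra.
Qed.

(** Since [z] may jump, the derivative falls on the test function: it is replaced
    by a difference quotient, which a translation moves to [F (z) - xi U (z)],
    where [minimiser_dissipation] applies. *)
Lemma minimiser_entropy U F psi (dpsi : R -> R) N : convex_entropy_pair U F ->
  (forall x, is_derive x 1 psi (dpsi x)) -> continuous dpsi ->
  (forall x, 0 <= psi x) -> (forall x, N < `|x| -> psi x = 0) ->
  0 <= \int[mu]_xi ((F (z xi) - xi * U (z xi)) * dpsi xi - U (z xi) * psi xi).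
Proof.
move=> p dp cdp psi0 psiN.
have [cU cF] := entropy_pair_continuous p.
have [dU dU1 _ _ _] := entropy_pairE p.
have cU1 : continuous (derive1 U) by move=> x; exact: is_derive_continuous (dU1 x).
have [C HC] : exists C, forall s, v <= s <= w -> `|derive1 U s| <= C.
  have [_ /(_ (Num.max `|v| `|w|))[C HC]] := continuous_locally_bounded1 cU1.
  by exists C => s /norm_between; exact: HC.
have mz := measurable_minimiser; have bz := minimiser_bounded.
have cpsi : continuous psi by move=> x; exact: is_derive_continuous (dp x).
have npsi : bsupp1 psi.
  by split; [exact: continuous_locally_bounded1|exists N => x; exact: psiN].
have dpN := is_derive_eq0_far dp psiN.
have ndpsi : bsupp1 dpsi.
  by split; [exact: continuous_locally_bounded1|exists N => x; exact: dpN].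
have [K HK] := bsupp_bounded ndpsi.
have bU : locally_bounded1 (fun x => U (z x)) by exact: locally_bounded1_comp mz bz.
have bz1 : locally_bounded1 z by exact: locally_bounded_bounded mz bz.
have bq : locally_bounded1 (q U F).
  apply: locally_boundedB; first exact: locally_bounded1_comp mz bz.
  by apply: locally_boundedM => //; exact: locally_bounded1_id.
pose h (n : nat) : R := n.+1%:R^-1.
have h0 n : 0 < h n by rewrite invr_gt0.
have h1 n : h n <= 1 by rewrite invf_le1// ler1n.
have hc : h n @[n --> \oo] --> (0 : R) by exact: cvg_harmonic.
(* The translates are written in the form accepted by the affine change of
   variables *)
have tr (g : R -> R) (a : R) : bsupp1 g -> bsupp1 (fun x => g (1 * x + a)).
  by move=> ng; apply: bsupp1_affine.
(* The difference quotients that approximate [dpsi]; [err] collects the error of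
   [minimiser_dissipation]. *)
pose dq n x := (h n)^-1 * (psi (1 * x + h n) - psi x).
have ndq n : bsupp1 (dq n).
  by apply: bsuppZ; apply: bsuppB => //; exact: tr.
have dqK n x : `|dq n x| <= K.
  rewrite normrM ger0_norm ?invr_ge0 ?(ltW (h0 n))// mulrC ler_pdivrMr//.
  have := derive_norm_le (a := x) (b := 1 * x + h n) dp (fun y _ _ => HK y).
  by rewrite mul1r (_ : x + h n - x = h n) ?[`|h n|]gtr0_norm//; ring.
have far n x : N + 1 < `|x| -> psi x = 0 /\ psi (1 * x + h n) = 0.
  move=> Nx; rewrite !psiN//; last by lra.
  rewrite mul1r; have := ler_normB (x + h n) (h n); rewrite addrK (gtr0_norm (h0 n)).
  by have := h1 n; lra.
have dqN n x : N + 1 < `|x| -> dq n x = 0.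
  by move=> Nx; have [a b] := far n x Nx; rewrite /dq a b subrr mulr0.
have dqc x : dq n x @[n --> \oo] --> dpsi x.
  apply/cvgrPdist_le => e e0.
  have /cvgrPdist_le/(_ e e0)/nbhs_ballP[r /= r0 Hr] := cdp x.
  have /cvgrPdist_lt/(_ r r0) := hc; apply: filterS => n.
  rewrite sub0r normrN gtr0_norm// => hr.
  have dd y : is_derive y 1 (fun y => psi y - dpsi x * y) (dpsi y - dpsi x * 1).
    exact: derB (dp y) (derZ _ (der_id y)).
  have : `|psi (x + h n) - dpsi x * (x + h n) - (psi x - dpsi x * x)| <= e * `|x + h n - x|.
    apply: (derive_norm_le dd) => y yx _; rewrite mulr1 distrC; apply: Hr.
    rewrite /ball/= distrC (le_lt_trans yx)// (_ : x + h n - x = h n) ?gtr0_norm//; ring.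
  have xh : x + h n - x = h n by ring.
  rewrite xh [`|h n|]gtr0_norm// => H.
  rewrite /dq mul1r distrC (_ : _ - dpsi x =
    (psi (x + h n) - dpsi x * (x + h n) - (psi x - dpsi x * x)) / h n).
    by rewrite normrM normfV [`|h n|]gtr0_norm// ler_pdivrMr.
  by field; rewrite gt_eqF.
pose g n x := q U F x * dq n x - U (z x) * psi x.
pose err n x := z x * (psi x - psi (1 * x + h n)).
have nUp : bsupp1 (fun x => U (z x) * psi x) by exact: bsuppMl.
have [K2 HK2] := bsupp_bounded nUp.
have [_ /(_ (N + 1))[Kq HKq]] := bq.
have [Kp HKp] := bsupp_bounded npsi.
have ng n : bsupp1 (g n) by exact: (bsuppB (bsuppMl bq (ndq n)) nUp).
have nerr n : bsupp1 (err n) by apply: bsuppMl => //; apply: bsuppB => //; exact: tr.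
have cg : \int[mu]_x g n x @[n --> \oo] -->
    \int[mu]_x (q U F x * dpsi x - U (z x) * psi x).
  apply: (@bounded_convergence _ _ _ (`|Kq| * K + K2) (N + 1)).
  - by move=> n; have [[]] := ng n.
  - move=> n x; apply: le_trans (ler_normB _ _) _; apply: lerD => //.
    have [xN|Nx] := leP (`|x|) (N + 1); last first.
      by rewrite dqN// mulr0 normr0 mulr_ge0// (le_trans _ (dqK 0%N 0)).
    by rewrite normrM ler_pM// (le_trans (HKq _ xN))// ler_norm.
  - by move=> n x Nx; rewrite /g dqN// (far n x Nx).1 !mulr0 subrr.
  - move=> x; apply: cvgB; last exact: cvg_cst.
    by apply: cvgM; [exact: cvg_cst|exact: dqc].
have cerr : \int[mu]_x err n x @[n --> \oo] --> (0 : R).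
  rewrite -[X in _ --> X](_ : \int[mu]_x (0 : R) = 0); last by rewrite /Rintegral integral0.
  apply: (@bounded_convergence _ _ _ (Num.max `|v| `|w| * (Kp + Kp)) (N + 1)).
  - by move=> n; have [[]] := nerr n.
  - by move=> n x; rewrite normrM ler_pM// (le_trans (ler_normB _ _))// lerD.
  - by move=> n x Nx; rewrite /err; have [-> ->] := far n x Nx; rewrite subrr mulr0.
  - move=> x; rewrite -(mulr0 (z x)); apply: cvgM; first exact: cvg_cst.
    rewrite -(subrr (psi x)); apply: cvgB; first exact: cvg_cst.
    have c : 1 * x + h n @[n --> \oo] --> x.
      by rewrite -[X in _ --> X]addr0 mul1r; apply: cvgD; [exact: cvg_cst|exact: hc].
    exact: (cvg_comp _ _ c (cpsi x)).
have gerr n : - (2 * C) * \int[mu]_x err n x <= \int[mu]_x g n x.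
  have -> : \int[mu]_x err n x = \int[mu]_x ((z x - z (x - h n)) * psi x).
    have n1 : bsupp1 (fun x => z x * psi x) by exact: bsuppMl.
    have n2 : bsupp1 (fun x => z (x - h n) * psi x).
      by apply: bsuppMl => //; exact: locally_bounded1_shift.
    have n3 : bsupp1 (fun x => z x * psi (1 * x + h n)) by apply: bsuppMl => //; exact: tr.
    have -> : \int[mu]_x err n x = \int[mu]_x (z x * psi x - z x * psi (1 * x + h n)).
      by apply: eq_Rintegral => x _; rewrite /err mulrBr.
    rewrite bsupp1_intB// Rintegral_translation// -bsupp1_intB//.
    by apply: eq_Rintegral => x _; rewrite mulrBl.
  have -> : \int[mu]_x g n x =
      \int[mu]_x (((h n)^-1 * (q U F (x - h n) - q U F x) - U (z x)) * psi x).
    have n1 : bsupp1 (fun x => q U F x * psi x) by exact: bsuppMl.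
    have n2 : bsupp1 (fun x => q U F (x - h n) * psi x).
      by apply: bsuppMl => //; exact: locally_bounded1_shift.
    have n3 : bsupp1 (fun x => q U F x * psi (1 * x + h n)) by apply: bsuppMl => //; exact: tr.
    have -> : \int[mu]_x g n x = \int[mu]_x ((h n)^-1 *
        (q U F x * psi (1 * x + h n) - q U F x * psi x) - U (z x) * psi x).
      by apply: eq_Rintegral => x _; rewrite /g /dq; ring.
    rewrite bsupp1_intB//; last by apply: bsuppZ; exact: bsuppB.
    rewrite bsupp1_intZ; last exact: bsuppB.
    rewrite bsupp1_intB// Rintegral_translation// -bsupp1_intB// -bsupp1_intZ; last exact: bsuppB.
    rewrite -bsupp1_intB//; last by apply: bsuppZ; exact: bsuppB.
    by apply: eq_Rintegral => x _; ring.
  have nz : bsupp1 (fun x => (z x - z (x - h n)) * psi x).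
    apply: bsuppMl => //; apply: locally_boundedB => //; exact: locally_bounded1_shift.
  rewrite -bsupp1_intZ//; apply: bsupp1_int_le; first exact: bsuppZ.
    apply: bsuppMl => //; apply: locally_boundedB => //.
    apply: locally_boundedM; first exact: locally_bounded_cst.
    by apply: locally_boundedB => //; exact: locally_bounded1_shift.
  move=> x; rewrite mulrA ler_wpM2r//.
  have xh : x - h n <= x by rewrite gerBl ltW.
  have := minimiser_dissipation p HC xh; rewrite (_ : x - (x - h n) = h n); last by ring.
  move=> D.
  have : `|U (z x) - U (z (x - h n))| <= C * (z x - z (x - h n)).
    apply: (derive_norm_le_itv (minimiser_nd xh) dU) => s /andP[s1 s2]; apply: HC.
    have /andP[? ?] := zvw x; have /andP[? ?] := zvw (x - h n).
    by apply/andP; split; lra.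
  rewrite ler_norml => /andP[_ HU].
  have : h n * (U (z (x - h n)) - C * (z x - z (x - h n))) <= q U F (x - h n) - q U F x by lra.
  rewrite -ler_pdivlMl// => D'.
  by move: D'; set Q := (h n)^-1 * _; lra.
have cl : - (2 * C) * \int[mu]_x err n x @[n --> \oo] --> (0 : R).
  by rewrite -(mulr0 (- (2 * C))); apply: cvgM; [exact: cvg_cst|exact: cerr].
by apply: (ler_cvg_to cl cg); exact: nearW.
Qed.

End minimisers.

Section riemann_existence.
Context {R : realType}.
Local Notation mu := (@lebesgue_measure R).
Local Notation RR := (measurableTypeR R * measurableTypeR R)%type.
Local Notation f := (@flux R).
Implicit Types (t x y xi s v w r : R) (z : R -> R).

Lemma measurable_self_similar z : measurable_fun setT z ->
  measurable_fun (@half_plane R) (fun p : RR => z (p.2 / p.1)).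
Proof.
move=> mz; apply: (measurableT_comp mz).
apply: measurable_funM; first exact: measurable_funTS measurable_snd.
apply: (@measurable_comp _ _ _ _ _ _ (`]0, +oo[%classic : set (measurableTypeR R))
  (fun t : measurableTypeR R => t^-1)).
- exact: measurable_itv.
- by move=> _ [p /= p0 <-]; rewrite in_itv/= andbT.
- apply: open_continuous_measurable_fun; first exact: interval_open.
  move=> t; rewrite inE/= in_itv/= andbT => t0.
  by apply: cvgV; [rewrite gt_eqF|exact: cvg_id].
- exact: measurable_funTS measurable_fst.
Qed.

Lemma minimiser_exists v w : v <= w -> exists z, (forall xi, v <= z xi <= w) /\
  forall xi s, v <= s <= w -> f (z xi) - xi * z xi <= f s - xi * s.
Proof.
move=> vw.
have H xi : exists c, v <= c <= w /\
    forall s, v <= s <= w -> f c - xi * c <= f s - xi * s.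
  have cf : {within `[v, w], continuous (fun s => f s - xi * s)}.
    apply: continuous_subspaceT => s; apply: cvgB; first exact: continuous_flux.
    by apply: cvgM; [exact: cvg_cst|exact: cvg_id].
  have [c c1 c2] := EVT_min vw cf; exists c; split; first by rewrite in_itv/= in c1.
  by move=> s sI; apply: c2; rewrite in_itv.
have [z Hz] := choice H.
by exists z; split=> xi; have [] := Hz xi.
Qed.

(** Finite speed of propagation: waves between bounded states stay in a wedge. *)
Lemma flux_slope_bounded (m : R) : exists2 L, 0 < L & forall s u : R, `|s| <= m -> `|u| <= m ->
  - L < (chord s u - 3) / 2 < L.
Proof.
exists (3 * m ^+ 2 + 2); first by have := sqr_ge0 m; lra.
move=> s u; rewrite !ler_norml => /andP[? ?] /andP[? ?]; rewrite /chord.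
by apply/andP; split; nra.
Qed.

(** At time [t] the solution differs from its datum only for [|x| <= L * t]. *)
Lemma initial_trace z v w (L K : R) : measurable_fun setT z -> 0 < L ->
  (forall xi, `|z xi| <= K) ->
  (forall xi, xi < - L -> z xi = v) -> (forall xi, L < xi -> z xi = w) ->
  forall r : R, 0 < r ->
  (\int[mu]_(x in [set` `[(- r)%R, r]%R])
     (`|z (x / t) - (if x < 0 then v else w)|)%R%:E)%E @[t --> 0^'+] --> 0%E.
Proof.
move=> mz L0 zK zv zw r r0.
have K0 : 0 <= K by apply: le_trans (zK 0).
pose M := K + (`|v| + `|w|).
have M0 : 0 <= M by rewrite !addr_ge0.
pose D : set R := `[- r, r]%classic.
have mD : measurable D by exact: measurable_itv.
pose g t x := `|z (x / t) - (if x < 0 then v else w)|.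
have mg t : measurable_fun setT (g t).
  apply: (measurableT_comp (@normr_measurable R setT)); apply: measurable_funB.
    by apply: (measurableT_comp mz); exact: mulrr_measurable.
  by apply: measurable_fun_ifT => //=; apply: measurable_fun_ltr.
have gM t x : g t x <= M.
  apply: le_trans (ler_normB _ _) _; rewrite lerD//.
  by case: ifP => _; rewrite ?lerDl ?lerDr.
have g0 t x : 0 < t -> L * t < `|x| -> g t x = 0.
  move=> t0; rewrite /g lter_normr => /orP[] H.
  - have x0 : 0 < x by apply: lt_trans H; rewrite mulr_gt0.
    have xt : L < x / t by rewrite ltr_pdivlMr.
    by rewrite (zw _ xt) ltNge (ltW x0)/= subrr normr0.
  - have x0 : x < 0 by rewrite -oppr_gt0; apply: lt_trans H; rewrite mulr_gt0.
    have xt : x / t < - L by rewrite ltr_pdivrMr// mulNr ltrNr.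
    by rewrite (zv _ xt) x0 subrr normr0.
have bound t : 0 < t -> (\int[mu]_(x in D) (g t x)%:E <= (M * (2 * (L * t)))%:E)%E.
  move=> t0; pose A : set R := `[- (L * t), L * t]%classic.
  have mA : measurable A by exact: measurable_itv.
  have mDA : measurable (D `&` A) by exact: measurableI.
  have -> : (\int[mu]_(x in D) (g t x)%:E = \int[mu]_(x in D `&` A) `|(g t x)%:E|)%E.
    rewrite integral_mkcondr; apply: eq_integral => x _; rewrite /patch.
    case: ifPn => [_|/negP nA]; first by rewrite gee0_abs// lee_fin normr_ge0.
    rewrite g0// ltNge; apply/negP => xL; apply: nA.
    by rewrite inE /A/= in_itv/= -ler_norml.
  apply: (@le_trans _ _ (M%:E * mu (D `&` A))%E).
    apply: integral_le_bound => //.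
    - by apply/measurable_EFinP; exact: (measurable_funTS (mg t)).
    - by apply: aeW => x _; rewrite lee_fin ger0_norm ?normr_ge0.
  rewrite EFinM; apply: lee_wpmul2l; first by rewrite lee_fin.
  apply: (@le_trans _ _ (mu A)); first by apply: le_measure; rewrite ?inE//; exact: subIsetr.
  rewrite lebesgue_measure_itv/= lte_fin; case: ifP => _.
    by rewrite -EFinB lee_fin; lra.
  by rewrite lee_fin !mulr_ge0// ltW.
apply: (@squeeze_cvge _ _ _ _ (fun=> 0%E) _ (fun t => (M * (2 * (L * t)))%:E)).
- near=> t; rewrite integral_ge0/=; first by apply: bound; near: t; exact: nbhs_right_gt.
  by move=> x _; rewrite lee_fin.
- exact: cvg_cst.
- apply: cvg_EFin; first exact: nearW.
  have E : M * (2 * (L * 0)) = 0 by rewrite !mulr0.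
  rewrite -[X in _ --> X]E; apply: cvg_at_right_filter.
  apply: (cvgM (cvg_cst M) (cvgM (cvg_cst (2 : R)) (cvgM (cvg_cst L) _))).
  exact: cvg_id.
Unshelve. all: by end_near. Qed.

(** A minimiser is constant and equal to a datum outside the wedge, which gives
    the initial condition, and monotone, which gives the trace. *)
Lemma riemann_exists_le v w : v <= w -> exists r, riemann_trace v w r.
Proof.
move=> vw; have [z [zvw zmin]] := minimiser_exists vw.
have nd := minimiser_nd zvw zmin.
have mz := measurable_minimiser zvw zmin.
have bz := minimiser_bounded zvw.
set m := Num.max `|v| `|w| in bz.
have [L L0 HL] := flux_slope_bounded m.
have vm : `|v| <= m by rewrite le_max lexx.
have wm : `|w| <= m by rewrite le_max lexx orbT.
have zv xi : xi < - L -> z xi = v.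
  move=> xL; have := zmin xi v; rewrite lexx vw => /(_ isT).
  have := fluxB (z xi) v; have /andP[h _] := HL _ _ (bz xi) vm.
  have /andP[h1 h2] := zvw xi; set S := chord _ _ in h * => E D.
  have : 0 <= (z xi - v) * (xi - (S - 3) / 2) by lra.
  by rewrite nmulr_lge0 ?subr_le0 => [?|]; [apply/le_anti/andP|lra].
have zw xi : L < xi -> z xi = w.
  move=> xL; have := zmin xi w; rewrite lexx vw => /(_ isT).
  have := fluxB (z xi) w; have /andP[_ h] := HL _ _ (bz xi) wm.
  have /andP[h1 h2] := zvw xi; set S := chord _ _ in h * => E D.
  have : 0 <= (z xi - w) * (xi - (S - 3) / 2) by lra.
  by rewrite pmulr_lge0 ?subr_ge0 => [?|]; [apply/le_anti/andP|lra].
have : cvg (z xi @[xi --> 0^'+]).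
  apply: nondecreasing_at_right_is_cvgr.
    by near=> x => ? ? _ _; exact: nd.
  by near=> x; exists v => _ [y _ <-]; have /andP[] := zvw y.
move=> /cvg_ex[/= r cr]; exists r, z; split=> //; split.
- exact: measurable_self_similar.
- by exists m => t x _.
- move=> U F p phi tphi; have [_ _ cx phi0 [a [b [a0 supp]]]] := tphi.
  have [cU cF] := entropy_pair_continuous p.
  rewrite (weak_form_rays tphi a0 (fun t x => (supp t x)) cU cF mz bz) lee_fin.
  apply: Rintegral_ge0 => t _.
  apply: (minimiser_entropy zvw zmin (psi := fun xi => phi t (t * xi))
     (dpsi := fun xi => t * partial_x phi t (t * xi)) (N := b / a) p).
  + move=> xi; apply: der_eq (der_comp (derZ t (der_id xi)) (is_derive_test_x tphi t (t * xi))) _.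
    by rewrite mulr1 mulrC.
  + move=> xi; apply: cvgM; first exact: cvg_cst.
    have c1 : t @[y --> xi] --> t by exact: cvg_cst.
    have c2 : t * y @[y --> xi] --> t * xi by apply: cvgM; [exact: cvg_cst|exact: cvg_id].
    exact: (cvg_comp _ _ (cvg_pair c1 c2) (cx (t, t * xi))).
  + by move=> xi; exact: phi0.
  + move=> xi bxi; apply/eqP/negPn/negP => /supp[/andP[ta _] h].
    have t0 : 0 < t by apply: lt_le_trans ta.
    move: bxi; rewrite ltr_pdivrMr// ltNge => /negP; apply.
    by apply: le_trans h; rewrite normrM gtr0_norm// mulrC ler_wpM2r.
- exact: (initial_trace mz L0 bz zv zw).
Unshelve. all: by end_near. Qed.

(** The flux is odd, so the conservation law is invariant under [u |-> - u]. *)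
Lemma riemann_trace_opp v w r : riemann_trace v w r -> riemann_trace (- v) (- w) (- r).
Proof.
move=> [z [[mz [C zC] ez iz] cz]]; exists (fun xi => - z xi); split; last exact: cvgN.
split.
- exact: (measurableT_comp (@oppr_measurable R setT) mz).
- by exists C => t x t0; rewrite normrN zC.
- move=> U F p phi tphi; exact: (ez _ _ (entropy_pair_opp p) phi tphi).
- move=> r0 r0p; have := iz r0 r0p; apply: cvg_trans; apply: near_eq_cvg.
  apply: nearW => t; apply: eq_integral => x _; congr EFin.
  by rewrite -normrN; congr (`| _ |); case: ifP => _; ring.
Qed.

Lemma riemann_exists v w : exists r, riemann_trace v w r.
Proof.
have [vw|/ltW wv] := leP v w; first exact: riemann_exists_le.
have [|r H] := @riemann_exists_le (- v) (- w); first by rewrite lerN2.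
by exists (- r); have := riemann_trace_opp H; rewrite !opprK.
Qed.

End riemann_existence.

(** * Uniqueness for the Riemann problem *)

Section separated_test_functions.
Context {R : realType}.
Local Notation mu := (@lebesgue_measure R).
Local Notation RR := (measurableTypeR R * measurableTypeR R)%type.
Implicit Types (t x y xi s K N : R) (U F psi dpsi z : R -> R).

(** The weight in time of the test functions, supported in [1, 2]. *)
Definition bump (t : R) : R := pospart (t - 1) ^+ 2 * pospart (2 - t) ^+ 2.

Definition bump_deriv (t : R) : R :=
  2 * pospart (t - 1) * pospart (2 - t) ^+ 2 - pospart (t - 1) ^+ 2 * (2 * pospart (2 - t)).

(** It agrees with the time on the support of the bump, and its positivity makes
    [x / clock t] smooth in the whole plane. *)
Definition clock (t : R) : R := t + pospart (1 - t) ^+ 2.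

Definition clock_deriv (t : R) : R := 1 - 2 * pospart (1 - t).

Lemma is_derive_pospart2_shift (a : R) t :
  is_derive t 1 (fun t => pospart (t - a) ^+ 2) (2 * pospart (t - a)).
Proof.
apply: der_eq (der_comp (derB (der_id t) (der_cst a t)) (is_derive_pospart2 (t - a))) _.
by rewrite subr0 mulr1.
Qed.

Lemma is_derive_pospart2_reflect (a : R) t :
  is_derive t 1 (fun t => pospart (a - t) ^+ 2) (- (2 * pospart (a - t))).
Proof.
apply: der_eq (der_comp (derB (der_cst a t) (der_id t)) (is_derive_pospart2 (a - t))) _.
by rewrite sub0r mulrN1.
Qed.

Lemma is_derive_bump t : is_derive t 1 bump (bump_deriv t).
Proof.
apply: der_eq (derM (is_derive_pospart2_shift 1 t) (is_derive_pospart2_reflect 2 t)) _.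
by rewrite /bump_deriv mulrN.
Qed.

Lemma is_derive_clock t : is_derive t 1 clock (clock_deriv t).
Proof. exact: (derD (der_id t) (is_derive_pospart2_reflect 1 t)). Qed.

Lemma continuous_pospart_comp (g : R -> R) : continuous g ->
  continuous (fun t => pospart (g t)).
Proof.
move=> cg t; apply: continuous_max; first exact: cvg_cst.
exact: cg.
Qed.

Lemma continuous_bump_deriv : continuous bump_deriv.
Proof.
have c1 : continuous (fun t : R => pospart (t - 1)).
  by apply: continuous_pospart_comp => t; apply: cvgB; [exact: cvg_id|exact: cvg_cst].
have c2 : continuous (fun t : R => pospart (2 - t)).
  by apply: continuous_pospart_comp => t; apply: cvgB; [exact: cvg_cst|exact: cvg_id].
have sq (g : R -> R) : continuous g -> continuous (fun t => g t ^+ 2).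
  by move=> cg t; exact: (cvgM (cg t) (cg t)).
move=> t; apply: cvgB; apply: cvgM.
- by apply: cvgM; [exact: cvg_cst|exact: c1].
- exact: (sq _ c2).
- exact: (sq _ c1).
- by apply: cvgM; [exact: cvg_cst|exact: c2].
Qed.

Lemma continuous_clock_deriv : continuous clock_deriv.
Proof.
have c : continuous (fun t : R => pospart (1 - t)).
  by apply: continuous_pospart_comp => t; apply: cvgB; [exact: cvg_cst|exact: cvg_id].
by move=> t; exact: (cvgB (cvg_cst (1 : R)) (cvgM (cvg_cst (2 : R)) (c t))).
Qed.

Lemma bump_ge0 t : 0 <= bump t.
Proof. by rewrite mulr_ge0 ?sqr_ge0. Qed.

Lemma bump_neq0 t : bump t != 0 -> 1 < t < 2.
Proof.
move=> b0; apply/andP; split; rewrite ltNge; apply/negP => h; move/eqP: b0; apply;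
  rewrite /bump; case: (pospartE (t - 1)) => -[? ->]; case: (pospartE (2 - t)) => -[? ->]; nra.
Qed.

Lemma clock_gt0 t : 0 < clock t.
Proof. by rewrite /clock; case: (pospartE (1 - t)) => -[? ->]; nra. Qed.

Lemma clockE t : 1 <= t -> clock t = t.
Proof. by move=> ?; rewrite /clock; case: (pospartE (1 - t)) => -[? ->]; nra. Qed.

Lemma bsupp1_bump : bsupp1 bump.
Proof.
split; first by apply: continuous_locally_bounded1 => t; exact: is_derive_continuous (is_derive_bump t).
exists 2 => t t2; apply/eqP/negPn/negP => /bump_neq0/andP[? ?].
by move: t2; rewrite ger0_norm; lra.
Qed.

Lemma bump_integral_gt0 : 0 < \int[mu]_t bump t.
Proof.
(* A rectangle below the bump. *)
pose g (t : R) : R := if (5 / 4 <= t <= 7 / 4) then 1 / 256 else 0.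
have mg : measurable_fun setT g.
  apply: measurable_fun_ifT => //=; apply: measurable_and.
    by apply: measurable_fun_ler.
  by apply: measurable_fun_ler.
have ng : bsupp1 g.
  split; first apply: (@locally_bounded_bounded _ _ _ _ _ 1) => //.
    by move=> t; rewrite /g; case: ifP => _; rewrite ?normr0// ger0_norm; lra.
  exists 2 => t t2; rewrite /g; case: ifP => // /andP[? ?].
  by move: t2; rewrite ger0_norm; lra.
apply: (@lt_le_trans _ _ (\int[mu]_t g t)); last first.
  apply: bsupp1_int_le => //; first exact: bsupp1_bump.
  move=> t; rewrite /g; case: ifP => [/andP[h1 h2]|_]; last exact: bump_ge0.
  rewrite /bump; case: (pospartE (t - 1)) => -[? ->]; case: (pospartE (2 - t)) => -[? ->]; try lra.
  have ? : 1 / 4 * (1 / 4) <= (t - 1) ^+ 2 by nra.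
  have ? : 1 / 4 * (1 / 4) <= (2 - t) ^+ 2 by nra.
  nra.
have -> : \int[mu]_t g t = \int[mu]_(t in `[5 / 4, 7 / 4]) (1 / 256).
  rewrite [RHS]Rintegral_mkcond; apply: eq_Rintegral => t _; rewrite /g /patch.
  by rewrite mem_setE in_itv.
rewrite Rintegral_cst; last exact: measurable_itv.
rewrite /= lebesgue_measure_itv/= lte_fin; case: ifP => /= h; last by lra.
by apply: mulr_gt0; lra.
Qed.

(** Test functions which are products of a bump in time and of a function of
    [x / t] separate the two integrals of [weak_form_rays]. *)
Lemma self_similar_entropy U F z K (u0 : R -> R) psi dpsi N :
  entropy_solution (fun t x => z (x / t)) u0 -> measurable_fun setT z ->
  (forall xi, `|z xi| <= K) -> convex_entropy_pair U F ->
  (forall x, is_derive x 1 psi (dpsi x)) -> continuous dpsi ->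
  (forall x, 0 <= psi x) -> (forall x, N < `|x| -> psi x = 0) -> 0 <= N ->
  0 <= \int[mu]_xi ((F (z xi) - xi * U (z xi)) * dpsi xi - U (z xi) * psi xi).
Proof.
move=> [_ _ ez _] mz zK p dp cdp psi0 psiN N0.
pose phi t x := bump t * psi (x / clock t).
pose pt t x := bump_deriv t * psi (x / clock t) +
  bump t * (dpsi (x / clock t) * (x * - (clock t ^- 2 * clock_deriv t))).
pose px t x := bump t * (dpsi (x / clock t) / clock t).
have c0 t : clock t != 0 by rewrite gt_eqF// clock_gt0.
have dt t x : is_derive t 1 (fun s => phi s x) (pt t x).
  have dc : is_derive t 1 (fun s => x / clock s) (x * - (clock t ^- 2 * clock_deriv t)).
    apply: (derZ x); apply: der_eq (is_deriveV (c0 t) (is_derive_clock t)) _.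
    by rewrite /GRing.scale/= mulNr.
  exact: (derM (is_derive_bump t) (der_comp dc (dp (x / clock t)))).
have dx t x : is_derive x 1 (phi t) (px t x).
  have dc : is_derive x 1 (fun y => y / clock t) (clock t)^-1.
    apply: der_eq (derM (der_id x) (der_cst (clock t)^-1 x)) _.
    by rewrite mul1r mulr0 addr0.
  exact: (derZ (bump t) (der_comp dc (dp (x / clock t)))).
have Ept : (fun p : R * R => partial_t phi p.1 p.2) = fun p => pt p.1 p.2.
  by apply/funext => -[t x]; exact: is_derive_derive1.
have Epx : (fun p : R * R => partial_x phi p.1 p.2) = fun p => px p.1 p.2.
  by apply/funext => -[t x]; exact: is_derive_derive1.
have cpsi : continuous psi by move=> x; exact: is_derive_continuous (dp x).
have f1 (g : R -> R) : continuous g -> continuous (fun p : R * R => g p.1).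
  move=> cg [t x]; have c1 : (fst : R * R -> R) y @[y --> (t, x)] --> t by exact: cvg_fst.
  exact: (cvg_comp _ _ c1 (cg t)).
have f2 : continuous (fun p : R * R => p.2).
  move=> [t x]; exact: cvg_snd.
have fM (g h : R * R -> R) : continuous g -> continuous h -> continuous (fun p => g p * h p).
  by move=> cg ch q; apply: cvgM; [exact: cg|exact: ch].
have cclock : continuous clock by move=> t; exact: is_derive_continuous (is_derive_clock t).
have cbump : continuous bump by move=> t; exact: is_derive_continuous (is_derive_bump t).
have ci : continuous (fun p : R * R => (clock p.1)^-1).
  by move=> q; apply: cvgV => //; exact: (f1 _ cclock).
have cr : continuous (fun p : R * R => p.2 / clock p.1) by exact: fM.
have cc (g : R -> R) : continuous g -> continuous (fun p : R * R => g (p.2 / clock p.1)).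
  by move=> cg q; exact: (cvg_comp _ _ (cr q) (cg _)).
have supp t x : phi t x != 0 -> 1 <= t <= 2 + 2 * N /\ `|x| <= 2 + 2 * N.
  rewrite mulf_eq0 negb_or => /andP[/bump_neq0/andP[t1 t2] h].
  split; first by apply/andP; split; lra.
  rewrite leNgt; apply/negP => xN; move/eqP: h; apply; apply: psiN.
  rewrite (clockE (ltW t1)) normrM normfV [`|t|]gtr0_norm; last by lra.
  by rewrite ltr_pdivlMr; [nra|lra].
have tphi : test_function phi.
  split.
  - move=> t x; split.
      exact: (@ex_derive _ _ _ _ _ _ _ (dt t x)).
    exact: (@ex_derive _ _ _ _ _ _ _ (dx t x)).
  - rewrite Ept => q; apply: cvgD.
      exact: (fM _ _ (f1 _ continuous_bump_deriv) (cc _ cpsi)).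
    apply: (fM _ _ (f1 _ cbump) (fM _ _ (cc _ cdp) (fM _ _ f2 _))) => {}q.
    apply: cvgN; apply: (fM _ _ _ (f1 _ continuous_clock_deriv)) => {}q.
    rewrite (_ : (fun p : R * R => clock p.1 ^- 2) = fun p => (clock p.1)^-1 * (clock p.1)^-1).
      exact: (fM _ _ ci ci).
    by apply/funext => p'; rewrite expr2 invfM.
  - by rewrite Epx; exact: (fM _ _ (f1 _ cbump) (fM _ _ (cc _ cdp) ci)).
  - by move=> t x; rewrite mulr_ge0 ?bump_ge0.
  - by exists 1, (2 + 2 * N); split.
have [cU cF] := entropy_pair_continuous p.
have := ez _ _ p phi tphi.
rewrite (weak_form_rays tphi ltr01 supp cU cF mz zK) lee_fin.
set J := \int[mu]_xi (_ - _).
have npsi : bsupp1 psi.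
  by split; [exact: continuous_locally_bounded1|exists N => x; exact: psiN].
have ndpsi : bsupp1 dpsi.
  by split; [exact: continuous_locally_bounded1|exists N; exact: is_derive_eq0_far dp psiN].
have bU : locally_bounded1 (fun xi => U (z xi)) by exact: locally_bounded1_comp mz zK.
have bF : locally_bounded1 (fun xi => F (z xi)) by exact: locally_bounded1_comp mz zK.
have bid := @locally_bounded1_id R.
have nJ : bsupp1 (fun xi => (F (z xi) - xi * U (z xi)) * dpsi xi - U (z xi) * psi xi).
  apply: bsuppB; apply: bsuppMl => //; apply: locally_boundedB => //.
  exact: locally_boundedM.
have -> : \int[mu]_t \int[mu]_xi ((F (z xi) - xi * U (z xi)) *
    (t * partial_x phi t (t * xi)) - U (z xi) * phi t (t * xi)) = \int[mu]_t (bump t * J).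
  apply: eq_Rintegral => t _; rewrite /J -bsupp1_intZ//; apply: eq_Rintegral => xi _.
  have -> : partial_x phi t (t * xi) = px t (t * xi) by exact: is_derive_derive1 (dx t _).
  rewrite /px /phi; have [->|/bump_neq0/andP[t1 _]] := eqVneq (bump t) 0.
    by rewrite !mul0r !mulr0 subrr.
  have t0 : t != 0 by rewrite gt_eqF// (lt_trans ltr01).
  by rewrite clockE 1?ltW// [t * xi]mulrC mulfK//; field.
rewrite RintegralZr//; last exact: bsupp1_integrable bsupp1_bump.
by rewrite pmulr_rge0// bump_integral_gt0.
Qed.

End separated_test_functions.

(** * Lebesgue points of the profile *)

Section mollifiers.
Context {R : realType}.
Local Notation mu := (@lebesgue_measure R).
Implicit Types (a b x y e : R) (z q : R -> R).

(** Mollifiers centred at [a], and the test functions, close to the indicator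
    function of the interval from [a] to [b], whose derivatives are differences
    of mollifiers. *)
Definition tent a e x : R := e^-1 * hat (e^-1 * (x - a)).

Definition plateau a b e x : R := step (e^-1 * (x - a)) - step (e^-1 * (x - b)).

Lemma is_derive_step_affine a e x :
  is_derive x 1 (fun x => step (e^-1 * (x - a))) (tent a e x).
Proof.
apply: der_eq (der_comp (derZ e^-1 (derB (der_id x) (der_cst a x))) (is_derive_step _)) _.
by rewrite /tent subr0 mulr1 mulrC.
Qed.

Lemma is_derive_plateau a b e x :
  is_derive x 1 (plateau a b e) (tent a e x - tent b e x).
Proof. exact: derB (is_derive_step_affine a e x) (is_derive_step_affine b e x). Qed.

Lemma tent_ge0 a e x : 0 < e -> 0 <= tent a e x.
Proof. by move=> e0; rewrite mulr_ge0 ?hat_ge0// invr_ge0 ltW. Qed.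

Lemma tent_le a e x : 0 < e -> tent a e x <= e^-1.
Proof. by move=> e0; rewrite ger_pMr ?invr_gt0// hat_le1. Qed.

Lemma tent_eq0 a e x : 0 < e -> e <= `|x - a| -> tent a e x = 0.
Proof.
move=> e0 h; rewrite /tent hat_eq0 ?mulr0// normrM gtr0_norm ?invr_gt0//.
by rewrite ler_pdivlMl// mulr1.
Qed.

Lemma continuous_tent a e : continuous (tent a e).
Proof.
move=> x; have c : e^-1 * (y - a) @[y --> x] --> e^-1 * (x - a).
  exact: (is_derive_continuous (derZ e^-1 (derB (der_id x) (der_cst a x)))).
exact: (cvgM (cvg_cst _) (cvg_comp _ _ c (@continuous_hat R _))).
Qed.

Lemma bsupp1_tent a e : 0 < e -> bsupp1 (tent a e).
Proof.
move=> e0; split; first by apply: continuous_locally_bounded1; exact: continuous_tent.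
exists (`|a| + e) => x h; apply: tent_eq0 => //.
by have := ler_normD (x - a) a; rewrite subrK; lra.
Qed.

Lemma tent_integral a e : 0 < e -> \int[mu]_x tent a e x = 1.
Proof.
move=> e0; have -> : \int[mu]_x tent a e x = \int[mu]_(x in `[a - e, a + e]) tent a e x.
  rewrite [RHS]Rintegral_mkcond; apply: eq_Rintegral => x _; rewrite /patch.
  case: ifPn => // /negP nx; apply: tent_eq0 => //; rewrite leNgt; apply/negP => xe.
  apply: nx; rewrite inE/= in_itv/=; move: xe; rewrite ltr_norml => /andP[? ?].
  by apply/andP; split; lra.
rewrite (integral_is_derive _ (@continuous_tent a e) (is_derive_step_affine a e)); last by lra.
have -> : e^-1 * (a + e - a) = 1 by field; rewrite gt_eqF.
have -> : e^-1 * (a - e - a) = - 1 by field; rewrite gt_eqF.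
by rewrite step_ge1// step_leN1// subr0.
Qed.

Lemma step_nd x y : x <= y -> step x <= step y.
Proof. by move=> xy; apply: (derive_ge0_le xy (fun t _ => is_derive_step t)) => t _; exact: hat_ge0. Qed.

Lemma plateau_ge0 a b e x : a <= b -> 0 < e -> 0 <= plateau a b e x.
Proof.
move=> ab e0; rewrite subr_ge0; apply: step_nd.
by rewrite ler_pM2l ?invr_gt0// lerD2l lerN2.
Qed.

Lemma plateau_eq0 a b e x : a <= b -> 0 < e -> ~~ (a - e <= x <= b + e) -> plateau a b e x = 0.
Proof.
move=> ab e0; rewrite negb_and -!ltNge /plateau => /orP[h|h].
  by rewrite !step_leN1 ?subrr// ler_pdivrMl//; lra.
by rewrite !step_ge1 ?subrr// ler_pdivlMl//; lra.
Qed.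

Lemma plateau_eq0_far a b e x : a <= b -> 0 < e -> `|a| + `|b| + e < `|x| ->
  plateau a b e x = 0.
Proof.
move=> ab e0 xN; apply: plateau_eq0 => //; apply/negP => /andP[h1 h2].
move: xN; rewrite ltNge => /negP; apply; rewrite ler_norml.
have := ler_norm b; have := ler_norm (- a); rewrite normrN.
by have := normr_ge0 a; have := normr_ge0 b => *; apply/andP; split; lra.
Qed.

Lemma bsupp1_plateau a b e : a <= b -> 0 < e -> bsupp1 (plateau a b e).
Proof.
move=> ab e0; split.
  by apply: continuous_locally_bounded1 => x; exact: is_derive_continuous (is_derive_plateau a b e x).
by exists (`|a| + `|b| + e) => x; exact: plateau_eq0_far.
Qed.

Lemma locally_bounded1_dist z (c K : R) : measurable_fun setT z -> (forall x, `|z x| <= K) ->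
  locally_bounded1 (fun x => `|z x - c|).
Proof.
move=> mz zK; apply: (@locally_bounded1_comp R (fun s => `|s - c|) z K _ mz zK) => s.
have cs : y - c @[y --> s] --> s - c by exact: (cvgB cvg_id (cvg_cst c)).
have cn : `|y| @[y --> s - c] --> `|s - c| by exact: norm_continuous.
exact: (cvg_comp _ _ cs cn).
Qed.

(** The tent is at most [e^-1] times the indicator function of the ball of radius
    [e], so its integral is at most twice the mean deviation over the ball. *)
Lemma lebesgue_pt_tent z a (K : R) : measurable_fun setT z -> (forall x, `|z x| <= K) ->
  lebesgue_pt z a -> \int[mu]_x (`|z x - z a| * tent a e x) @[e --> 0^'+] --> (0 : R).
Proof.
move=> mz zK; rewrite /lebesgue_pt => /fine_cvgP[fin cv].
have nz e : 0 < e -> bsupp1 (fun x => `|z x - z a| * tent a e x).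
  move=> e0; apply: bsuppMl; last exact: bsupp1_tent.
  exact: locally_bounded1_dist mz zK.
apply: (@squeeze_cvgr _ _ _ _ (fun=> 0) (fun e => 2 * fine (davg z a e))); last 2 first.
- exact: cvg_cst.
- by rewrite -[X in _ --> X](mulr0 2); apply: cvgM; [exact: cvg_cst|exact: cv].
near=> e; have e0 : 0 < e by near: e; exact: nbhs_right_gt.
apply/andP; split.
  by apply: Rintegral_ge0 => x _; rewrite mulr_ge0// tent_ge0.
have fe : davg z a e \is a fin_num by near: e; exact: fin.
rewrite -lee_fin EFinM (fineK fe) [X in (X%:E <= _)%E]/Rintegral fineK; last first.
  exact: (integrable_fin_num measurableT (bsupp1_integrable (nz e e0))).
rewrite /davg /iavg lebesgue_measure_ball ?(ltW e0)//.
have -> : ((e *+ 2)%:E^-1 = (2^-1 * e^-1)%:E)%E.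
  by rewrite inver mulrn_eq0/= gt_eqF// -invfM mulr_natl.
rewrite muleA -EFinM mulrA divff// mul1r.
have mb : measurable (ball a e) by exact: measurable_ball.
rewrite -ge0_integralZl//; last 2 first.
- apply: measurable_funTS; apply: measurableT_comp => //; apply/measurable_EFinP.
  exact: (@measurable_funB _ _ _ _ z (cst (z a))).
- by rewrite lee_fin invr_ge0 ltW.
rewrite [leRHS]integral_mkcond; apply: ge0_le_integral => //.
- by move=> x _; rewrite lee_fin mulr_ge0// tent_ge0.
- by apply/measurable_EFinP; have [[]] := nz e e0.
- apply/(measurable_restrictT _ _).1 => //.
  apply: measurable_funTS; apply: emeasurable_funM; first exact: measurable_cst.
  apply: measurableT_comp => //; apply/measurable_EFinP.
  exact: (@measurable_funB _ _ _ _ z (cst (z a))).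
- move=> x _; rewrite /patch; case: ifPn => [_|/negP nb] /=.
    by rewrite -EFinM lee_fin mulrC ler_wpM2r// tent_le.
  rewrite tent_eq0 ?mulr0// leNgt; apply/negP => xe; apply: nb.
  by rewrite inE /ball/= distrC.
Unshelve. all: by end_near. Qed.

(** Stated for [q] with Lipschitz dependence on [z] and [x]: the entropy flux in
    the moving frame has Lebesgue points where [z] has them. *)
Lemma tent_average z q a (K L : R) : measurable_fun setT z -> (forall x, `|z x| <= K) ->
  lebesgue_pt z a -> locally_bounded1 q ->
  (forall x, `|x - a| <= 1 -> `|q x - q a| <= L * (`|z x - z a| + `|x - a|)) ->
  \int[mu]_x (q x * tent a e x) @[e --> 0^'+] --> q a.
Proof.
move=> mz zK lz bq qL; apply/cvgrPdist_le => r r0.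
have L0 : 0 <= L.
  by have := qL (a + 1); rewrite addrAC subrr add0r normr1 lexx => /(_ isT); have := normr_ge0 (z (a + 1) - z a); have := normr_ge0 (q (a + 1) - q a); nra.
have r1 : 0 < r / (2 * (L + 1)) by rewrite divr_gt0//; lra.
have /cvgrPdist_le/(_ _ r1) H := lebesgue_pt_tent mz zK lz.
near=> e; have e0 : 0 < e by near: e; exact: nbhs_right_gt.
have e1 : e <= 1 by near: e; exact: nbhs_right_le.
have er : e <= r / (2 * (L + 1)) by near: e; exact: nbhs_right_le.
have nt := bsupp1_tent a e0.
have nq : bsupp1 (fun x => q x * tent a e x) by exact: bsuppMl.
have nc : bsupp1 (fun x => q a * tent a e x) by exact: bsuppZ.
have bz : locally_bounded1 (fun x => `|z x - z a|).
  exact: locally_bounded1_dist mz zK.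
have nz : bsupp1 (fun x => `|z x - z a| * tent a e x) by exact: bsuppMl.
have -> : q a - \int[mu]_x (q x * tent a e x) = - \int[mu]_x (q x * tent a e x - q a * tent a e x).
  by rewrite bsupp1_intB// bsupp1_intZ// tent_integral// mulr1 opprB.
rewrite normrN; apply: (le_trans (le_normr_Rintegral measurableT (bsupp1_integrable (bsuppB nq nc)))).
have E : \int[mu]_x (L * (`|z x - z a| * tent a e x) + L * e * tent a e x) <= r.
  rewrite bsupp1_intD; [|exact: bsuppZ|exact: bsuppZ].
  rewrite (bsupp1_intZ _ nz) (bsupp1_intZ _ nt) tent_integral// mulr1.
  have : `|0 - \int[mu]_x (`|z x - z a| * tent a e x)| <= r / (2 * (L + 1)) by near: e; exact: H.
  rewrite sub0r normrN ger0_norm; last first.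
    by apply: Rintegral_ge0 => x _; rewrite mulr_ge0// tent_ge0.
  set I := \int[mu]_x _ => HI.
  have Er : r = 2 * ((L + 1) * (r / (2 * (L + 1)))) by field; rewrite gt_eqF//; lra.
  rewrite Er; nra.
apply: le_trans E; apply: le_Rintegral => //.
- have n : bsupp1 (fun x => `|q x * tent a e x - q a * tent a e x|).
    have [[m b] [N HN]] := bsuppB nq nc; split; [split|].
    + exact: (measurableT_comp (@normr_measurable R setT) m).
    + by move=> M; have [B HB] := b M; exists B => x xM; rewrite normr_id HB.
    + by exists N => x Nx; rewrite HN// normr0.
  exact: bsupp1_integrable.
- by apply: bsupp1_integrable; apply: bsuppD; exact: bsuppZ.
- move=> x _; rewrite -mulrBl normrM (ger0_norm (tent_ge0 a x e0)).
  rewrite [X in _ <= X + _]mulrA -mulrDl.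
  have [xe|xe] := leP e `|x - a|; first by rewrite tent_eq0// !mulr0.
  apply: ler_wpM2r; first exact: tent_ge0.
  apply: le_trans (qL x _) _; first by rewrite (le_trans (ltW xe)).
  by rewrite mulrDr lerD2l ler_wpM2l// ltW.
Unshelve. all: by end_near. Qed.

(** Integration by parts: the derivative of [x * plateau] has integral 0, and the
    tents are approximate identities. *)
Lemma plateau_integral a b : a <= b -> \int[mu]_x plateau a b e x @[e --> 0^'+] --> b - a.
Proof.
move=> ab.
have lc c : lebesgue_pt (fun=> 0 : R) c.
  apply: (@continuous_lebesgue_pt _ _ _ setT) => //; first by split => //; exact: openT.
  exact: cvg_cst.
have av c : \int[mu]_x (x * tent c e x) @[e --> 0^'+] --> c.
  apply: (@tent_average (fun=> 0) (fun x => x) c 0 1) => //.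
  - by move=> x; rewrite normr0.
  - exact: locally_bounded1_id.
  - by move=> x _; rewrite subrr normr0 add0r mul1r.
apply: (cvg_trans _ (cvgB (av b) (av a))); apply: near_eq_cvg.
near=> e; have e0 : 0 < e by near: e; exact: nbhs_right_gt.
have bid := @locally_bounded1_id R.
have nt c : bsupp1 (fun x => x * tent c e x) by apply: bsuppMl => //; exact: bsupp1_tent.
have np := bsupp1_plateau ab e0.
pose D x := plateau a b e x + (x * tent a e x - x * tent b e x).
have dD x : is_derive x 1 (fun x => x * plateau a b e x) (D x).
  apply: der_eq (derM (der_id x) (is_derive_plateau a b e x)) _.
  by rewrite /D mul1r mulrBr.
have ID : \int[mu]_x D x = 0.
  apply: (integral_derivative_eq0 (N := `|a| + `|b| + e) _ dD).
    move=> x; apply: cvgD; first exact: is_derive_continuous (is_derive_plateau a b e x).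
    by apply: cvgB; apply: cvgM; [exact: cvg_id|exact: continuous_tent|exact: cvg_id|exact: continuous_tent].
  move=> x xN; have [? ?] : e <= `|x - a| /\ e <= `|x - b|.
    have := lerB_dist x a; have := lerB_dist x b.
    by have := normr_ge0 a; have := normr_ge0 b; split; lra.
  have P0 := plateau_eq0_far ab e0 xN.
  by rewrite /D P0 !tent_eq0// !mulr0 subrr addr0.
move: ID; rewrite (bsupp1_intD np (bsuppB (nt a) (nt b))) (bsupp1_intB (nt a) (nt b)) => ID.
rewrite -[LHS]/(\int[mu]_x (x * tent b e x) - \int[mu]_x (x * tent a e x)); lra.
Unshelve. all: by end_near. Qed.

End mollifiers.

Section entropy_decrease.
Context {R : realType}.
Local Notation mu := (@lebesgue_measure R).
Local Notation f := (@flux R).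
Implicit Types (a b x y e s u xi : R) (U F : R -> R).
Variables (z u0 : R -> R) (K : R).
Hypotheses (ez : entropy_solution (fun t x => z (x / t)) u0)
  (mz : measurable_fun setT z) (zK : forall x, `|z x| <= K).

Let lipschitz_on (g dg : R -> R) : (forall x, is_derive x 1 g (dg x)) -> continuous dg ->
  exists2 L, 0 <= L & forall s u, `|s| <= K -> `|u| <= K -> `|g s - g u| <= L * `|s - u|.
Proof.
move=> dgx cdg; have [_ /(_ K)[L HL]] := continuous_locally_bounded1 cdg.
have L0 : 0 <= L by apply: le_trans (HL (z 0) (zK 0)).
exists L => // s u sK uK; apply: (derive_norm_le dgx) => x _ xK; apply: HL.
by rewrite (le_trans xK)// ge_max uK.
Qed.

(** The one-dimensional inequality is tested with a plateau from [a] to [b] whose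
    slopes shrink to jumps; Lebesgue points are where the averages over the
    slopes converge. *)
Lemma entropy_decrease U F a b lo r : convex_entropy_pair U F ->
  lebesgue_pt z a -> lebesgue_pt z b -> a <= b -> 0 < r ->
  (forall x, a - r <= x <= b + r -> lo <= U (z x)) ->
  lo * (b - a) <= (F (z a) - a * U (z a)) - (F (z b) - b * U (z b)).
Proof.
move=> p la lb ab r0 Hlo.
pose q x := F (z x) - x * U (z x).
have [dU dU1 _ _ dF] := entropy_pairE p.
have [cU cF] := entropy_pair_continuous p.
have cU1 : continuous (derive1 U) by move=> x; exact: is_derive_continuous (dU1 x).
have cf1 : continuous (@flux_deriv R) by move=> x; exact: is_derive_continuous (is_derive_flux_deriv x).
have [LU LU0 HU] := lipschitz_on dU cU1.
have [LF LF0 HF] := lipschitz_on dF (fun x => cvgM (cU1 x) (cf1 x)).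
have bU : locally_bounded1 (fun x => U (z x)) by exact: locally_bounded1_comp mz zK.
have bF : locally_bounded1 (fun x => F (z x)) by exact: locally_bounded1_comp mz zK.
have bid := @locally_bounded1_id R.
have bq : locally_bounded1 q by apply: locally_boundedB => //; exact: locally_boundedM.
have qL c x : `|x - c| <= 1 ->
    `|q x - q c| <= (LF + (`|c| + 1) * LU + `|U (z c)|) * (`|z x - z c| + `|x - c|).
  move=> xc; have -> : q x - q c = (F (z x) - F (z c)) +
      (- (x * (U (z x) - U (z c))) + - ((x - c) * U (z c))) by rewrite /q; ring.
  have xl : `|x| <= `|c| + 1 by have := ler_normD (x - c) c; rewrite subrK; lra.
  have h1 := HF _ _ (zK x) (zK c); have h2 := HU _ _ (zK x) (zK c).
  apply: le_trans (ler_normD _ _) _.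
  have h3 := ler_normD (- (x * (U (z x) - U (z c)))) (- ((x - c) * U (z c))).
  rewrite !normrN !normrM in h3.
  have h4 : `|x| * `|U (z x) - U (z c)| <= (`|c| + 1) * (LU * `|z x - z c|).
    by apply: ler_pM.
  have := normr_ge0 (z x - z c); have := normr_ge0 (x - c); have := normr_ge0 c.
  move: h1 h3 h4; have := normr_ge0 (U (z c)).
  move: (normr_ge0 (F (z x) - F (z c))).
  set n1 := `|F _ - _|; set n2 := `|_ + _|; set n3 := `|U (z c)|; set n4 := `|z x - z c|.
  set n5 := `|x - c|; set n6 := `|c|; set n7 := `|x| * _ => *.
  have : 0 <= n3 * n4 by rewrite mulr_ge0.
  have : 0 <= n5 * LF by rewrite mulr_ge0.
  have : 0 <= n5 * ((n6 + 1) * LU) by rewrite !mulr_ge0//; lra.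
  lra.
have ta := tent_average mz zK la bq (qL a).
have tb := tent_average mz zK lb bq (qL b).
have pl := plateau_integral ab.
apply: (ler_cvg_to (cvgM (cvg_cst lo) pl) (cvgB ta tb)).
near=> e; have e0 : 0 < e by near: e; exact: nbhs_right_gt.
have er : e <= r by near: e; exact: nbhs_right_le.
rewrite -[leLHS]/(lo * \int[mu]_x plateau a b e x).
rewrite -[leRHS]/(\int[mu]_x (q x * tent a e x) - \int[mu]_x (q x * tent b e x)).
have np := bsupp1_plateau ab e0.
have nt c : bsupp1 (fun x => q x * tent c e x) by apply: (bsuppMl bq); exact: bsupp1_tent.
have nU : bsupp1 (fun x => U (z x) * plateau a b e x) by exact: bsuppMl.
have N0 : 0 <= `|a| + `|b| + e by rewrite !addr_ge0// ltW.
have := self_similar_entropy ez mz zK p (is_derive_plateau a b e)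
  (fun x => cvgB (@continuous_tent R a e x) (@continuous_tent R b e x))
  (fun x => plateau_ge0 x ab e0)
  (fun x => plateau_eq0_far ab e0) N0.
have -> : \int[mu]_xi ((F (z xi) - xi * U (z xi)) * (tent a e xi - tent b e xi) -
    U (z xi) * plateau a b e xi) = \int[mu]_x (q x * tent a e x) -
    \int[mu]_x (q x * tent b e x) - \int[mu]_x (U (z x) * plateau a b e x).
  rewrite -(bsupp1_intB (nt a) (nt b)) -(bsupp1_intB (bsuppB (nt a) (nt b)) nU).
  by apply: eq_Rintegral => x _; rewrite mulrBr.
have : lo * \int[mu]_x plateau a b e x <= \int[mu]_x (U (z x) * plateau a b e x).
  rewrite -(bsupp1_intZ lo np); apply: bsupp1_int_le => //; first exact: bsuppZ.
  move=> x; have [xin|xout] := boolP (a - e <= x <= b + e); last first.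
    by rewrite plateau_eq0// !mulr0.
  rewrite ler_wpM2r ?plateau_ge0//; apply: Hlo.
  by move/andP: xin => [? ?]; apply/andP; split; lra.
by move=> h1 h2; apply: le_trans h1 _; rewrite -subr_ge0; exact: h2.
Unshelve. all: by end_near. Qed.

End entropy_decrease.

(** * The trace of the solution of the Riemann problem *)

(** The argument uses only the monotonicity of the entropy fluxes on a dense set
    [A], the two states at infinity and the trace. *)

Section sign_argument.
Context {R : realType}.
Local Notation f := (@flux R).
Implicit Types (a b c k x y e s u xi eta lo : R) (U F : R -> R).
Variables (A : set R) (z : R -> R) (v w K r : R).
Hypotheses (A_dense : forall a b, a < b -> exists xi, A xi /\ a < xi < b)
  (zK : forall x, `|z x| <= K)
  (decrease : forall U F a b lo e, convex_entropy_pair U F -> A a -> A b -> a <= b -> 0 < e ->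
     (forall x, a - e <= x <= b + e -> lo <= U (z x)) ->
     lo * (b - a) <= (F (z a) - a * U (z a)) - (F (z b) - b * U (z b)))
  (left_state : forall X eta, 0 < eta -> exists xi, [/\ A xi, xi < - X & `|z xi - v| < eta])
  (right_state : forall X eta, 0 < eta -> exists xi, [/\ A xi, X < xi & `|z xi - w| < eta])
  (vw : v <= w) (zr : z xi @[xi --> 0^'+] --> r).

(** The defect in the jump condition for a discontinuity of speed [x] between
    [z x] and [k]; for [z x != k] it vanishes exactly when [x] is the speed of that shock. *)
Definition slack k x := f (z x) - f k - x * (z x - k).

(** The affine entropies [s] and [- s] bound the decrease of [slack k] from both
    sides: the defect is continuous on [A] although [z] is not. *)
Lemma slack_lipschitz k a b : A a -> A b -> a <= b ->
  `|slack k a - slack k b| <= (K + `|k|) * (b - a).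
Proof.
move=> Aa Ab ab.
have zx x : - K <= z x <= K by rewrite -ler_norml.
have H1 : - K * (b - a) <= - 1 * f (z a) - a * (- 1 * z a) - (- 1 * f (z b) - b * (- 1 * z b)).
  apply: (decrease (entropy_pair_id (- 1)) Aa Ab ab ltr01) => x _.
  by have /andP[? ?] := zx x; lra.
have H2 : - K * (b - a) <= 1 * f (z a) - a * (1 * z a) - (1 * f (z b) - b * (1 * z b)).
  apply: (decrease (entropy_pair_id 1) Aa Ab ab ltr01) => x _.
  by have /andP[? ?] := zx x; lra.
have k1 : 0 <= (`|k| - k) * (b - a) by rewrite mulr_ge0 ?subr_ge0// ler_norm.
have k2 : 0 <= (`|k| + k) * (b - a).
  by rewrite mulr_ge0 ?subr_ge0//; have := ler_norm (- k); rewrite normrN; lra.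
by rewrite ler_norml /slack; apply/andP; split; lra.
Qed.

(** Kruzkov's entropies make the signed slack monotone. *)
Lemma signed_slack_nonincreasing k a b : A a -> A b -> a <= b ->
  Num.sg (z b - k) * slack k b <= Num.sg (z a - k) * slack k a.
Proof.
move=> Aa Ab ab; apply/ler_addgt0Pr => e e0.
pose eta := e / (2 + `|a| + `|b|).
have D0 : 0 < 2 + `|a| + `|b| by rewrite -addrA ltr_wpDr// addr_ge0.
have eta0 : 0 < eta by rewrite divr_gt0.
have [U [F [p U0 HU HF _]]] := kruzkov_pair k eta0.
have := decrease p Aa Ab ab ltr01 (lo := 0) (fun x _ => U0 (z x)).
have q x : `|(F (z x) - x * U (z x)) - Num.sg (z x - k) * slack k x| <= eta * (1 + `|x|).
  have -> : (F (z x) - x * U (z x)) - Num.sg (z x - k) * slack k x =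
      (F (z x) - Num.sg (z x - k) * (f (z x) - f k)) - x * (U (z x) - `|z x - k|).
    by rewrite normrEsg /slack; ring.
  apply: le_trans (ler_normB _ _) _; rewrite [leRHS]mulrDr mulr1 lerD ?HF// normrM mulrC.
  by rewrite ler_wpM2r// HU.
have Ee : e = eta * (1 + `|a|) + eta * (1 + `|b|) by rewrite /eta; field; rewrite gt_eqF.
have := q a; have := q b; rewrite !ler_norml => /andP[? ?] /andP[? ?].
lra.
Qed.

(** An intermediate value property: on the dense set [A] a Lipschitz function
    which changes sign takes arbitrarily small values. *)
Lemma slack_crossing k a b e : A a -> A b -> a < b -> slack k a * slack k b < 0 -> 0 < e ->
  exists c, [/\ A c, a <= c <= b & `|slack k c| <= e].
Proof.
move=> Aa Ab ab sab e0; set g := slack k in sab *.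
pose L := K + `|k|; have L0 : 0 <= L by rewrite addr_ge0// (le_trans (normr_ge0 _) (zK 0)).
have gL x y : A x -> A y -> x <= y -> `|g x - g y| <= L * (y - x) by exact: slack_lipschitz.
pose S := [set x | [/\ A x, a <= x <= b & 0 < g x * g a]].
have ga0 : g a != 0 by apply: contraTneq sab => ->; rewrite mul0r ltxx.
have Sa : S a by split; rewrite ?lexx ?ltW// -expr2 exprn_even_gt0.
have bS : ubound S b by move=> x [_ /andP[]].
have hS : has_sup S by split; [exists a|exists b].
have as_ : a <= sup S by apply: ub_le_sup => //; exists b.
have sb : sup S <= b by apply: ge_sup => //; exists a.
pose de := e / (2 * (L + 1)); have de0 : 0 < de by rewrite divr_gt0//; lra.
have [x Sx xs] := sup_adherent de0 hS; have [Ax /andP[ax xb] gx] := Sx.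
have xsup : x <= sup S by apply: ub_le_sup => //; exists b.
have [y [Ay xy yd gy]] : exists y, [/\ A y, x <= y, y <= x + 2 * de & g y * g a <= 0].
  move: sb; rewrite le_eqVlt => /predU1P[sb|sb].
    exists b; split=> //; [lra|].
    by rewrite mulrC ltW.
  have [|y [Ay /andP[y1 y2]]] := @A_dense (sup S) (Num.min b (sup S + de)).
    by rewrite lt_min sb ltrDl.
  move: y2; rewrite lt_min => /andP[y2 y3].
  exists y; split=> //; [lra|lra|].
  rewrite leNgt; apply/negP => gy; have := y1; rewrite ltNge => /negP; apply.
  by apply: ub_le_sup; [exists b|split => //; apply/andP; split; lra].
exists x; split=> //; first by rewrite ax.
have H := gL x y Ax Ay xy.
have {}H : `|g x - g y| <= e.
  apply: le_trans H _; have -> : e = (L + 1) * (2 * de) by rewrite /de; field; rewrite gt_eqF//; lra.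
  by apply: ler_pM => //; lra.
apply: le_trans H; have [ga|ga|/eqP] := ltgtP (g a) 0; last by rewrite (negbTE ga0).
- move: gx gy; rewrite nmulr_lgt0// nmulr_lle0// => gx gy.
  by rewrite !ler0_norm; lra.
- move: gx gy; rewrite pmulr_lgt0// pmulr_lle0// => gx gy.
  by rewrite !ger0_norm; lra.
Qed.

(** After a change of sign of [slack k] its signed version, being nonincreasing
    and having taken arbitrarily small values, is at most 0; before one it is at
    least 0. *)
Lemma signed_slack_le0 k a x : A a -> A x -> x < a -> slack k x * slack k a < 0 ->
  Num.sg (z a - k) * slack k a <= 0.
Proof.
move=> Aa Ax xa H; apply/ler_addgt0Pr => e e0; rewrite add0r.
have [c [Ac /andP[_ ca] ce]] := slack_crossing Ax Aa xa H e0.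
apply: le_trans (signed_slack_nonincreasing k Ac Aa ca) _.
apply: le_trans (ler_norm _) _; rewrite normrM normr_sg; apply: le_trans ce.
by case: (_ != 0); rewrite ?mul1r// mul0r.
Qed.

Lemma signed_slack_ge0 k a x : A a -> A x -> a < x -> slack k a * slack k x < 0 ->
  0 <= Num.sg (z a - k) * slack k a.
Proof.
move=> Aa Ax ax H; apply/ler_addgt0Pr => e e0.
have [c [Ac /andP[ac _] ce]] := slack_crossing Aa Ax ax H e0.
rewrite -lerBlDr sub0r; apply: le_trans (signed_slack_nonincreasing k Aa Ac ac).
rewrite lerNl; apply: le_trans (ler_norm _) _; rewrite normrN normrM normr_sg; apply: le_trans ce.
by case: (_ != 0); rewrite ?mul1r// mul0r.
Qed.

Let slackE k x : slack k x = (z x - k) * ((chord (z x) k - 3) / 2 - x).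
Proof. by rewrite /slack fluxB; field. Qed.

Let same_side (x y k : R) : `|x - y| < `|y - k| -> 0 < (x - k) * (y - k).
Proof.
have [h|h] := ltP (y - k) 0.
  by rewrite (ltr0_norm h) ltr_norml => /andP[? ?]; nra.
by rewrite (ger0_norm h) ltr_norml => /andP[? ?]; nra.
Qed.

(** Far to the left [slack k xi] is [z xi - k] times a positive number, and
    [z xi] is close to [v]. *)
Lemma slack_far_left k X : k != v -> exists xi, [/\ A xi, xi < X & 0 < slack k xi * (v - k)].
Proof.
move=> kv; have [L L0 HL] := flux_slope_bounded (Num.max K `|k|).
have vk : 0 < `|v - k| by rewrite normr_gt0 subr_eq0 eq_sym.
have [xi [Axi xiX zv]] := left_state (Num.max L (- X)) vk.
have /andP[xL xX] : (xi < - L) && (xi < X).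
  by move: xiX; rewrite oppr_max lt_min opprK.
exists xi; split=> //; rewrite slackE.
have /andP[S1 S2] : - L < (chord (z xi) k - 3) / 2 < L.
  by apply: HL; rewrite le_max ?zK// lexx orbT.
set T := _ / 2 in S1 S2 *; rewrite mulrAC pmulr_lgt0; last by lra.
exact: same_side.
Qed.

Lemma slack_far_right k X : k != w -> exists xi, [/\ A xi, X < xi & slack k xi * (w - k) < 0].
Proof.
move=> kw; have [L L0 HL] := flux_slope_bounded (Num.max K `|k|).
have wk : 0 < `|w - k| by rewrite normr_gt0 subr_eq0 eq_sym.
have [xi [Axi xiX zw]] := right_state (Num.max L X) wk.
move: xiX; rewrite gt_max => /andP[xL xX].
exists xi; split=> //; rewrite slackE.
have /andP[S1 S2] : - L < (chord (z xi) k - 3) / 2 < L.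
  by apply: HL; rewrite le_max ?zK// lexx orbT.
set T := _ / 2 in S1 S2 *; rewrite mulrAC pmulr_rlt0; first by lra.
exact: same_side.
Qed.

(** For [k] between the data, [slack k] is negative somewhere far on both sides.
    If it were positive at [a] it would change sign before and after [a], the
    signed version would vanish at [a], and so would [slack k]. *)
Lemma slack_le0 k a : v < k < w -> A a -> slack k a <= 0.
Proof.
move=> /andP[vk kw] Aa; rewrite leNgt; apply/negP => da.
have [x1 [A1 x1a]] := @slack_far_left k a (negbT (gt_eqF vk)).
have [x2 [A2 ax2]] := @slack_far_right k a (negbT (lt_eqF kw)).
rewrite (pmulr_llt0 _ (_ : 0 < w - k)); last by rewrite subr_gt0.
rewrite (nmulr_lgt0 _ (_ : v - k < 0)); last by rewrite subr_lt0.
move=> d2 d1.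
have q0 : Num.sg (z a - k) * slack k a = 0.
  apply/le_anti/andP; split.
    by apply: signed_slack_le0 Aa A1 x1a _; rewrite pmulr_llt0.
  by apply: signed_slack_ge0 Aa A2 ax2 _; rewrite pmulr_rlt0.
move/eqP: q0; rewrite mulf_eq0 (gt_eqF da) orbF sgr_eq0 subr_eq0 => /eqP zk.
by move: da; rewrite /slack zk !subrr mulr0 subrr ltxx.
Qed.

(** For [k] below both data, [slack k] is positive far on the left and negative
    far on the right, while a value of [z] below [k] reverses the sign of the
    signed version: a nonzero [slack k a] contradicts its monotonicity. *)
Lemma slack_eq0_below k a : k < v -> A a -> z a < k -> slack k a = 0.
Proof.
move=> kv Aa zak; have kw : k < w by apply: lt_le_trans vw.
have [x1 [A1 x1a]] := @slack_far_left k a (negbT (lt_eqF kv)).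
have [x2 [A2 ax2]] := @slack_far_right k a (negbT (lt_eqF kw)).
rewrite (pmulr_llt0 _ (_ : 0 < w - k)); last by rewrite subr_gt0.
rewrite (pmulr_lgt0 _ (_ : 0 < v - k)); last by rewrite subr_gt0.
move=> d2 d1.
have sgz : Num.sg (z a - k) = - 1 by rewrite ltr0_sg// subr_lt0.
have [da|da|//] := ltgtP (slack k a) 0.
- have := @signed_slack_le0 k a x1 Aa A1 x1a; rewrite (pmulr_rlt0 _ d1) => /(_ da).
  by rewrite sgz; lra.
- have := @signed_slack_ge0 k a x2 Aa A2 ax2; rewrite (pmulr_rlt0 _ da) => /(_ d2).
  by rewrite sgz; lra.
Qed.

Lemma slack_eq0_above k a : w < k -> A a -> k < z a -> slack k a = 0.
Proof.
move=> wk Aa zak; have vk : v < k by apply: le_lt_trans wk.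
have [x1 [A1 x1a]] := @slack_far_left k a (negbT (gt_eqF vk)).
have [x2 [A2 ax2]] := @slack_far_right k a (negbT (gt_eqF wk)).
rewrite (nmulr_llt0 _ (_ : w - k < 0)); last by rewrite subr_lt0.
rewrite (nmulr_lgt0 _ (_ : v - k < 0)); last by rewrite subr_lt0.
move=> d2 d1.
have sgz : Num.sg (z a - k) = 1 by rewrite gtr0_sg// subr_gt0.
have [da|da|//] := ltgtP (slack k a) 0.
- have := @signed_slack_ge0 k a x2 Aa A2 ax2; rewrite (nmulr_rlt0 _ da) => /(_ d2).
  by rewrite sgz; lra.
- have := @signed_slack_le0 k a x1 Aa A1 x1a; rewrite (nmulr_rlt0 _ d1) => /(_ da).
  by rewrite sgz; lra.
Qed.

(** The flux has no affine piece: three chords with a common end point have at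
    most two equal slopes. *)
Lemma slack_not_eq0 a x y : x < y -> ~ (forall k, x < k < y -> z a != k /\ slack k a = 0).
Proof.
move=> xy H; set s := z a in H.
have C (t : R) : 0 < t < 1 -> (chord s (x + t * (y - x)) - 3) / 2 = a.
  move=> /andP[t0 t1]; have [|/eqP sk] := H (x + t * (y - x)); first by apply/andP; split; nra.
  rewrite slackE => /eqP; rewrite mulf_eq0 subr_eq0 => /orP[/eqP //|].
  by rewrite subr_eq0 => /eqP.
have h : 0 < (y - x) ^+ 2 by rewrite exprn_gt0// subr_gt0.
have c1 : (chord s (x + 1 / 4 * (y - x)) - 3) / 2 = a by apply: C; lra.
have c2 : (chord s (x + 1 / 2 * (y - x)) - 3) / 2 = a by apply: C; lra.
have c3 : (chord s (x + 3 / 4 * (y - x)) - 3) / 2 = a by apply: C; lra.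
by move: c1 c2 c3 h; rewrite /chord !expr2; lra.
Qed.

(** A value below the data would make the flux affine between it and the data. *)
Lemma self_similar_between a : A a -> v <= z a <= w.
Proof.
move=> Aa; apply/andP; split; rewrite leNgt; apply/negP => h.
- apply: (@slack_not_eq0 a _ _ h) => k /andP[zk kv]; split; first by rewrite (lt_eqF zk).
  exact: slack_eq0_below.
- apply: (@slack_not_eq0 a _ _ h) => k /andP[wk kz]; split; first by rewrite (gt_eqF kz).
  exact: slack_eq0_above.
Qed.

(** The trace is reached along [A]. *)
Lemma near_trace (P : R -> Prop) : (\forall x \near 0^'+, P x) -> exists a, [/\ A a, 0 < a & P a].
Proof.
move=> [e /= e0 H]; have [a [Aa /andP[a0 ae]]] := A_dense e0.
by exists a; split=> //; apply: H => //=; rewrite sub0r normrN gtr0_norm.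
Qed.

Lemma trace_between : v <= r <= w.
Proof.
apply/andP; split; rewrite leNgt; apply/negP => h.
- have [a [Aa _]] := near_trace (cvgr_lt _ zr _ h).
  by have /andP[va _] := self_similar_between Aa; rewrite ltNge va.
- have [a [Aa _]] := near_trace (cvgr_gt _ zr _ h).
  by have /andP[_ aw] := self_similar_between Aa; rewrite ltNge aw.
Qed.

Lemma slack_le0_closed k a : v < w -> v <= k <= w -> A a -> slack k a <= 0.
Proof.
move=> vltw /andP[vk kw] Aa; rewrite leNgt; apply/negP => da.
have ck : continuous (fun k => slack k a).
  move=> s; apply: cvgB; first by apply: cvgB; [exact: cvg_cst|exact: continuous_flux].
  by apply: cvgM; [exact: cvg_cst|apply: cvgB; [exact: cvg_cst|exact: cvg_id]].
have [e /= e0 H] := cvgr_gt _ (ck k) _ da.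
(* Moving [k] towards the middle of the data leaves the end points. *)
pose m := (v + w) / 2; pose t := Num.min (1 / 2) (e / (2 * (w - v))).
have t0 : 0 < t by rewrite lt_min divr_gt0 ?divr_gt0//; lra.
have t1 : t <= 1 / 2 by rewrite ge_min lexx.
have te : t * (2 * (w - v)) <= e.
  by rewrite -ler_pdivlMr ?ge_min ?lexx ?orbT//; lra.
have : 0 < slack (k + t * (m - k)) a.
  apply: H; rewrite /= opprD addNKr normrN normrM gtr0_norm//.
  have : `|m - k| <= w - v by rewrite ler_norml /m; apply/andP; split; lra.
  by have := normr_ge0 (m - k); nra.
rewrite ltNge slack_le0//; rewrite /m; apply/andP; split; nra.
Qed.

Lemma flux_trace_le k : v <= k <= w -> f r <= f k.
Proof.
have /andP[vr rw] := trace_between.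
move=> /andP[vk kw]; have [vltw|wv] := ltP v w; last first.
  by have -> : r = k by lra.
rewrite leNgt; apply/negP => fk.
have cf : f (z x) @[x --> 0^'+] --> f r.
  exact: (cvg_comp _ _ zr (@continuous_flux R r)).
have cx : x @[x --> (0 : R)^'+] --> (0 : R) by apply: cvg_at_right_filter; exact: cvg_id.
have cs : slack k x @[x --> 0^'+] --> f r - f k - 0 * (r - k).
  exact: (cvgB (cvgB cf (cvg_cst (f k))) (cvgM cx (cvgB zr (cvg_cst k)))).
have h : 0 < f r - f k - 0 * (r - k) by lra.
have [a [Aa _]] := near_trace (cvgr_gt _ cs _ h).
by rewrite ltNge slack_le0_closed ?vk.
Qed.

(** If a minimiser [k] of the flux were larger than the trace, [slack k <= 0] at
    small positive speeds would make [f (z a)] smaller than the minimum. *)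
Lemma flux_trace_tie k : v <= k <= w -> f k = f r -> k <= r.
Proof.
move=> vkw fk; rewrite leNgt; apply/negP => rk.
have /andP[vr rw] := trace_between; have /andP[vk kw] := vkw.
have [a [Aa a0 zk]] := near_trace (cvgr_lt _ zr _ rk).
have vltw : v < w by lra.
have := slack_le0_closed vltw vkw Aa; rewrite /slack.
have := flux_trace_le (self_similar_between Aa).
have : 0 < a * (k - z a) by rewrite mulr_gt0 ?subr_gt0.
lra.
Qed.

End sign_argument.

Section riemann_uniqueness.
Context {R : realType}.
Local Notation mu := (@lebesgue_measure R).
Local Notation RR := (measurableTypeR R * measurableTypeR R)%type.
Local Notation f := (@flux R).
Implicit Types (t x xi v w r c X eta : R) (z : R -> R).

Lemma measurable_half_plane : measurable (@half_plane R : set RR).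
Proof.
have -> : (@half_plane R : set RR) = setT `&` (fst : RR -> measurableTypeR R) @^-1` `]0, +oo[%classic.
  by apply/seteqP; split=> [[t x]|[t x]] /=; rewrite in_itv/= andbT //; case.
exact: (measurable_fst measurableT).
Qed.

Lemma entropy_solution_measurable z (u0 : R -> R) :
  entropy_solution (fun t x => z (x / t)) u0 -> measurable_fun setT z.
Proof.
move=> [mz _ _ _]; have -> : z = (fun p : RR => z (p.2 / p.1)) \o (fun x => (1, x)).
  by apply/funext => x /=; rewrite divr1.
apply: (measurable_comp measurable_half_plane _ mz).
  by move=> _ [x _ <-]; exact: ltr01.
exact: measurable_pair1.
Qed.

Lemma entropy_solution_bounded z (u0 : R -> R) :
  entropy_solution (fun t x => z (x / t)) u0 -> exists K, forall xi, `|z xi| <= K.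
Proof.
by move=> [_ [K zK] _ _]; exists K => xi; have := zK 1 xi ltr01; rewrite divr1.
Qed.

Lemma bounded_lebesgue_pt z K : measurable_fun setT z -> (forall x, `|z x| <= K) ->
  {ae mu, forall x, lebesgue_pt z x}.
Proof.
move=> mz zK; apply: lebesgue_differentiation; split=> //; first exact: openT.
move=> C _ cC; have mC : measurable C by exact: compact_measurable.
have /integrableP[_] : mu.-integrable C (EFin \o z).
  apply: measurable_bounded_integrable => //.
  - exact: compact_finite_measure.
  - exact: measurable_funTS.
  - exists K; split; first exact: num_real.
    by move=> L KL x _ /=; rewrite (le_trans (zK x))// ltW.
by [].
Qed.

Lemma ae_exists (P : R -> Prop) (D : set R) : {ae mu, forall x, P x} -> measurable D ->
  (0 < mu D)%E -> exists x, D x /\ P x.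
Proof.
move=> [N [mN N0 PN]] mD D0; apply: contrapT => H.
have : (mu D <= mu N)%E.
  apply: le_measure; rewrite ?inE// => x Dx; apply: PN => Px; apply: H.
  by exists x.
by rewrite N0 leNgt D0.
Qed.

(** A dilation multiplies the measure of a set by a constant. *)
Lemma ae_dilation (P : R -> Prop) t : 0 < t -> {ae mu, forall x, P x} ->
  {ae mu, forall x, P (x / t)}.
Proof.
move=> t0 [N [mN N0 PN]]; have ti : 0 < t^-1 by rewrite invr_gt0.
exists ((fun x => t^-1 * x + 0) @^-1` N); split.
- rewrite -[X in measurable X]setTI.
  have m : measurable_fun setT (fun x : measurableTypeR R => t^-1 * x + 0 : measurableTypeR R).
    by apply: measurable_funD => //; exact: mulrl_measurable.
  exact: m.
- have := lebesgue_measure_affine 0 ti mN; rewrite N0 => /esym/eqP.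
  by rewrite mule_eq0 eqe (gt_eqF ti)/= => /eqP.
- by move=> x /= H; apply: PN; rewrite addr0 mulrC.
Qed.

(** If [z] stayed away from [c] on the points of [G] where [P] holds, then for
    small [t] the integral over [D] of the distance to the initial datum would
    stay away from 0. *)
Lemma far_state z (u0 : R -> R) c eta (D G : set R) (P : R -> Prop) :
  entropy_solution (fun t x => z (x / t)) u0 -> {ae mu, forall x, P x} ->
  measurable D -> D `<=` `[- 1, 1]%classic -> mu D = (2^-1)%:E -> (forall x, D x -> u0 x = c) ->
  measurable_fun setT u0 ->
  (\forall t \near 0^'+, forall x, D x -> G (x / t)) -> 0 < eta ->
  exists xi, [/\ P xi, G xi & `|z xi - c| < eta].
Proof.
move=> es aP mD D1 muD u0c mu0 nG eta0; apply: contrapT => H.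
have mz := entropy_solution_measurable es; have [_ _ _ /(_ 1 ltr01) iz] := es.
have : ((eta * 2^-1)%:E <= 0 :> \bar R)%E; last by rewrite lee_fin leNgt mulr_gt0.
apply: (cvge_to_ge iz); near=> t; have t0 : 0 < t by near: t; exact: nbhs_right_gt.
have Gt : forall x, D x -> G (x / t) by near: t; exact: nG.
have mg : measurable_fun setT (fun x => (`|z (x / t) - u0 x|)%:E).
  apply/measurable_EFinP; apply: (measurableT_comp (@normr_measurable R setT)).
  apply: measurable_funB => //.
  by apply: (measurableT_comp mz); exact: mulrr_measurable.
have mI : measurable (`[- 1, 1]%classic : set R) by exact: measurable_itv.
apply: (@le_trans _ _ (\int[mu]_(x in D) (`|z (x / t) - u0 x|)%:E)%E); last first.
  by apply: ge0_subset_integral => //; exact: measurable_funTS.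
rewrite EFinM -muD -integral_cst//; apply: ae_ge0_le_integral => //.
- by move=> x _; rewrite /= lee_fin ltW.
- exact: measurable_funTS.
have [N [mN N0 PN]] := ae_dilation t0 aP; exists N; split=> //; apply: subset_trans PN => x nx Px.
apply: nx => Dx; rewrite lee_fin u0c// leNgt.
by apply/negP => h; apply: H; exists (x / t); split=> //; exact: Gt.
Unshelve. all: by end_near. Qed.

Let small_time t X : 0 < t -> t <= 1 / (2 * (`|X| + 1)) -> `|X| * t < 1 / 2.
Proof.
have h : 0 < `|X| + 1 by rewrite ltr_wpDl.
move=> t0; rewrite ler_pdivlMr ?mulr_gt0//; lra.
Qed.

Lemma riemann_trace_interface_le v w r : v <= w -> riemann_trace v w r ->
  v <= r <= w /\ forall s, v <= s <= w -> f r <= f s /\ (f s = f r -> s <= r).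
Proof.
move=> vw [z [es zr]].
have mz := entropy_solution_measurable es; have [K zK] := entropy_solution_bounded es.
have aeA := bounded_lebesgue_pt mz zK; pose A : set R := [set x | lebesgue_pt z x].
have mu0 : measurable_fun setT (fun x : R => if x < 0 then v else w).
  by apply: measurable_fun_ifT => //=; apply: measurable_fun_ltr.
have A_dense (a b : R) : a < b -> exists xi, A xi /\ a < xi < b.
  move=> ab; have [||xi [h ?]] := ae_exists (D := `]a, b[%classic) aeA.
  - exact: measurable_itv.
  - by rewrite lebesgue_measure_itv/= lte_fin ab -EFinB lte_fin subr_gt0.
  - by exists xi; split=> //; move: h; rewrite /= in_itv.
have left_state X eta : 0 < eta -> exists xi, [/\ A xi, xi < - X & `|z xi - v| < eta].
  move=> eta0; pose G := [set xi : R | xi < - X].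
  apply: (far_state (D := `[- 1, - 2^-1]%classic) (G := G) es aeA) => //.
  - by move=> x; rewrite /= !in_itv/= => /andP[? ?]; apply/andP; split; lra.
  - have h : - 1 < - 2^-1 :> R by lra.
    by rewrite lebesgue_measure_itv/= lte_fin h -EFinB; congr EFin; lra.
  - by move=> x; rewrite /= in_itv/= => /andP[_ ?]; rewrite (_ : x < 0 = true)//; lra.
  - near=> t => x; rewrite /= in_itv/= => /andP[_ x2].
    have t0 : 0 < t by near: t; exact: nbhs_right_gt.
    have tX : t <= 1 / (2 * (`|X| + 1)).
      by near: t; apply: nbhs_right_le; rewrite divr_gt0// mulr_gt0// ltr_wpDl.
    have Xt := small_time t0 tX; have := ler_norm X.
    by rewrite /G/= ltr_pdivrMr//; nra.
have right_state X eta : 0 < eta -> exists xi, [/\ A xi, X < xi & `|z xi - w| < eta].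
  move=> eta0; pose G := [set xi : R | X < xi].
  apply: (far_state (D := `[2^-1, 1]%classic) (G := G) es aeA) => //.
  - by move=> x; rewrite /= !in_itv/= => /andP[? ?]; apply/andP; split; lra.
  - have h : 2^-1 < 1 :> R by lra.
    by rewrite lebesgue_measure_itv/= lte_fin h -EFinB; congr EFin; lra.
  - by move=> x; rewrite /= in_itv/= => /andP[? _]; rewrite (_ : x < 0 = false)//; lra.
  - near=> t => x; rewrite /= in_itv/= => /andP[x2 _].
    have t0 : 0 < t by near: t; exact: nbhs_right_gt.
    have tX : t <= 1 / (2 * (`|X| + 1)).
      by near: t; apply: nbhs_right_le; rewrite divr_gt0// mulr_gt0// ltr_wpDl.
    have Xt := small_time t0 tX; have := ler_norm X.
    by rewrite /G/= ltr_pdivlMr//; nra.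
have dec := fun U F a b lo e p Aa Ab => @entropy_decrease R z _ K es mz zK U F a b lo e p Aa Ab.
split; first exact: (trace_between A_dense zK dec left_state right_state vw zr).
move=> s vsw; split.
  exact: (flux_trace_le A_dense zK dec left_state right_state vw zr vsw).
exact: (flux_trace_tie A_dense zK dec left_state right_state vw zr vsw).
Unshelve. all: by end_near. Qed.

Lemma riemann_trace_interface_state v w r : riemann_trace v w r -> interface_state v w r.
Proof.
move=> H; split=> [vw|wv]; first exact: riemann_trace_interface_le.
have [|/andP[h1 h2] h] := @riemann_trace_interface_le (- v) (- w) (- r) _ (riemann_trace_opp H).
  by rewrite lerN2.
rewrite !lerN2 in h1 h2; split; first by rewrite h1 h2.
move=> s /andP[s1 s2]; have [|h3 h4] := h (- s); first by rewrite !lerN2 s1 s2.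
rewrite !fluxN lerN2 in h3; split=> // E; rewrite -lerN2; apply: h4.
by rewrite !fluxN E.
Qed.

Lemma riemann_value_interface_state v w : interface_state v w (riemann_value v w).
Proof. exact: riemann_trace_interface_state (xgetPex 0 (riemann_exists v w)). Qed.

End riemann_uniqueness.

(** * The condition on the mesh ratio, and the conclusion *)

(** The supremum of [|f'|] is attained at [8 * M], hence the bound in the sections
    on the Lax-Friedrichs schemes. *)
Lemma sup_flux'_ge (R : realType) (M : R) : 2 < M -> (3 * (8 * M) ^+ 2 - 3) / 2 <= sup_flux' M.
Proof.
move=> M2; pose D x := `|derive1 (@flux R) x|.
have M8 : 16 * 16 <= (8 * M) ^+ 2 by rewrite expr2; nra.
have h : (3 * (8 * M) ^+ 2 - 3) / 2 = D (8 * M).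
  by rewrite /D derive1_flux /flux_deriv ger0_norm//; lra.
rewrite h; apply: ub_le_sup; last by exists (8 * M) => //; rewrite /= in_itv/=; apply/andP; split; lra.
exists ((3 * (8 * M) ^+ 2 + 3) / 2) => _ [x /= + <-]; rewrite in_itv/= => /andP[? ?].
by rewrite derive1_flux /flux_deriv ler_norml; apply/andP; split; nra.
Qed.

Unset Implicit Arguments.

Theorem theorem4p2 (R : realType) :
  (forall uB : R,
     [/\ E_riemann uB = E_formula uB,
         E_entropy_viscosity setT uB = E_riemann uB,
         E_layer_scheme setT (@godunov_flux R) uB = E_riemann uB,
         E_entropy_scheme setT (@godunov_entropy_flux R) uB = E_riemann uB
       & forall B : R -> R, smooth B -> (forall u, 0 < B u) ->
         E_layer_viscosity setT B uB = E_riemann uB `\` E_exc uB])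
  /\
  (forall M : R, 2 < M ->
   forall Q lambda : R, 0 < Q < 1 -> 0 < lambda ->
   sup_flux' M * lambda / Q <= 1 ->
   forall uB : R, - M <= uB <= M ->
     E_layer_scheme `[- M, M] (lax_flux Q lambda) uB `&` `[- M, M]
       = (E_riemann uB `&` `[- M, M]) `\` E_exc uB
     /\
     E_entropy_scheme `[- M, M] (lax_entropy_flux Q lambda) uB `&` `[- M, M]
       = E_riemann uB `&` `[- M, M]).
Proof.
have rvP := @riemann_value_interface_state R.
have ER (uB : R) : E_riemann uB = [set u0 | bln uB u0] by exact: (range_rv_bln rvP uB).
split=> [uB|M M2 Q lambda /andP[Q0 _] l0 cfl uB uBM].
  split.
  - by rewrite ER E_formula_bln.
  - by rewrite ER E_entropy_viscosity_bln.
  - by rewrite ER; exact: (godunov_layer rvP uB).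
  - by rewrite ER; exact: (godunov_entropy rvP uB).
  - move=> B sB B0; rewrite (E_layer_viscosity_bln uB sB B0) ER -E_formula_bln.
    by rewrite E_exc_strict_bln.
have c0 : (3 * (8 * M) ^+ 2 - 3) / 2 <= Q / lambda.
  apply: le_trans (sup_flux'_ge M2) _.
  by rewrite ler_pdivlMr//; rewrite ler_pdivrMr// mul1r in cfl.
have gE (x y : R) : lax_flux Q lambda x y =
    (flux x / 2 + Q / lambda * x) - (Q / lambda * y - flux y / 2).
  by rewrite /lax_flux; field; rewrite gt_eqF.
have layer u0 uM := @lax_layer R M _ _ M2 c0 gE uB u0 uBM uM.
have entropy u0 uM := @lax_entropy_bln R M _ M2 c0 uB u0 uBM uM.
have strict (u0 : R) : strict_bln uB u0 <-> bln uB u0 /\ ~ E_exc uB u0.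
  have : [set u0 | strict_bln uB u0] u0 = (E_formula uB `\` E_exc uB) u0.
    by rewrite E_exc_strict_bln.
  by rewrite E_formula_bln /= => ->.
rewrite ER; split; apply/seteqP; split=> u0 /=; rewrite !in_itv/=.
- by move=> [/layer +] uM => /(_ uM)/strict[].
- by move=> [[b uM] nE]; split=> //; apply/(layer _ uM)/strict.
- move=> [[_ [v1 [v1M H]]] uM]; split=> //; apply/(entropy _ uM).
  by exists v1; rewrite /= in_itv/= in v1M.
- move=> [b uM]; split=> //; split; first by rewrite /= in_itv.
  have [v1 [v1M H]] := (entropy _ uM).2 b.
  by exists v1; split; [rewrite /= in_itv|exact: H].
Qed.
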